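(* Suppose that the mesh condition $$C_0\max_j h_{T^{n,i}_j}\le\varepsilon^n_i\le C_1\max_j h_{T^{n,i}_j},\qquad \tau^n\le C_2\min_{i,j}|E^{n,i}_j|$$ is satisfied for all $n$ and $i$. Then there exists a constant $C_3>0$ depending only on $\gamma$, $L_{H,2}$ such that $$\left|\frac{\varphi_i^{n+1}-[S_h^n(I_h^n\varphi)]_i}{\tau^n}-\bigl\{\partial^\bullet\varphi(x_i^n,t^n)+H(x_i^n,t^n,\nabla_\Gamma\varphi(x_i^n,t^n))\bigr\}\right|\le C_3h\left(\|\nabla_\Gamma\varphi\|_{B(\overline{S_T})}+\|\nabla_\Gamma^2\varphi\|_{B(\overline{S_T})}+\|(\partial^\bullet)^2\varphi\|_{B(\overline{S_T})}\right)$$ for all $\varphi\in C^2(\overline{S_T})$, $n=0,1,\dots,N-1$, and $i=1,\dots,M$, where $\varphi_i^n=\varphi(x_i^n,t^n)$, $I_h^n\varphi=\sum_{i=1}^M\varphi_i^n\chi_i(\cdot,t^n)\in V_h^n$, and $(\partial^\bullet)^2\varphi$ is the second-order material derivative of $\varphi$.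
   Context: Evolving surface (fixed throughout; constants may depend on it). $\Gamma_0\subset\mathbb{R}^3$ is a closed (compact, without boundary), connected, oriented, smooth hypersurface, $T>0$, and $\Phi:\Gamma_0\times[0,T]\to\mathbb{R}^3$ is a smooth flow map such that $\Phi(\cdot,t)$ is a diffeomorphism of $\Gamma_0$ onto a hypersurface $\Gamma(t)$, with $\Phi(X,0)=X$ and $\partial_t\Phi(X,t)=v_\Gamma(\Phi(X,t),t)$, $v_\Gamma\in C^1(\overline{S_T})$, where $\overline{S_T}=\bigcup_{t\in[0,T]}\Gamma(t)\times\{t\}$. $d(\cdot,t)$ is the signed distance function to $\Gamma(t)$ increasing in the direction of the unit outward normal $\nu(\cdot,t)$, and $\pi(x,t)\in\Gamma(t)$ is the unique point with $x=\pi(x,t)+d(x,t)\nu(\pi(x,t),t)$, for $x$ in a suitable neighbourhood $N(t)$ of $\Gamma(t)$. $\nabla_\Gamma f=(I_3-\nu\otimes\nu)\nabla\tilde f$ is the tangential gradient ($\tilde f$ any smooth extension of $f$), $\nabla_\Gamma^2f$ the matrix of second tangential derivatives, and $\partial^\bullet f$ the material derivative, $\partial^\bullet f(\Phi(X,t),t)=\frac{d}{dt}\bigl(f(\Phi(X,t),t)\bigr)$. $\|f\|_{B(D)}=\sup_{D}|f|$. Hamiltonian. $H:\overline{S_T}\times\mathbb{R}^3\to\mathbb{R}$ satisfies, with positive constants $L_{H,1},L_{H,2}$, for all $(x,t),(y,s)\in\overline{S_T}$, $p,q\in\mathbb{R}^3$: $|H(x,t,p)-H(y,s,p)|\le L_{H,1}(|x-y|+|t-s|)(1+|p|)$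 and $|H(x,t,p)-H(x,t,q)|\le L_{H,2}|p-q|$. Triangulations. For $0<h<h_*$ let $\mathcal{T}_h(t)$ be a triangulation with polyhedral surface $\Gamma_h(t)=\bigcup_{K(t)\in\mathcal{T}_h(t)}K(t)$ (flat triangles), $h=\max_{t\in[0,T]}\max_{K(t)}h_{K(t)}$, $h_{K(t)}=\operatorname{diam}K(t)$. The $M$ vertices $x_i(t)=\Phi(x_i^0,t)\in\Gamma(t)$ are moved by the flow map, with connectivity fixed in time. $h_*$ is small enough that $\Gamma_h(t)\subset N(t)$, and $\pi_h(\cdot,t)=\pi(\cdot,t)|_{\Gamma_h(t)}$ is assumed to be a homeomorphism onto $\Gamma(t)$. Regularity: there is $\gamma>0$ with $h_{K(t)}\le\gamma\rho_{K(t)}$ for all $t\in[0,T]$ and $K(t)\in\mathcal{T}_h(t)$ (and all $h$), where $\rho_{K(t)}$ is the radius of the largest circle contained in $K(t)$. $V_h(t)$ is the space of continuous functions on $\Gamma_h(t)$, affine on each triangle, with nodal basis $\chi_i(\cdot,t)$, $\chi_i(x_j(t),t)=\delta_{ij}$. Scheme. Let $0=t^0<t^1<\dots<t^N=T$, $\tau^n=t^{n+1}-t^n$, $x_i^n=x_i(t^n)$, $V_h^n=V_h(t^n)$. Let $\Upsilon_i$ be the number of triangles with common vertex $i$, and let $i_1,\dots,i_{\Upsilon_i}$ be the other vertices of these triangles, enumerated cyclically in clockwise direction (indices $j$ cyclic modulo $\Upsilon_i$). $T_j^{n,i}\in\mathcal{T}_h(t^n)$ is the triangle with vertices $i,i_j,i_{j+1}$,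 $h_{T_j^{n,i}}$ its diameter, and $E_j^{n,i}$ (length $|E_j^{n,i}|$) the edge joining $i$ and $i_j$. Let $d_j^{n,i}$ be the distance from vertex $i$ to the contact point on $E_j^{n,i}$ of the inscribed circle of $T_j^{n,i}$ and $d^{n,i}=\min_j d_j^{n,i}$. The volume $V^{n,i}\subset\Gamma_h(t^n)$ is the polygonal region around $i$ bounded by line segments perpendicular to the edges $E_j^{n,i}$ at distance $d^{n,i}$ from vertex $i$; i.e. $V^{n,i}\cap T_j^{n,i}$ is the quadrilateral in $T_j^{n,i}$ whose vertices are $x_i^n$, the points of $E_j^{n,i}$ and $E_{j+1}^{n,i}$ at distance $d^{n,i}$ from $x_i^n$, and the intersection of the perpendiculars to these edges (in the plane of $T_j^{n,i}$) at those points. $h_{j,L}^{n,i}$ and $h_{j,R}^{n,i}$ are the lengths of the parts of the boundary of $V^{n,i}$ perpendicular to $E_j^{n,i}$ lying in $T_{j-1}^{n,i}$ and $T_j^{n,i}$, respectively. $|\cdot|$ of a two-dimensional set is its area, $\varepsilon_i^n>0$ are parameters, and $\nabla_{\Gamma_h}u_h|_{T}$ is the (constant) tangential gradient of $u_h$ on the flat triangle $T$. For $u_h^n=\sum_iu_i^n\chi_i(\cdot,t^n)\in V_h^n$ and $n\in\{0,\dots,N-1\}$ define $S_h^n(u_h^n)=\sum_{i=1}^M[S_h^n(u_h^n)]_i\,\chi_i(\cdot,t^{n+1})\in V_h^{n+1}$ with $$[S_h^n(u_h^n)]_i=u_i^n-\tau^n\Bigl\{\sum_{j=1}^{\Upsilon_i}\tfrac{|V^{n,i}\cap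 T_j^{n,i}|}{|V^{n,i}|}H\bigl(x_i^n,t^n,\nabla_{\Gamma_h}u_h^n|_{T_j^{n,i}}\bigr)-\tfrac{\varepsilon_i^n}{|V^{n,i}|}\sum_{j=1}^{\Upsilon_i}\tfrac{u_{i_j}^n-u_i^n}{|E_j^{n,i}|}(h_{j,L}^{n,i}+h_{j,R}^{n,i})\Bigr\}.$$ Constants in the mesh condition. $C_0,C_1,C_2>0$ are fixed constants depending only on $\gamma$ and $L_{H,2}$ for which the mesh condition implies monotonicity of the scheme: $u_h^n\le v_h^n$ on $\Gamma_h(t^n)$ implies $S_h^n(u_h^n)\le S_h^n(v_h^n)$ on $\Gamma_h(t^{n+1})$, for $u_h^n,v_h^n\in V_h^n$. *)

(* Defs.v *)
From HB Require Import structures.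
From mathcomp Require Import all_boot all_order all_algebra.
From mathcomp Require Import all_classical all_reals all_analysis.
Set Implicit Arguments.
Unset Strict Implicit.
Unset Printing Implicit Defensive.
Import Order.TTheory GRing.Theory Num.Theory.
Import numFieldNormedType.Exports.
Local Open Scope classical_set_scope.
Local Open Scope ring_scope.

(* The library norm on 'rV[R]_3 is the sup norm (it is used for the topology
   only); every length below is measured with the Euclidean norm [enorm]. *)

Definition dot (R : realType) (n : nat) (u v : 'rV[R]_n) : R :=
  \sum_k u 0 k * v 0 k.

Definition enorm (R : realType) (n : nat) (u : 'rV[R]_n) : R :=
  Num.sqrt (dot u u).

Definition frobenius (R : realType) (A : 'M[R]_3) : R :=
  Num.sqrt (\sum_i \sum_j A i j ^+ 2).

(* The indices k + 1 and k + 2 are taken modulo 3. *)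
Definition cross (R : realType) (u v : 'rV[R]_3) : 'rV[R]_3 :=
  \row_(k < 3) (u 0 (k + 1) * v 0 (k + 2%:R) - u 0 (k + 2%:R) * v 0 (k + 1)).

Definition tproj (R : realType) (n g : 'rV[R]_3) : 'rV[R]_3 :=
  g - dot g n *: n.

Definition grad (R : realType) (f : 'rV[R]_3 -> R) (x : 'rV[R]_3) : 'rV[R]_3 :=
  \row_(k < 3) 'D_(delta_mx 0 k) f x.

Definition diam (R : realType) (A : set 'rV[R]_3) : R :=
  sup [set enorm (p.1 - p.2) | p in A `*` A].

(* Used only for nonnegative entries. *)
Definition seqmax (R : realType) (s : seq R) : R := \big[Num.max/0]_(a <- s) a.

(* Used only for nonempty sequences. *)
Definition seqmin (R : realType) (s : seq R) : R :=
  \big[Num.min/head 0 s]_(a <- s) a.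

Definition sup_norm (R : realType) (T : Type) (D : set T) (f : T -> R) :
    \bar R :=
  ereal_sup [set `|f p|%:E | p in D].

(* For finite-dimensional V, asking for all the directional derivatives amounts
   to asking for all the partial derivatives. *)
Fixpoint Ck (R : realType) (V W : normedModType R) (k : nat) (U : set V)
    (f : V -> W) : Prop :=
  match k with
  | 0 => forall x, U x -> {for x, continuous f}
  | k'.+1 => (forall x, U x -> differentiable f x) /\
             (forall v : V, Ck k' U (fun x => 'D_v f x))
  end.

Definition smooth (R : realType) (V W : normedModType R) (U : set V)
    (f : V -> W) : Prop := forall k, Ck k U f.

(* Regularity on a set that need not be open (a submanifold, possibly with
   boundary) means that the function has local extensions of that regularity. *)
Definition Ck_on (R : realType) (V W : normedModType R) (k : nat) (A : set V)
    (f : V -> W) : Prop :=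
  forall x, A x -> exists (U : set V) (g : V -> W),
    [/\ open U, U x, Ck k U g & forall y, A y -> U y -> g y = f y].

Definition smooth_on (R : realType) (V W : normedModType R) (A : set V)
    (f : V -> W) : Prop :=
  forall x, A x -> exists (U : set V) (g : V -> W),
    [/\ open U, U x, smooth U g & forall y, A y -> U y -> g y = f y].

(* Two-sided derivative at interior points of D, one-sided at endpoints. *)
Definition derive_within (R : realType) (V : normedModType R) (D : set R)
    (g : R -> V) (t : R) (l : V) : Prop :=
  (s - t)^-1 *: (g s - g t) @[s --> within D t^'] --> l.

Definition homeo_on (V W : topologicalType) (A : set V) (B : set W)
    (f : V -> W) : Prop :=
  [/\ set_bij A B f, {within A, continuous f}
    & exists g : W -> V,
        {within B, continuous g} /\ (forall x, A x -> g (f x) = x)].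

(** Closed hypersurfaces of R^3 *)

Definition local_equation (R : realType) (G : set 'rV[R]_3) (x : 'rV[R]_3)
    (F : 'rV[R]_3 -> R) : Prop :=
  exists U : set 'rV[R]_3,
    [/\ open U, U x, smooth U F, (forall y, U y -> grad F y != 0)
      & G `&` U = [set y | U y /\ F y = 0]].

Definition smooth_hypersurface (R : realType) (G : set 'rV[R]_3) : Prop :=
  forall x, G x -> exists F, local_equation G x F.

Definition inside (R : realType) (G : set 'rV[R]_3) : set 'rV[R]_3 :=
  [set x | ~ G x /\ bounded_set (connected_component (~` G) x)].

Definition outward_unit_normal (R : realType) (G : set 'rV[R]_3)
    (x n : 'rV[R]_3) : Prop :=
  [/\ enorm n = 1,
      exists (F : 'rV[R]_3 -> R) (c : R),
        local_equation G x F /\ n = c *: grad F x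
    & \forall s \near 0^'+, inside G (x - s *: n) /\ ~ inside G (x + s *: n)].

Definition signed_dist (R : realType) (G : set 'rV[R]_3) (x : 'rV[R]_3) : R :=
  let r := inf [set enorm (x - y) | y in G] in
  if `[< inside G x >] then - r else r.

(** The evolving surface *)

(* Space-time points are pairs (x, t) : 'rV[R]_3 * R. *)
Record surface_data (R : realType) := SurfaceData {
  Gamma0 : set 'rV[R]_3;
  Tend : R;
  Phi : 'rV[R]_3 * R -> 'rV[R]_3;
  vel : 'rV[R]_3 * R -> 'rV[R]_3;
  nu : 'rV[R]_3 * R -> 'rV[R]_3;
  nbh : R -> set 'rV[R]_3;
  proj : 'rV[R]_3 * R -> 'rV[R]_3
}.

Definition time_set (R : realType) (S : surface_data R) : set R :=
  [set t | 0 <= t <= Tend S].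

Definition Gamma (R : realType) (S : surface_data R) (t : R) : set 'rV[R]_3 :=
  [set Phi S (X, t) | X in Gamma0 S].

Definition STbar (R : realType) (S : surface_data R) : set ('rV[R]_3 * R) :=
  [set p | time_set S p.2 /\ Gamma S p.2 p.1].

Record evolving_surface (R : realType) (S : surface_data R) : Prop := {
  es_Tend : 0 < Tend S;
  es_compact : compact (Gamma0 S);
  es_connected : connected (Gamma0 S);
  es_hypersurface0 : smooth_hypersurface (Gamma0 S);
  es_Phi_smooth :
    smooth_on [set p | Gamma0 S p.1 /\ time_set S p.2] (Phi S);
  es_Phi_inj : forall t, time_set S t ->
    set_inj (Gamma0 S) (fun X => Phi S (X, t));
  es_Phi_inv_smooth : forall t, time_set S t ->
    exists Psi : 'rV[R]_3 -> 'rV[R]_3,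
      smooth_on (Gamma S t) Psi /\
      (forall X, Gamma0 S X -> Psi (Phi S (X, t)) = X);
  es_hypersurface : forall t, time_set S t -> smooth_hypersurface (Gamma S t);
  es_Phi0 : forall X, Gamma0 S X -> Phi S (X, 0) = X;
  es_Phi_flow : forall X t, Gamma0 S X -> time_set S t ->
    derive_within (time_set S) (fun s => Phi S (X, s)) t
      (vel S (Phi S (X, t), t));
  es_vel_C1 : Ck_on 1 (STbar S) (vel S);
  es_normal : forall x t, STbar S (x, t) ->
    outward_unit_normal (Gamma S t) x (nu S (x, t));
  es_nbh_open : forall t, time_set S t -> open (nbh S t);
  es_nbh_sub : forall t, time_set S t -> Gamma S t `<=` nbh S t;
  es_proj : forall x t, time_set S t -> nbh S t x -> forall y,
    (Gamma S t y /\ x = y + signed_dist (Gamma S t) x *: nu S (y, t)) <->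
    y = proj S (x, t)
}.

(** Derivatives of functions on the closure of S_T *)

(* The extension of f(., t) need only be C^1 near x: the value is independent of
   it, and for f of class C^2 no C^infinity extension needs to exist. *)
Definition is_tgrad (R : realType) (S : surface_data R)
    (f : 'rV[R]_3 * R -> R) (p : 'rV[R]_3 * R) (g : 'rV[R]_3) : Prop :=
  exists (U : set 'rV[R]_3) (F : 'rV[R]_3 -> R),
    [/\ open U, U p.1, Ck 1 U F,
        (forall y, Gamma S p.2 y -> U y -> F y = f (y, p.2))
      & g = tproj (nu S p) (grad F p.1)].

Definition tgrad (R : realType) (S : surface_data R)
    (f : 'rV[R]_3 * R -> R) (p : 'rV[R]_3 * R) : 'rV[R]_3 :=
  xget 0 [set g | is_tgrad S f p g].

Definition tgrad2 (R : realType) (S : surface_data R)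
    (f : 'rV[R]_3 * R -> R) (p : 'rV[R]_3 * R) : 'M[R]_3 :=
  \matrix_(i < 3, j < 3) tgrad S (fun q => tgrad S f q 0 j) p 0 i.

Definition is_matder (R : realType) (S : surface_data R)
    (f : 'rV[R]_3 * R -> R) (p : 'rV[R]_3 * R) (l : R) : Prop :=
  exists2 X, Gamma0 S X /\ Phi S (X, p.2) = p.1 &
    derive_within (time_set S) (fun s => f (Phi S (X, s), s) : R^o) p.2 l.

Definition matder (R : realType) (S : surface_data R)
    (f : 'rV[R]_3 * R -> R) (p : 'rV[R]_3 * R) : R :=
  xget 0 [set l | is_matder S f p l].

Definition hamiltonian (R : realType) (S : surface_data R) (L1 L2 : R)
    (H : 'rV[R]_3 * R -> 'rV[R]_3 -> R) : Prop :=
  (forall a b p, STbar S a -> STbar S b ->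
     `|H a p - H b p| <= L1 * (enorm (a.1 - b.1) + `|a.2 - b.2|) * (1 + enorm p))
  /\
  (forall a p q, STbar S a -> `|H a p - H a q| <= L2 * enorm (p - q)).

(** Triangulations *)

(* Convex and affine hull of the points x k, k \in K. *)
Definition hull (R : realType) (M : nat) (x : 'I_M -> 'rV[R]_3)
    (K : {set 'I_M}) : set 'rV[R]_3 :=
  [set y | exists w : 'I_M -> R,
    [/\ forall k, k \in K -> 0 <= w k, \sum_(k in K) w k = 1
      & y = \sum_(k in K) w k *: x k]].

Definition aff (R : realType) (M : nat) (x : 'I_M -> 'rV[R]_3)
    (K : {set 'I_M}) : set 'rV[R]_3 :=
  [set y | exists w : 'I_M -> R,
    \sum_(k in K) w k = 1 /\ y = \sum_(k in K) w k *: x k].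

(* Radius of the largest circle (with its disc) contained in the triangle. *)
Definition inradius (R : realType) (M : nat) (x : 'I_M -> 'rV[R]_3)
    (K : {set 'I_M}) : R :=
  sup [set r | 0 <= r /\ exists c, aff x K c /\
    forall y, aff x K y -> enorm (y - c) <= r -> hull x K y].

(* [nbrs m i] lists the neighbours of the vertex i in cyclic order: if j is
   i_j, then [next (nbrs m i) j] is i_{j+1} and [prev (nbrs m i) j] is i_{j-1}.
   [hat m i (x, t)] is the nodal basis function chi_i(x, t). *)
Record mesh (R : realType) (M : nat) := Mesh {
  vtx0 : 'I_M -> 'rV[R]_3;
  tris : {set {set 'I_M}};
  nbrs : 'I_M -> seq 'I_M;
  hat : 'I_M -> 'rV[R]_3 * R -> R
}.

Definition vtx (R : realType) (S : surface_data R) (M : nat) (m : mesh R M)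
    (t : R) (i : 'I_M) : 'rV[R]_3 := Phi S (vtx0 m i, t).

Definition Gamma_h (R : realType) (S : surface_data R) (M : nat)
    (m : mesh R M) (t : R) : set 'rV[R]_3 :=
  [set y | exists2 K, K \in tris m & hull (vtx S m t) K y].

Definition mesh_size (R : realType) (S : surface_data R) (M : nat)
    (m : mesh R M) : R :=
  sup [set d | exists t K,
    [/\ time_set S t, K \in tris m & d = diam (hull (vtx S m t) K)]].

Definition Vh (R : realType) (S : surface_data R) (M : nat)
    (m : mesh R M) (t : R) (f : 'rV[R]_3 -> R) : Prop :=
  {within Gamma_h S m t, continuous f} /\
  (forall K, K \in tris m -> exists a b, forall y,
     hull (vtx S m t) K y -> f y = dot a y + b).

(* The triangle a b c of the closed surface G is positively oriented when seen
   from the side of (b - a) x (c - a); it is clockwise when seen from outside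
   if this vector points inwards. *)
Definition clockwise (R : realType) (G : set 'rV[R]_3) (a b c : 'rV[R]_3) :
    Prop :=
  \forall s \near 0^'+,
    inside G (3%:R^-1 *: (a + b + c) + s *: cross (b - a) (c - a)).

Record triangulation (R : realType) (S : surface_data R) (hstar gamma : R)
    (M : nat) (m : mesh R M) : Prop := {
  tr_vtx0 : forall i, Gamma0 S (vtx0 m i);
  tr_card : forall K, K \in tris m -> #|K| = 3%N;
  tr_cover : forall i : 'I_M, exists2 K, K \in tris m & i \in K;
  tr_nondeg : forall t i j k, time_set S t ->
    [set i; j; k]%SET \in tris m ->
    cross (vtx S m t j - vtx S m t i) (vtx S m t k - vtx S m t i) != 0;
  (* two triangles meet in the empty set, a common vertex or a common edge *)
  tr_conform : forall t K K', time_set S t -> K \in tris m -> K' \in tris m ->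
    hull (vtx S m t) K `&` hull (vtx S m t) K' =
    hull (vtx S m t) (K :&: K')%SET;
  tr_nbrs_uniq : forall i, uniq (nbrs m i);
  tr_nbrs_tris : forall i,
    [set K in tris m | i \in K]%SET =
    [set [set i; j; next (nbrs m i) j]%SET | j in nbrs m i]%SET;
  tr_nbrs_size : forall i,
    size (nbrs m i) = #|[set K in tris m | i \in K]%SET|;
  tr_nbrs_clockwise : forall t i j, time_set S t -> j \in nbrs m i ->
    clockwise (Gamma_h S m t) (vtx S m t i) (vtx S m t j)
      (vtx S m t (next (nbrs m i) j));
  tr_size : 0 < mesh_size S m < hstar;
  tr_nbh : forall t, time_set S t -> Gamma_h S m t `<=` nbh S t;
  tr_homeo : forall t, time_set S t ->
    homeo_on (Gamma_h S m t) (Gamma S t) (fun x => proj S (x, t));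
  tr_regular : forall t K, time_set S t -> K \in tris m ->
    diam (hull (vtx S m t) K) <= gamma * inradius (vtx S m t) K;
  tr_hat_Vh : forall t i, time_set S t -> Vh S m t (fun y => hat m i (y, t));
  tr_hat_delta : forall t i j, time_set S t ->
    hat m i (vtx S m t j, t) = (i == j)%:R
}.

(** Geometry of the volumes around a vertex, for vertex positions x *)

Definition segment (R : realType) (a b : 'rV[R]_3) : set 'rV[R]_3 :=
  [set a + s *: (b - a) | s in [set s : R | 0 <= s <= 1]].

(* p is the point where the circle of centre z and radius r touches [a, b]. *)
Definition touches (R : realType) (z : 'rV[R]_3) (r : R) (a b p : 'rV[R]_3) :
    Prop :=
  [/\ segment a b p, dot (z - p) (b - a) = 0 & enorm (z - p) = r].

(* p is the contact point, on the edge i j, of the inscribed circle of the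
   triangle i j k. *)
Definition is_contact (R : realType) (M : nat) (x : 'I_M -> 'rV[R]_3)
    (i j k : 'I_M) (p : 'rV[R]_3) : Prop :=
  exists z r, [/\ aff x [set i; j; k]%SET z, 0 < r,
    touches z r (x i) (x j) p,
    exists q, touches z r (x j) (x k) q
    & exists q, touches z r (x k) (x i) q].

Definition contact_dist (R : realType) (M : nat) (x : 'I_M -> 'rV[R]_3)
    (i j k : 'I_M) : R :=
  enorm (x i - xget 0 [set p | is_contact x i j k p]).

Definition edge_len (R : realType) (M : nat) (x : 'I_M -> 'rV[R]_3)
    (i j : 'I_M) : R := enorm (x j - x i).

Definition vol_dist (R : realType) (M : nat) (m : mesh R M)
    (x : 'I_M -> 'rV[R]_3) (i : 'I_M) : R :=
  seqmin [seq contact_dist x i j (next (nbrs m i) j) | j <- nbrs m i].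

(* The point of the edge i j at distance d^i from x i. *)
Definition edge_pt (R : realType) (M : nat) (m : mesh R M)
    (x : 'I_M -> 'rV[R]_3) (i j : 'I_M) : 'rV[R]_3 :=
  x i + (vol_dist m x i / edge_len x i j) *: (x j - x i).

(* In the plane of the triangle i j k, the intersection of the perpendiculars to
   the edges i j and i k at their points at distance d^i from x i. *)
Definition corner (R : realType) (M : nat) (m : mesh R M)
    (x : 'I_M -> 'rV[R]_3) (i j k : 'I_M) : 'rV[R]_3 :=
  xget 0 [set q | [/\ aff x [set i; j; k]%SET q,
    dot (q - edge_pt m x i j) (x j - x i) = 0
    & dot (q - edge_pt m x i k) (x k - x i) = 0]].

Definition triangle_area (R : realType) (a b c : 'rV[R]_3) : R :=
  enorm (cross (b - a) (c - a)) / 2%:R.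

(* Area of the intersection of the volume around i with the triangle
   {i, j, next j}: the quadrilateral with successive vertices x i, edge_pt j,
   corner, edge_pt (next j), cut along the diagonal from x i. *)
Definition piece_area (R : realType) (M : nat) (m : mesh R M)
    (x : 'I_M -> 'rV[R]_3) (i j : 'I_M) : R :=
  let k := next (nbrs m i) j in
  let q := corner m x i j k in
  triangle_area (x i) (edge_pt m x i j) q +
  triangle_area (x i) q (edge_pt m x i k).

Definition vol_area (R : realType) (M : nat) (m : mesh R M)
    (x : 'I_M -> 'rV[R]_3) (i : 'I_M) : R :=
  \sum_(j <- nbrs m i) piece_area m x i j.

Definition len_R (R : realType) (M : nat) (m : mesh R M)
    (x : 'I_M -> 'rV[R]_3) (i j : 'I_M) : R :=
  enorm (corner m x i j (next (nbrs m i) j) - edge_pt m x i j).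

Definition len_L (R : realType) (M : nat) (m : mesh R M)
    (x : 'I_M -> 'rV[R]_3) (i j : 'I_M) : R :=
  enorm (corner m x i (prev (nbrs m i) j) j - edge_pt m x i j).

(** The scheme *)

Definition fe_fun (R : realType) (M : nat) (m : mesh R M) (t : R)
    (u : 'I_M -> R) (y : 'rV[R]_3) : R :=
  \sum_i u i * hat m i (y, t).

(* Tangential gradient of f on the flat triangle i j k, where f is affine. *)
Definition flat_tgrad (R : realType) (M : nat) (x : 'I_M -> 'rV[R]_3)
    (f : 'rV[R]_3 -> R) (i j k : 'I_M) : 'rV[R]_3 :=
  let N := cross (x j - x i) (x k - x i) in
  xget 0 [set g | exists a b,
    (forall y, hull x [set i; j; k]%SET y -> f y = dot a y + b) /\
    g = tproj ((enorm N)^-1 *: N) a].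

Definition scheme_coef (R : realType) (S : surface_data R)
    (H : 'rV[R]_3 * R -> 'rV[R]_3 -> R) (M : nat) (m : mesh R M)
    (t : nat -> R) (eps : nat -> 'I_M -> R) (n : nat) (u : 'I_M -> R)
    (i : 'I_M) : R :=
  let x := vtx S m (t n) in
  u i - (t n.+1 - t n) *
    (\sum_(j <- nbrs m i) piece_area m x i j / vol_area m x i *
        H (x i, t n)
          (flat_tgrad x (fe_fun m (t n) u) i j (next (nbrs m i) j))
     - eps n i / vol_area m x i *
       \sum_(j <- nbrs m i) (u j - u i) / edge_len x i j *
          (len_L m x i j + len_R m x i j)).

Definition scheme (R : realType) (S : surface_data R)
    (H : 'rV[R]_3 * R -> 'rV[R]_3 -> R) (M : nat) (m : mesh R M)
    (t : nat -> R) (eps : nat -> 'I_M -> R) (n : nat) (u : 'I_M -> R) :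
    'rV[R]_3 -> R :=
  fe_fun m (t n.+1) (scheme_coef S H m t eps n u).

Definition time_grid (R : realType) (S : surface_data R) (N : nat)
    (t : nat -> R) : Prop :=
  [/\ t 0%N = 0, t N = Tend S & forall n, (n < N)%N -> t n < t n.+1].

Definition mesh_condition (R : realType) (S : surface_data R) (C0 C1 C2 : R)
    (M : nat) (m : mesh R M) (N : nat) (t : nat -> R)
    (eps : nat -> 'I_M -> R) : Prop :=
  forall n, (n < N)%N ->
  let x := vtx S m (t n) in
  (forall i : 'I_M,
    let hmax := seqmax [seq diam (hull x [set i; j; next (nbrs m i) j]%SET)
                       | j <- nbrs m i] in
    C0 * hmax <= eps n i <= C1 * hmax) /\
  t n.+1 - t n <=
    C2 * seqmin [seq edge_len x i j | i <- enum 'I_M, j <- nbrs m i].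

(* The standing property of C0, C1, C2 for the given gamma and L2: uniformly in
   the Hamiltonian, the triangulation, the time grid and the eps, the mesh
   condition makes the scheme monotone. *)
Definition monotonicity_constants (R : realType) (S : surface_data R)
    (hstar gamma L2 C0 C1 C2 : R) : Prop :=
  forall (L1 : R) (H : 'rV[R]_3 * R -> 'rV[R]_3 -> R)
    (M : nat) (m : mesh R M) (N : nat) (t : nat -> R)
    (eps : nat -> 'I_M -> R),
    0 < L1 -> hamiltonian S L1 L2 H ->
    triangulation S hstar gamma m -> time_grid S N t ->
    (forall n i, (n < N)%N -> 0 < eps n i) ->
    mesh_condition S C0 C1 C2 m N t eps ->
  forall n, (n < N)%N -> forall u v : 'I_M -> R,
    (forall y, Gamma_h S m (t n) y ->
       fe_fun m (t n) u y <= fe_fun m (t n) v y) ->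
    forall y, Gamma_h S m (t n.+1) y ->
      scheme S H m t eps n u y <= scheme S H m t eps n v y.

(* Main.v *)
(* The truncation error has three parts.  The time difference is handled by
   Taylor's formula along the flow, and [tau <= C2 h] by the mesh condition.  For
   the Hamiltonian, [phi (y) - phi (x) - tgrad phi (x) . (y - x)] is
   [O (|y - x|^2)] on the surface, and the normal of a shape regular triangle is
   [O (h)]-close to a multiple of [nu]; so the flat gradients are [O (h)]-close
   to the tangential gradient.

   In the viscosity term the consistent part of the difference quotients has to
   cancel.  With [tau_j] the tangent of half the angle of the triangle [j] at the
   vertex, both lengths [len_R j] and [len_L (j + 1)] are [d tau_j] and the area of
   the piece is [d^2 tau_j], so the term equals
     [eps / (d sum_j tau_j) * sum_j tau_j (r_j + r_{j+1})],
   where [r_j] is the difference quotient along the edge of direction [e_j].  As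
   [tau_j (e_j + e_{j+1})] is [e_j - e_{j+1}] rotated by a right angle in the plane
   of the triangle, the sum telescopes up to [O (h)] once the triangles around the
   vertex have nearly the same oriented normal.

   It remains to know that the normals do not flip and that [d] is not much
   smaller than the largest diameter at the vertex.  Both follow from the
   injectivity of the projection onto the surface: two small triangles with a
   common vertex cannot overlap as seen along [nu].  Hence there is no fold along
   an edge, and only boundedly many small triangles share a vertex, while
   neighbouring ones have comparable sizes. *)

Require Import Defs.
From HB Require Import structures.
From mathcomp Require Import all_boot all_order all_algebra.
From mathcomp Require Import all_classical all_reals all_analysis.
From mathcomp Require Import ring lra.
Set Implicit Arguments.
Unset Strict Implicit.
Unset Printing Implicit Defensive.
Import Order.TTheory GRing.Theory Num.Theory.
Import numFieldNormedType.Exports.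
Local Open Scope classical_set_scope.
Local Open Scope ring_scope.

(** * Euclidean geometry of R^3 *)

Section Euclidean.
Variable R : realType.
Implicit Types (u v w : 'rV[R]_3) (a b c : R).

(** The right-hand side contains only tangential derivatives of [phi], neither [phi] itself nor an
    extension of it. A Taylor formula in the ambient space is therefore of no use: it is applied
    along curves that stay in [Gamma S t], built in [Gamma0 S] by an implicit function argument and
    transported by [Phi S]. For points too far apart for such a curve, the oscillation of [phi] is
    bounded by its tangential gradient; this rests on the connectedness of [Gamma0 S].

    All constants must be uniform in time, vertex and mesh. They come from compactness of [Gamma0 S]
    and of the time interval, mostly through one number [c] that bounds the derivatives while its
    inverse is the radius of validity.

    The mesh size is only bounded by the arbitrary number [hstar]. The orientation of a star is
    therefore only available below a fixed size; above it, a bounded quantity is trivially at most a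
    constant times the size.

    Tangential gradients, contact distances, corners and flat gradients are selected by [xget]; each
    is shown to exist and is characterised before it is computed. *)

Lemma sum3 (V : nmodType) (F : 'I_3 -> V) :
  \sum_(k < 3) F k = F 0 + F 1 + F 2%:R.
Proof.
by rewrite !big_ord_recl big_ord0 addr0 addrA; congr (F _ + F _ + F _); apply/val_inj.
Qed.

Lemma ord3P (k : 'I_3) : [\/ k = 0, k = 1 | k = 2%:R].
Proof.
case: k => -[|[|[|//]]] i; [apply: Or31|apply: Or32|apply: Or33]; exact/val_inj.
Qed.

Lemma dotE u v : dot u v = u 0 0 * v 0 0 + u 0 1 * v 0 1 + u 0 2%:R * v 0 2%:R.
Proof. by rewrite /dot sum3. Qed.

Lemma rV3P u v : u 0 0 = v 0 0 -> u 0 1 = v 0 1 -> u 0 2%:R = v 0 2%:R -> u = v.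
Proof. by move=> h0 h1 h2; apply/rowP => k; case: (ord3P k) => ->. Qed.

Lemma crossE0 u v : cross u v 0 0 = u 0 1 * v 0 2%:R - u 0 2%:R * v 0 1.
Proof. by rewrite mxE !add0r. Qed.

Lemma crossE1 u v : cross u v 0 1 = u 0 2%:R * v 0 0 - u 0 0 * v 0 2%:R.
Proof.
rewrite mxE; have -> : 1 + 1 = 2%:R :> 'I_3 by apply/val_inj.
by have -> : 1 + 2%:R = 0 :> 'I_3 by apply/val_inj.
Qed.

Lemma crossE2 u v : cross u v 0 2%:R = u 0 0 * v 0 1 - u 0 1 * v 0 0.
Proof.
rewrite mxE; have -> : 2%:R + 1 = 0 :> 'I_3 by apply/val_inj.
by have -> : 2%:R + 2%:R = 1 :> 'I_3 by apply/val_inj.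
Qed.

Definition rv3E := (dotE, crossE0, crossE1, crossE2, mxE).

Lemma dotC u v : dot u v = dot v u. Proof. by rewrite !dotE; ring. Qed.
Lemma dotDl u v w : dot (u + v) w = dot u w + dot v w.
Proof. by rewrite !rv3E; ring. Qed.
Lemma dotDr u v w : dot w (u + v) = dot w u + dot w v.
Proof. by rewrite !rv3E; ring. Qed.
Lemma dotNl u w : dot (- u) w = - dot u w.
Proof. by rewrite !rv3E; ring. Qed.
Lemma dotNr u w : dot w (- u) = - dot w u.
Proof. by rewrite !rv3E; ring. Qed.
Lemma dotBl u v w : dot (u - v) w = dot u w - dot v w.
Proof. by rewrite dotDl dotNl. Qed.
Lemma dotBr u v w : dot w (u - v) = dot w u - dot w v.
Proof. by rewrite dotDr dotNr. Qed.
Lemma dotZl a u w : dot (a *: u) w = a * dot u w.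
Proof. by rewrite !rv3E; ring. Qed.
Lemma dotZr a u w : dot w (a *: u) = a * dot w u.
Proof. by rewrite !rv3E; ring. Qed.
Lemma dot0l w : dot 0 w = 0. Proof. by rewrite !rv3E; ring. Qed.
Lemma dot0r w : dot w 0 = 0. Proof. by rewrite !rv3E; ring. Qed.

Definition dot_simpl := (dotDl, dotDr, dotNl, dotNr, dotZl, dotZr, dot0l, dot0r).

Lemma dot_ge0 u : 0 <= dot u u.
Proof. by rewrite dotE !addr_ge0 // -expr2 sqr_ge0. Qed.

Lemma enorm_ge0 u : 0 <= enorm u. Proof. exact: sqrtr_ge0. Qed.

Lemma sqr_enorm u : enorm u ^+ 2 = dot u u.
Proof. by rewrite sqr_sqrtr ?dot_ge0. Qed.

Lemma dot_eq0 u : (dot u u == 0) = (u == 0).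
Proof.
apply/idP/eqP => [|->]; last by rewrite dot0l.
rewrite dotE !paddr_eq0 ?addr_ge0 // -?expr2 ?sqr_ge0 // !sqrf_eq0.
by move=> /andP[/andP[/eqP h0 /eqP h1] /eqP h2]; apply: rV3P; rewrite ?mxE.
Qed.

Lemma enorm_eq0 u : (enorm u == 0) = (u == 0).
Proof. by rewrite -sqrf_eq0 sqr_enorm dot_eq0. Qed.

Lemma enorm_gt0 u : (0 < enorm u) = (u != 0).
Proof. by rewrite lt_def enorm_eq0 enorm_ge0 andbT. Qed.

Lemma enorm0 : enorm (0 : 'rV[R]_3) = 0.
Proof. by apply/eqP; rewrite enorm_eq0. Qed.

Lemma enorm_le u a : 0 <= a -> (enorm u <= a) = (dot u u <= a ^+ 2).
Proof. by move=> a0; rewrite -sqr_enorm ler_sqr ?nnegrE ?enorm_ge0. Qed.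

Lemma enorm_unit u : (enorm u = 1) <-> (dot u u = 1).
Proof.
rewrite -sqr_enorm; split=> [->|h]; first by rewrite expr1n.
by apply/eqP; rewrite -(@eqrXn2 _ 2) ?enorm_ge0 // h expr1n.
Qed.

(** Lagrange's identity: the sign of the left side gives the Cauchy-Schwarz inequality, that of the
    square on the right the bound on the length of a cross product. *)
Lemma dot_cross_cross u v : dot (cross u v) (cross u v) = dot u u * dot v v - dot u v ^+ 2.
Proof. by rewrite !rv3E; ring. Qed.

Lemma dot_le u v : `|dot u v| <= enorm u * enorm v.
Proof.
have h := dot_ge0 (cross u v); rewrite dot_cross_cross -!sqr_enorm subr_ge0 -exprMn in h.
by rewrite -[leRHS]ger0_norm ?mulr_ge0 ?enorm_ge0 // -ler_sqr ?nnegrE // !real_normK ?num_real.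
Qed.

Lemma enorm_cross_le u v : enorm (cross u v) <= enorm u * enorm v.
Proof.
rewrite enorm_le ?mulr_ge0 ?enorm_ge0 // dot_cross_cross exprMn !sqr_enorm.
by rewrite lerBlDr lerDl sqr_ge0.
Qed.

Lemma enormZ a u : enorm (a *: u) = `|a| * enorm u.
Proof.
by rewrite /enorm dotZl dotZr mulrA -expr2 sqrtrM ?sqr_ge0 // sqrtr_sqr.
Qed.

Lemma enormN u : enorm (- u) = enorm u.
Proof. by rewrite -scaleN1r enormZ normrN1 mul1r. Qed.

Lemma enormB u v : enorm (u - v) = enorm (v - u).
Proof. by rewrite -enormN opprB. Qed.

Lemma enormD u v : enorm (u + v) <= enorm u + enorm v.
Proof.
rewrite enorm_le ?addr_ge0 ?enorm_ge0 // sqrrD !sqr_enorm !dot_simpl (dotC v u).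
have /ler_normlP[_ h] := dot_le u v.
lra.
Qed.

Lemma enorm_triangle w u v : enorm (u - v) <= enorm (u - w) + enorm (w - v).
Proof. by have := enormD (u - w) (w - v); rewrite addrA subrK. Qed.

Lemma coord_le_enorm u (k : 'I_3) : `|u 0 k| <= enorm u.
Proof.
rewrite -[leRHS]ger0_norm ?enorm_ge0 // -ler_sqr ?nnegrE // !real_normK ?num_real //.
rewrite sqr_enorm dotE -!expr2.
have h0 := sqr_ge0 (u 0 0); have h1 := sqr_ge0 (u 0 1); have h2 := sqr_ge0 (u 0 2%:R).
by case: (ord3P k) => ->; lra.
Qed.

Lemma enorm_sum_le u : enorm u <= `|u 0 0| + `|u 0 1| + `|u 0 2%:R|.
Proof.
rewrite enorm_le ?addr_ge0 // dotE.
have e k : u 0 k * u 0 k = `|u 0 k| * `|u 0 k|.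
  by rewrite -!expr2 real_normK ?num_real.
rewrite !e; have := normr_ge0 (u 0 0); have := normr_ge0 (u 0 1).
by have := normr_ge0 (u 0 2%:R); nra.
Qed.

Lemma norm_le_enorm u : `|u| <= enorm u.
Proof.
have [M0|M0] := leP `|u| 0; first exact: le_trans M0 (enorm_ge0 _).
rewrite (le_trans _ (lexx _)) // [`|u|]mx_normrE; apply/bigmax_leP; split.
  exact: enorm_ge0.
by move=> [i k] _ /=; rewrite (ord1 i); exact: coord_le_enorm.
Qed.

Lemma coord_le_norm u (k : 'I_3) : `|u 0 k| <= `|u|.
Proof.
by rewrite [`|u|]mx_normrE; apply: (le_bigmax _ (fun i : 'I_1 * 'I_3 => `|u i.1 i.2|) (0, k)).
Qed.

(** The factor 3 counts the coordinates; it reappears wherever a bound in the library norm is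
    converted into a Euclidean one. *)
Lemma enorm_le_norm u : enorm u <= 3%:R * `|u|.
Proof.
apply: le_trans (enorm_sum_le u) _.
by have := coord_le_norm u 0; have := coord_le_norm u 1; have := coord_le_norm u 2%:R; lra.
Qed.

Lemma dot_crossl u v : dot u (cross u v) = 0. Proof. by rewrite !rv3E; ring. Qed.
Lemma dot_crossr u v : dot v (cross u v) = 0. Proof. by rewrite !rv3E; ring. Qed.
Lemma crossDl u v w : cross (v + w) u = cross v u + cross w u.
Proof. by apply: rV3P; rewrite !rv3E; ring. Qed.
Lemma crossZl a u v : cross (a *: u) v = a *: cross u v.
Proof. by apply: rV3P; rewrite !rv3E; ring. Qed.
Lemma crossZr a u v : cross u (a *: v) = a *: cross u v.
Proof. by apply: rV3P; rewrite !rv3E; ring. Qed.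
Lemma crossC u v : cross u v = - cross v u.
Proof. by apply: rV3P; rewrite !rv3E; ring. Qed.
Lemma crossuu u : cross u u = 0.
Proof. by apply: rV3P; rewrite !rv3E; ring. Qed.

(** Cramer's rule in the basis [u], [v], [cross u v], multiplied by the Gram determinant so that it
    is a polynomial identity valid for dependent vectors too. *)
Lemma frame_decomp u v w :
  dot (cross u v) (cross u v) *: w =
    dot w (cross u v) *: cross u v
    + (dot w u * dot v v - dot w v * dot u v) *: u
    + (dot w v * dot u u - dot w u * dot u v) *: v.
Proof. by apply: rV3P; rewrite !rv3E; ring. Qed.

End Euclidean.

(** * Functions of class C^1 and C^{1,1} *)

Section Calculus.
Variable R : realType.

(** Compactness enters as a near-covering property for the filter at infinity on the constants:
    since [P] is monotone, a local constant stays valid for all larger ones. *)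
Lemma compact_uniform (V : normedModType R) (K : set V) (P : R -> V -> Prop) :
  compact K ->
  (forall c c' x, c <= c' -> P c x -> P c' x) ->
  (forall x, K x -> exists c, \forall y \near x, K y -> P c y) ->
  exists2 c, 0 < c & forall x, K x -> P c x.
Proof.
move=> /compact_near_coveringP cK mono loc.
have := cK R (pinfty_nbhs R) (fun c x => K x -> P c x) _ _.
case=> [x Kx|c [_ hc]].
  have [c hc] := loc x Kx.
  exists ([set y | K y -> P c y], [set c' | c <= c']) => /=.
    by split=> //; by apply: nbhs_pinfty_ge; exact: num_real.
  by move=> [y c'] /= [hy cc'] Ky; apply: mono cc' _; exact: hy.
exists (Num.max (c + 1) 1); first by rewrite lt_max ltr01 orbT.
by move=> x Kx; apply: (hc _ _ x Kx Kx); rewrite lt_max ltrDl ltr01.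
Qed.

Lemma is_derive_comp (V W : normedModType R) (f : V -> W) (c : R -> V) (s : R) (dc : V) :
  is_derive s 1 c dc -> differentiable f (c s) ->
  is_derive s 1 (fun s => f (c s)) ('D_dc f (c s)).
Proof.
move=> [dc1 dcE] df.
have dcs : differentiable c s by exact/derivable1_diffP.
have dfc : differentiable (f \o c) s by exact: differentiable_comp.
apply: DeriveDef; first exact: diff_derivable.
have e : 'D_1 c s = 'd c s (1 : R) by exact: deriveE.
by rewrite (deriveE _ dfc) diff_comp //= -e dcE deriveE.
Qed.

Lemma is_derive_line (V : normedModType R) (a v : V) (s : R) :
  is_derive s 1 (fun s : R => a + s *: v) v.
Proof.
have dv : is_derive s 1 ( *:%R ^~ v : R -> V) v.
  apply: DeriveDef; first exact/diff_derivable.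
  by rewrite deriveE // diff_val scale1r.
rewrite -[X in is_derive _ _ _ X]add0r.
by apply: (@is_deriveD _ _ _ (cst a) ( *:%R ^~ v : R -> V) s 1 0 v).
Qed.

Lemma mvt_derive (f df : R -> R) (a b : R) : a <= b ->
  (forall s, a <= s <= b -> is_derive s 1 f (df s)) ->
  exists2 s, a <= s <= b & f b - f a = df s * (b - a).
Proof.
move=> ab dfE.
have [||s] := @MVT_segment R f df a b ab.
- by move=> x; rewrite in_itv /= => /andP[/ltW ? /ltW ?]; apply: dfE; apply/andP.
- apply: derivable_within_continuous => x; rewrite in_itv /= => xab.
  by have [] := dfE x xab.
- by rewrite in_itv /= => sab ->; exists s.
Qed.

Lemma mvt_segment_derive (V : normedModType R) (f : V -> R) (a v : V) :
  (forall s : R, 0 <= s <= 1 -> differentiable f (a + s *: v)) ->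
  exists2 s : R, 0 <= s <= 1 & f (a + v) - f a = 'D_v f (a + s *: v).
Proof.
move=> df.
have [s s01|s s01] := @mvt_derive (fun s => f (a + s *: v))
  (fun s => 'D_v f (a + s *: v)) 0 1 ler01.
  by apply: is_derive_comp; [exact: is_derive_line|exact: df].
by rewrite scale1r scale0r addr0 subr0 mulr1 => ->; exists s.
Qed.

Lemma near_open (V : normedModType R) (U : set V) x : open U -> U x -> \forall y \near x, U y.
Proof. by move=> oU Ux; exact: open_nbhs_nbhs. Qed.

Lemma near_eq_differentiable (V W : normedModType R) (f g : V -> W) x :
  (\forall y \near x, f y = g y) -> differentiable f x -> differentiable g x.
Proof.
move=> fg df; have /diff_locallyP[dfc /eqaddoP fE] := df.
have gE : g \o shift x = cst (g x) + 'd f x +o_ 0 id.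
  apply/eqaddoP => e e0; have := fE e e0.
  have fg0 : \forall h \near (0 : V), f (h + x) = g (h + x).
    by move: fg; rewrite (near_shift 0) subr0.
  have fgx : f x = g x := nbhs_singleton fg.
  by apply: filterS2 fg0 => h h1; rewrite !fctE /= h1 fgx.
have gdE : 'd g x = 'd f x :> (V -> W) by exact: diff_unique.
by apply/diff_locallyP; rewrite gdE.
Qed.

Lemma Ck_ext (V W : normedModType R) k (U : set V) (f g : V -> W) :
  open U -> (forall x, U x -> f x = g x) -> Ck k U f -> Ck k U g.
Proof.
move=> oU; elim: k f g => [|k IH] f g fg /=.
  move=> cf x Ux; rewrite /prop_for /continuous_at -(fg _ Ux).
  apply: cvg_trans (cf x Ux); apply: near_eq_cvg.
  by apply: filterS (near_open oU Ux) => y Uy; rewrite fg.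
have nfg x : U x -> \forall y \near x, f y = g y.
  by move=> Ux; apply: filterS (near_open oU Ux).
move=> [df Df]; split=> [x Ux|v].
  by apply: near_eq_differentiable (df x Ux); exact: nfg.
apply: IH (Df v) => x Ux; apply: near_eq_derive; exact: nfg.
Qed.

Lemma CkW (V W : normedModType R) k (U : set V) (f : V -> W) :
  Ck k.+1 U f -> Ck k U f.
Proof.
elim: k f => [|k IH] f [df Df].
  by move=> x Ux; apply: differentiable_continuous; exact: df.
by split=> // v; apply: IH.
Qed.

Lemma Ck_sub (V W : normedModType R) k (U U' : set V) (f : V -> W) :
  U' `<=` U -> Ck k U f -> Ck k U' f.
Proof.
move=> UU'; elim: k f => [|k IH] f /=; first by move=> cf x /UU' /cf.
by move=> [df Df]; split=> [x /UU' /df//|v]; exact: IH.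
Qed.

Lemma Ck_linear_comp (V W Z : normedModType R) k (U : set V) (f : V -> W)
    (l : {linear W -> Z}) : open U -> continuous l -> Ck k U f ->
  Ck k U (l \o f).
Proof.
move=> oU cl; elim: k f => [|k IH] f /=.
  by move=> cf x Ux; apply: continuous_comp; [exact: cf|exact: cl].
have dl y : differentiable l y by exact: linear_differentiable.
move=> [df Df]; split=> [x Ux|v].
  by apply: differentiable_comp; [exact: df|exact: dl].
apply: Ck_ext (IH _ (Df v)) => // x Ux /=.
rewrite [RHS]deriveE; last by apply: differentiable_comp; [exact: df|exact: dl].
by rewrite diff_comp //=; [rewrite diff_lin // deriveE //; exact: df|exact: df].
Qed.

Lemma Ck_coord (V : normedModType R) m n k (U : set V) (f : V -> 'M[R]_(m, n)) i j :
  open U -> Ck k U f -> Ck k U (fun x => f x i j : R).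
Proof.
move=> oU Cf.
have @l : {linear 'M[R]_(m, n) -> R}.
  by exists (fun N : 'M[R]_(_, _) => N i j); do 2![eexists]; do ?[constructor];
     rewrite ?mxE// => ? *; rewrite ?mxE//; move=> ?; rewrite !mxE.
have cl : continuous l by exact: coord_continuous.
exact: (Ck_linear_comp oU cl Cf).
Qed.

(** The derivative [l] of [i] is the same at every point, so a directional derivative of [f \o i] is
    again one of [f] composed with [i], and the induction on [k] goes through. *)
Lemma Ck_comp_affine (V W Z : normedModType R) k (U : set W) (f : W -> Z)
    (i : V -> W) (l : V -> W) :
  open U -> (forall y, differentiable i y) -> (forall y, 'd i y = l :> (V -> W)) ->
  Ck k U f -> Ck k (i @^-1` U) (f \o i).
Proof.
move=> oU di dil.
have ci y : {for y, continuous i} by exact: differentiable_continuous.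
elim: k f => [|k IH] f /=.
  by move=> cf x Ux; apply: continuous_comp; [exact: ci|exact: cf].
move=> [df Df]; split=> [x Ux|v].
  by apply: differentiable_comp; [exact: di|exact: df].
have oiU : open (i @^-1` U) by apply: open_comp => // y _; exact: ci.
apply: Ck_ext (IH _ (Df (l v))) => // x Ux /=.
rewrite [RHS]deriveE; last by apply: differentiable_comp; [exact: di|exact: df].
rewrite diff_comp //=; last exact: df.
by rewrite dil deriveE //; exact: df.
Qed.

Lemma diff_slicel (V T : normedModType R) (t : T) (y : V) :
  differentiable (fun y : V => (y, t)) y /\
  'd (fun y : V => (y, t)) y = (fun v => (v, 0)) :> (V -> V * T).
Proof.
have d1 : differentiable (id : V -> V) y by exact: ex_diff.
have d2 : differentiable (cst t : V -> T) y by exact: differentiable_cst.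
split; first exact: (differentiable_pair d1 d2).
rewrite (diff_pair d1 d2); apply/funext => v /=; rewrite diff_cst; congr pair.
by rewrite diff_val.
Qed.

Lemma diff_slicer (V T : normedModType R) (x : V) (t : T) :
  differentiable (fun s : T => (x, s)) t /\
  'd (fun s : T => (x, s)) t = (fun v => (0, v)) :> (T -> V * T).
Proof.
have d1 : differentiable (id : T -> T) t by exact: ex_diff.
have d2 : differentiable (cst x : T -> V) t by exact: differentiable_cst.
split; first exact: (differentiable_pair d2 d1).
rewrite (diff_pair d2 d1); apply/funext => v /=; rewrite diff_cst; congr pair.
by rewrite diff_val.
Qed.

Lemma Ck_slicel (V T W : normedModType R) k (U : set (V * T)) (f : V * T -> W) t :
  open U -> Ck k U f -> Ck k [set y | U (y, t)] (fun y => f (y, t)).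
Proof.
move=> oU; apply: (Ck_comp_affine oU (i := fun y => (y, t)) (l := fun v => (v, 0))).
  by move=> y; have [] := diff_slicel t y.
by move=> y; have [] := diff_slicel t y.
Qed.

Lemma Ck_slicer (V T W : normedModType R) k (U : set (V * T)) (f : V * T -> W) x :
  open U -> Ck k U f -> Ck k [set s | U (x, s)] (fun s => f (x, s)).
Proof.
move=> oU; apply: (Ck_comp_affine oU (i := fun s => (x, s)) (l := fun v => (0, v))).
  by move=> y; have [] := diff_slicer x y.
by move=> y; have [] := diff_slicer x y.
Qed.

Lemma derive_slicel (V T W : normedModType R) (f : V * T -> W) (x v : V) (t : T) :
  differentiable f (x, t) -> 'D_v (fun y => f (y, t)) x = 'D_(v, 0) f (x, t).
Proof.
have [d1 d2] := diff_slicel t x => df.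
rewrite [LHS]deriveE; last exact: (differentiable_comp d1 df).
by rewrite (diff_comp d1 df) /= d2 deriveE.
Qed.

(** With a formula [D] for the derivatives only its continuity is left to check. The algebra of C^1
    functions built on this serves the coordinates of the tangential gradient. *)
Lemma Ck1I (V W : normedModType R) (U : set V) (f : V -> W) (D : V -> V -> W) :
  open U -> (forall x, U x -> differentiable f x) ->
  (forall x v, U x -> 'D_v f x = D v x) ->
  (forall x v, U x -> {for x, continuous (D v)}) ->
  Ck 1 U f.
Proof.
move=> oU df fD cD; split => // v; apply: (@Ck_ext _ _ 0 _ (D v)) => //.
  by move=> x Ux; rewrite fD.
by move=> x; exact: cD.
Qed.

Lemma Ck1M (V : normedModType R) (U : set V) (f g : V -> R) : open U ->
  Ck 1 U f -> Ck 1 U g -> Ck 1 U (fun x => f x * g x).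
Proof.
move=> oU [df Df] [dg Dg].
apply: (@Ck1I _ _ _ _ (fun v x => f x * 'D_v g x + g x * 'D_v f x)) => //.
- by move=> x Ux; apply: differentiableM; [exact: df|exact: dg].
- move=> x v Ux; have -> : (fun x => f x * g x) = f * g by [].
  by rewrite deriveM //; apply: diff_derivable; [exact: df|exact: dg].
- move=> x v Ux.
  have cf : {for x, continuous f} by apply: differentiable_continuous; exact: df.
  have cg : {for x, continuous g} by apply: differentiable_continuous; exact: dg.
  by apply: cvgD; apply: cvgM => //; [exact: Dg|exact: Df].
Qed.

Lemma Ck1D (V W : normedModType R) (U : set V) (f g : V -> W) : open U ->
  Ck 1 U f -> Ck 1 U g -> Ck 1 U (fun x => f x + g x).
Proof.
move=> oU [df Df] [dg Dg].
apply: (@Ck1I _ _ _ _ (fun v x => 'D_v f x + 'D_v g x)) => //.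
- by move=> x Ux; apply: differentiableD; [exact: df|exact: dg].
- move=> x v Ux; have -> : (fun x => f x + g x) = f + g by [].
  by rewrite deriveD //; apply: diff_derivable; [exact: df|exact: dg].
- by move=> x v Ux; apply: cvgD; [exact: Df|exact: Dg].
Qed.

Lemma Ck1N (V W : normedModType R) (U : set V) (f : V -> W) : open U ->
  Ck 1 U f -> Ck 1 U (fun x => - f x).
Proof.
move=> oU [df Df].
apply: (@Ck1I _ _ _ _ (fun v x => - 'D_v f x)) => //.
- by move=> x Ux; apply: differentiableN; exact: df.
- move=> x v Ux; have -> : (fun x => - f x) = - f by [].
  by rewrite deriveN //; apply: diff_derivable; exact: df.
- by move=> x v Ux; apply: cvgN; exact: Df.
Qed.

Lemma Ck1V (V : normedModType R) (U : set V) (f : V -> R) : open U ->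
  (forall x, U x -> f x != 0) -> Ck 1 U f -> Ck 1 U (fun x => (f x)^-1).
Proof.
move=> oU f0 [df Df].
apply: (@Ck1I _ _ _ _ (fun v x => - (f x) ^- 2 *: 'D_v f x)) => //.
- by move=> x Ux; apply: differentiableV; [exact: df|exact: f0].
- by move=> x v Ux; rewrite [LHS](@deriveV _ _ f) //; [exact: f0|exact: diff_derivable (df x Ux)].
- move=> x v Ux.
  have cf : {for x, continuous f} by apply: differentiable_continuous; exact: df.
  apply: cvgZ; last exact: Df.
  apply: cvgN; apply: cvgV; first by rewrite expf_neq0 // f0.
  by rewrite expr2; under eq_fun do rewrite expr2; exact: cvgM.
Qed.

End Calculus.

(** * Local C^{1,1} bounds *)

Section LocalBounds.
Variable R : realType.

Lemma ball_segment (V : normedModType R) (x a b : V) (r s : R) :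
  `|a - x| < r -> `|b - x| < r -> 0 <= s <= 1 -> `|a + s *: (b - a) - x| < r.
Proof.
move=> ax bx /andP[s0 s1].
have -> : a + s *: (b - a) - x = (1 - s) *: (a - x) + s *: (b - x).
  have e : (b - x) - (a - x) = b - a by rewrite opprB addrA subrK.
  by rewrite scalerBl scale1r -(addrA (a - x)) [X in _ = _ + X]addrC -scalerBr e addrAC.
apply: le_lt_trans (ler_normD _ _) _; rewrite !normrZ (ger0_norm s0).
rewrite ger0_norm ?subr_ge0 //.
have [->|s0'] := eqVneq s 0; first by rewrite subr0 mul1r mul0r addr0.
have : s * `|b - x| < s * r by rewrite ltr_pM2l // lt_def s0'.
have : (1 - s) * `|a - x| <= (1 - s) * r by rewrite ler_wpM2l ?subr_ge0 // ltW.
lra.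
Qed.

(* Quantitative C^{1,1} bounds with one parameter, both the radius of the ball
   and the constants being monotone in [c]. *)
Definition C11 (V W : normedModType R) (f : V -> W) (x : V) (c : R) :=
  [/\ 0 < c, forall a, `|a - x| < c^-1 -> differentiable f a,
      forall a v, `|a - x| < c^-1 -> `|'D_v f a| <= c * `|v|,
      forall a b, `|a - x| < c^-1 -> `|b - x| < c^-1 -> `|f b - f a| <= c * `|b - a|
    & forall a b v, `|a - x| < c^-1 -> `|b - x| < c^-1 ->
        `|'D_v f b - 'D_v f a| <= c * `|b - a| * `|v|].

Lemma C11_mono (V W : normedModType R) (f : V -> W) x c c' :
  c <= c' -> C11 f x c -> C11 f x c'.
Proof.
move=> cc' [c0 h1 h2 h3 h4].
have c'0 : 0 < c' by exact: lt_le_trans cc'.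
have ic : c'^-1 <= c^-1 by rewrite lef_pV2.
have lc a : `|a - x| < c'^-1 -> `|a - x| < c^-1 by move=> /lt_le_trans; exact.
split=> //.
- by move=> a /lc; exact: h1.
- by move=> a v /lc /h2 h; apply: le_trans (h v) _; rewrite ler_wpM2r.
- by move=> a b /lc ha /lc hb; apply: le_trans (h3 _ _ ha hb) _; rewrite ler_wpM2r.
- move=> a b v /lc ha /lc hb; apply: le_trans (h4 _ _ v ha hb) _.
  by rewrite -!mulrA ler_wpM2r // mulr_ge0.
Qed.

Lemma finite_uniform (I : finType) (P : I -> R -> Prop) :
  (forall i c c', c <= c' -> P i c -> P i c') -> (forall i, exists c, P i c) ->
  exists c, forall i, P i c.
Proof.
move=> mono /choice[c hc]; exists (\big[Num.max/0]_i c i) => i.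
by apply: mono (hc i); exact: le_bigmax.
Qed.

Section Coordinates.
Variables (V : normedModType R) (n : nat) (b : 'I_n -> V) (co : 'I_n -> V -> R).
Hypothesis coE : forall v, v = \sum_k co k v *: b k.
Hypothesis co_le : forall k v, `|co k v| <= `|v|.

Lemma derive_coord (W : normedModType R) (f : V -> W) x v : differentiable f x ->
  'D_v f x = \sum_k co k v *: 'D_(b k) f x.
Proof.
move=> df; rewrite deriveE // {1}(coE v) linear_sum; apply: eq_bigr => k _.
by rewrite linearZ deriveE.
Qed.

Lemma derive_coord_le (W : normedModType R) (f : V -> W) x v : differentiable f x ->
  `|'D_v f x| <= (\sum_k `|'D_(b k) f x|) * `|v|.
Proof.
move=> df; rewrite derive_coord // mulr_suml.
apply: le_trans (ler_norm_sum _ _ _) _; apply: ler_sum => k _.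
by rewrite normrZ mulrC ler_wpM2l.
Qed.

Lemma mvt_ball (f : V -> R) x r c : (forall a, `|a - x| < r -> differentiable f a) ->
  (forall a v, `|a - x| < r -> `|'D_v f a| <= c * `|v|) ->
  forall a b, `|a - x| < r -> `|b - x| < r -> `|f b - f a| <= c * `|b - a|.
Proof.
move=> df Df p q px qx.
have [s s01|s s01] := @mvt_segment_derive R V f p (q - p).
  by apply: df; exact: ball_segment.
by rewrite subrKC => ->; apply: Df; exact: ball_segment.
Qed.

Lemma C1_bound (U : set V) (f : V -> R) x : open U -> U x -> Ck 1 U f ->
  exists2 c, 0 < c & forall a, `|a - x| < c^-1 ->
    [/\ U a, differentiable f a & forall v, `|'D_v f a| <= c * `|v|].
Proof.
move=> oU Ux [df Df].
have n1 k : \forall a \near x, `|'D_(b k) f a| < `|'D_(b k) f x| + 1.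
  have /cvgrPdist_lt/(_ 1 ltr01) : {for x, continuous ('D_(b k) f)} := Df (b k) x Ux.
  apply: filterS => a /= h; rewrite -ltrBlDl.
  by apply: le_lt_trans (lerB_dist _ _) _; rewrite distrC.
have n2 : \forall a \near x, forall k, `|'D_(b k) f a| < `|'D_(b k) f x| + 1.
  exact: filter_forall.
have /nbhs_ballP[r /= r0 hr] : \forall a \near x, U a /\
    forall k, `|'D_(b k) f a| < `|'D_(b k) f x| + 1.
  by apply: filterS2 (near_open oU Ux) n2 => a.
pose c0 := \sum_k (`|'D_(b k) f x| + 1).
have c00 : 0 <= c0 by apply: sumr_ge0 => k _; rewrite addr_ge0.
exists (r^-1 + c0) => [|a]; first by rewrite ltr_wpDr // invr_gt0.
move=> ha.
have /hr[/= Ua ha2] : ball x r a.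
  rewrite -ball_normE /ball_ /= distrC; apply: lt_le_trans ha _.
  by rewrite invf_ple ?posrE ?ltr_wpDr ?invr_gt0 // lerDl.
split=> //; first exact: df.
move=> v; apply: le_trans (derive_coord_le v (df _ Ua)) _.
apply: ler_wpM2r => //; apply: le_trans (ler_sum _ (fun k _ => ltW (ha2 k))) _.
by rewrite lerDr invr_ge0 ltW.
Qed.

(** The first derivatives are bounded by continuity; their Lipschitz bounds come from the mean value
    inequality for each partial derivative, which is itself of class C^1. *)
Lemma C11_Ck2 (U : set V) (f : V -> R) x : open U -> U x -> Ck 2 U f ->
  exists c, C11 f x c.
Proof.
move=> oU Ux Cf.
have [c c0 hc] := C1_bound oU Ux (CkW Cf).
have /finite_uniform[] : forall k : 'I_n, exists d, 0 < d /\ forall a, `|a - x| < d^-1 ->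
    differentiable ('D_(b k) f) a /\ forall v, `|'D_v ('D_(b k) f) a| <= d * `|v|.
- by move=> k; have [d d0 hd] := C1_bound oU Ux (Cf.2 (b k)); exists d; split=> // a /hd[].
- move=> k d d' dd' [d0 hd]; split; first exact: lt_le_trans dd'.
  move=> a ha; have [|h1 h2] := hd a.
    by apply: lt_le_trans ha _; rewrite lef_pV2 // posrE (lt_le_trans d0).
  by split=> // v; apply: le_trans (h2 v) _; rewrite ler_wpM2r.
move=> d hd.
have d0 : 0 < Num.max d 1 by rewrite lt_max ltr01 orbT.
have {}hd k a : `|a - x| < (Num.max d 1)^-1 -> differentiable ('D_(b k) f) a /\
    forall v, `|'D_v ('D_(b k) f) a| <= Num.max d 1 * `|v|.
  have [dk0 hk] := hd k; move=> ha; have [|h1 h2] := hk a.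
    by apply: lt_le_trans ha _; rewrite lef_pV2 ?posrE // le_max lexx.
  by split=> // v; apply: le_trans (h2 v) _; rewrite ler_wpM2r // le_max lexx.
set D := Num.max d 1 in d0 hd.
(* [n] Lipschitz bounds of size [D] are added; the summand 1 ensures [D <= e] also for [n = 0]. *)
pose e := c + D * (n%:R + 1).
have n0 : 0 <= n%:R :> R by [].
have De : D * (n%:R + 1) <= e by rewrite lerDr ltW.
have ce : c <= e by rewrite /e; nra.
have DDe : D <= e by apply: le_trans De; rewrite ler_peMr ?lerDr // ltW.
have e0 : 0 < e by exact: lt_le_trans ce.
have lc a : `|a - x| < e^-1 -> `|a - x| < c^-1.
  by move=> /lt_le_trans; apply; rewrite lef_pV2.
have lD a : `|a - x| < e^-1 -> `|a - x| < D^-1.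
  by move=> /lt_le_trans; apply; rewrite lef_pV2.
exists e; split=> //.
- by move=> a /lc /hc[].
- by move=> a v /lc /hc[_ _ h]; apply: le_trans (h v) _; rewrite ler_wpM2r.
- apply: mvt_ball; first by move=> a /lc /hc[].
  by move=> a v /lc /hc[_ _ h]; apply: le_trans (h v) _; rewrite ler_wpM2r.
- move=> p q v hp hq.
  have [_ dp _] := hc _ (lc _ hp); have [_ dq _] := hc _ (lc _ hq).
  rewrite (derive_coord v dp) (derive_coord v dq) -sumrB.
  apply: le_trans (ler_norm_sum _ _ _) _.
  have : \sum_(k < n) `|co k v *: 'D_(b k) f q - co k v *: 'D_(b k) f p| <=
         \sum_(k < n) (D * `|q - p| * `|v|).
    apply: ler_sum => k _; rewrite -scalerBr normrZ mulrC ler_pM //.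
    have hDk := @mvt_ball ('D_(b k) f) x D^-1 D _ _ p q (lD _ hp) (lD _ hq).
    by apply: hDk => [a /(hd k)[]|a w /(hd k)[]].
  have nDe : n%:R * D <= e by nra.
  move=> /le_trans; apply; rewrite sumr_const card_ord -mulr_natl !mulrA.
  by rewrite !ler_wpM2r.
Qed.

(** The mean value theorem is one for real-valued functions, and the norm of a row vector is the
    maximum of its coordinates: the scalar bounds are collected coordinate by coordinate. *)
Lemma C11_Ck2_rV m (U : set V) (f : V -> 'rV[R]_m) x : open U -> U x -> Ck 2 U f ->
  exists c, C11 f x c.
Proof.
move=> oU Ux Cf.
have /finite_uniform[] : forall k : 'I_m, exists c, C11 (fun y => f y 0 k : R) x c.
- by move=> k; apply: (C11_Ck2 oU Ux); exact: Ck_coord.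
- by move=> k c c'; exact: C11_mono.
move=> c hc.
have [c1 c10 hc1] : exists2 c1, 0 < c1 & forall a, `|a - x| < c1^-1 -> U a.
  have /nbhs_ballP[r /= r0 hr] := near_open oU Ux; exists r^-1; first by rewrite invr_gt0.
  by move=> a; rewrite invrK => ha; apply: hr; rewrite -ball_normE /ball_ /= distrC.
have [e e0 [ec ec1]] : exists2 e, 0 < e & c <= e /\ c1 <= e.
  exists (Num.max c c1); first by rewrite lt_max c10 orbT.
  by rewrite !le_max !lexx orbT.
have {}hc k := C11_mono ec (hc k).
have dfa a : `|a - x| < e^-1 -> differentiable f a.
  by move=> ha; apply: Cf.1; apply: hc1; apply: lt_le_trans ha _; rewrite lef_pV2.
have De a v k : `|a - x| < e^-1 -> ('D_v f a) 0 k = 'D_v (fun y => f y 0 k : R) a.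
  by move=> /dfa da; rewrite derive_mx ?mxE //; exact: diff_derivable.
have nle (w : 'rV[R]_m) r : 0 <= r -> (forall k, `|w 0 k| <= r) -> `|w| <= r.
  move=> r0 h; rewrite [`|w|]mx_normrE; apply/bigmax_leP; split=> // -[i k] _ /=.
  by rewrite (ord1 i).
have e0' := ltW e0.
exists e; split=> //.
- move=> a v ha; apply: nle => [|k]; first by rewrite mulr_ge0.
  by rewrite De //; have [_ _ h _ _] := hc k; exact: h.
- move=> a d ha hd; apply: nle => [|k]; first by rewrite mulr_ge0.
  by have [_ _ _ h _] := hc k; have := h a d ha hd; rewrite !mxE.
- move=> a d v ha hd; apply: nle => [|k]; first by rewrite !mulr_ge0.
  by have [_ _ _ _ h] := hc k; have := h a d v ha hd; rewrite !mxE !De.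
Qed.

End Coordinates.
End LocalBounds.

Section LocalBoundsR3.
Variable R : realType.

Lemma rV3_coordE (v : 'rV[R]_3) : v = \sum_k v 0 k *: delta_mx 0 k.
Proof. exact: row_sum_delta. Qed.

Lemma C11_Ck2_rV3 (W : nat) (U : set 'rV[R]_3) (f : 'rV[R]_3 -> 'rV[R]_W) x :
  open U -> U x -> Ck 2 U f -> exists c, C11 f x c.
Proof.
exact: (C11_Ck2_rV rV3_coordE (fun k v => coord_le_norm v k)).
Qed.

Lemma C11_Ck2_R3 (U : set 'rV[R]_3) (f : 'rV[R]_3 -> R) x :
  open U -> U x -> Ck 2 U f -> exists c, C11 f x c.
Proof. exact: (C11_Ck2 rV3_coordE (fun k v => coord_le_norm v k)). Qed.

Definition stbasis (k : 'I_(3 + 1)) : 'rV[R]_3 * R :=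
  match fintype.split k with inl i => (delta_mx 0 i, 0) | inr _ => (0, 1) end.

Definition stcoord (k : 'I_(3 + 1)) (v : 'rV[R]_3 * R) : R :=
  match fintype.split k with inl i => v.1 0 i | inr _ => v.2 end.

Lemma stcoordE v : v = \sum_k stcoord k v *: stbasis k.
Proof.
rewrite big_split_ord /= big_ord1 /stcoord /stbasis.
under eq_bigr do rewrite (unsplitK (inl _)).
rewrite (unsplitK (inr _)).
case: v => v s /=; rewrite [X in (X, _)](rV3_coordE v) !sum3 /=.
by congr pair => /=; rewrite ?scaler0 ?addr0 ?add0r // [_ *: _]mulr1.
Qed.

Lemma stcoord_le k v : `|stcoord k v| <= `|v|.
Proof.
rewrite /stcoord; case: (fintype.split k) => [i|_]; rewrite [leRHS]prod_normE le_max.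
  by rewrite coord_le_norm.
by rewrite lexx orbT.
Qed.

Lemma C11_Ck2_st (W : nat) (U : set ('rV[R]_3 * R)) (f : 'rV[R]_3 * R -> 'rV[R]_W) x :
  open U -> U x -> Ck 2 U f -> exists c, C11 f x c.
Proof. exact: (C11_Ck2_rV stcoordE stcoord_le). Qed.

(** The remainder is a difference of first derivatives at [a] and at a mean point of the segment, so
    the Lipschitz bound on the derivative suffices. *)
Lemma C11_taylor (V : normedModType R) (f : V -> R) x c a b : C11 f x c ->
  `|a - x| < c^-1 -> `|b - x| < c^-1 ->
  `|f b - f a - 'D_(b - a) f a| <= c * `|b - a| ^+ 2.
Proof.
move=> [c0 df _ _ Lf] ha hb.
have [s s01|s s01] := @mvt_segment_derive R V f a (b - a).
  by apply: df; exact: ball_segment.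
rewrite subrKC => ->; apply: le_trans (Lf _ _ _ ha (ball_segment ha hb s01)) _.
have -> : a + s *: (b - a) - a = s *: (b - a) by rewrite addrC addKr.
case/andP: s01 => s0 s1; rewrite normrZ ger0_norm // expr2 [leRHS]mulrA ler_wpM2r //.
by rewrite ler_wpM2l ?(ltW c0) // ler_piMl.
Qed.

(** Curves defined by solving an equation have no formula to differentiate; their derivative is read
    off from a quadratic remainder. *)
Lemma is_derive_quad (V : normedModType R) (f : R -> V) (s : R) (l : V) (r K : R) :
  0 < r -> (forall h, `|h| < r -> `|f (s + h) - f s - h *: l| <= K * h ^+ 2) ->
  is_derive s 1 f l.
Proof.
move=> r0 hK.
have cvl : h^-1 *: ((f \o shift s) (h *: (1 : R)) - f s) @[h --> 0^'] --> l.
  apply/cvgrPdist_le => /= e e0.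
  have K0 : 0 <= K.
    have h2 : 0 < r / 2 by lra.
    have := hK (r / 2); rewrite gtr0_norm // => /(_ ltac:(lra)).
    by move=> /(le_trans (normr_ge0 _)); rewrite pmulr_lge0 // exprn_gt0.
  near=> h.
  have h0 : h != 0 by near: h; exact: nbhs_dnbhs_neq.
  have hr : `|h| < r by near: h; exact: dnbhs0_lt.
  have he : `|h| <= e / (K + 1) by near: h; apply: dnbhs0_le; rewrite divr_gt0 // ltr_wpDl.
  have -> : h *: (1 : R) = h by rewrite [_ *: _]mulr1.
  rewrite distrC -[X in _ - X](scalerK h0) -scalerBr normrZ normfV.
  rewrite ler_pdivrMl ?normr_gt0 //= (addrC h).
  apply: le_trans (hK _ hr) _; rewrite -real_normK ?num_real // expr2 mulrCA.
  rewrite ler_wpM2l //; apply: le_trans (ler_wpM2l K0 he) _.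
  by rewrite mulrCA ler_piMr ?ltW // ltr_pdivrMr ?mul1r ?ltrDl ?ltr_wpDl.
apply: DeriveDef; first by apply/cvg_ex; exists l.
exact: cvg_lim.
Unshelve. all: by end_near. Qed.

Lemma derive_lin (V W : normedModType R) (f : V -> W) x (a : R) u v : differentiable f x ->
  'D_(a *: u + v) f x = a *: 'D_u f x + 'D_v f x.
Proof. by move=> df; rewrite !deriveE // linearP. Qed.

Lemma derive_grad (f : 'rV[R]_3 -> R) x v : differentiable f x ->
  'D_v f x = dot (grad f x) v.
Proof.
move=> df; rewrite (derive_coord rV3_coordE) // /dot; apply: eq_bigr => k _.
by rewrite mxE mulrC.
Qed.

End LocalBoundsR3.

(** * Curves on the evolving surface *)

Section ImplicitCurve.
Variable R : realType.

(** The lower bound on the slope turns the bound on [g 0] into opposite signs at the two ends of the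
    interval, and the intermediate value theorem applies. *)
Lemma implicit_root (g dg : R -> R) (w0 m : R) : 0 < w0 -> 0 < m ->
  (forall w : R, `|w| <= w0 -> is_derive w 1 g (dg w)) ->
  (forall w : R, `|w| <= w0 -> m <= dg w) -> `|g 0| <= w0 * m ->
  exists2 w, `|w| <= w0 & g w = 0.
Proof.
move=> w00 m0 dgE mdg g0.
have lo : g (- w0) <= 0.
  have [||s s0] := @mvt_derive R g dg (- w0) 0; rewrite ?oppr_le0 ?(ltW w00) //.
    by move=> s /andP[s1 s2]; apply: dgE; rewrite ler_norml s1 (le_trans s2) ?(ltW w00).
  have : m <= dg s by case/andP: s0 => s1 s2; apply: mdg; rewrite ler_norml s1 (le_trans s2) ?(ltW w00).
  by rewrite sub0r opprK; have /ler_normlP[_ +] := g0; nra.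
have hi : 0 <= g w0.
  have [||s s0] := @mvt_derive R g dg 0 w0; rewrite ?(ltW w00) //.
    by move=> s /andP[s1 s2]; apply: dgE; rewrite ger0_norm.
  have : m <= dg s by case/andP: s0 => s1 s2; apply: mdg; rewrite ger0_norm.
  by rewrite subr0; have /ler_normlP[+ _] := g0; nra.
have [|||w] := @IVT R g (- w0) w0 0; first by lra.
- apply: derivable_within_continuous => w; rewrite in_itv /= => wab.
  by have [] := dgE w; rewrite ?ler_norml.
- by rewrite ge_min lo le_max hi orbT.
by rewrite in_itv /= -ler_norml => h1 h2; exists w.
Qed.

(** Monotonicity in quantitative form: it gives uniqueness of the root as well as its Lipschitz
    dependence on a parameter. *)
Lemma derive_lower (g dg : R -> R) (w0 m w w' : R) :
  (forall w : R, `|w| <= w0 -> is_derive w 1 g (dg w)) ->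
  (forall w : R, `|w| <= w0 -> m <= dg w) -> `|w| <= w0 -> `|w'| <= w0 ->
  m * `|w' - w| <= `|g w' - g w|.
Proof.
move=> dgE mdg; wlog : w w' / w <= w' => [hw|ww' hw hw'].
  by have [/hw|/ltW /hw h hw1 hw2] := leP w w'; [exact|rewrite distrC [leRHS]distrC; exact: h].
have sw s : w <= s <= w' -> `|s| <= w0.
  move: hw hw'; rewrite !ler_norml => /andP[h1 h2] /andP[h3 h4] /andP[h5 h6].
  by apply/andP; split; lra.
have [|s /sw s0 ->] := @mvt_derive R g dg w w' ww'; first by move=> s /sw; exact: dgE.
by rewrite normrM ler_wpM2r // (le_trans (mdg _ s0)) // ler_norm.
Qed.

Lemma quotient_lip (a a' b b' q al da db : R) : 0 < q -> q <= b -> q <= b' ->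
  `|a| <= al -> `|a - a'| <= da -> `|b - b'| <= db ->
  `|- (a' / b') - - (a / b)| <= (da + al / q * db) / q.
Proof.
move=> q0 qb qb' ha hda hdb.
have b0 : 0 < b by exact: lt_le_trans qb.
have b'0 : 0 < b' by exact: lt_le_trans qb'.
have -> : - (a' / b') - - (a / b) = ((a - a') + - (a / b) * (b - b')) / b'.
  by field; rewrite !gt_eqF.
rewrite normrM normfV (gtr0_norm b'0); apply: ler_pM => //.
- by rewrite invr_ge0 ltW.
- apply: le_trans (ler_normD _ _) _; apply: lerD => //.
  rewrite normrM; apply: ler_pM => //; rewrite normrN normrM normfV (gtr0_norm b0).
  by apply: ler_pM; rewrite ?invr_ge0 ?(ltW b0) // lef_pV2.
- by rewrite lef_pV2.
Qed.

Lemma norm_le2 (s : R) : -1 < s < 2 -> `|s| <= 2.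
Proof. by rewrite ler_norml; lra. Qed.

Lemma norm_le3 (s s' : R) : -1 < s < 2 -> -1 < s' < 2 -> `|s - s'| <= 3.
Proof. by rewrite ler_norml; lra. Qed.

(** The parameter runs over an interval around [0, 1], so that the derivatives at the two end points
    are two-sided. The bounds scale as for a reparametrised chord: the velocity is linear in its
    length, the oscillation of the velocity quadratic. *)
Definition curve_in (A : set 'rV[R]_3) (X Y : 'rV[R]_3) (c : R)
    (g dg : R -> 'rV[R]_3) :=
  [/\ g 0 = X, g 1 = Y
    & forall s : R, -1 < s < 2 ->
      [/\ A (g s), is_derive s 1 g (dg s), `|dg s| <= c * `|Y - X|,
        `|g s - X| <= c * `|Y - X|
      & forall s', -1 < s' < 2 -> `|dg s' - dg s| <= c * `|Y - X| ^+ 2]].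

(** The curve is a graph over the chord: the point [X + s *: (Y - X)] is corrected by a multiple of
    a fixed vector, the gradient of [F] at [X0], along which [F] increases at a definite rate near
    [X0]. *)
Lemma implicit_curve (F : 'rV[R]_3 -> R) (U : set 'rV[R]_3) (X0 : 'rV[R]_3) :
  open U -> U X0 -> Ck 2 U F -> grad F X0 != 0 ->
  exists2 c, 0 < c & forall X Y, F X = 0 -> F Y = 0 ->
    `|X - X0| < c^-1 -> `|Y - X0| < c^-1 ->
    exists g dg, curve_in [set Z | U Z /\ F Z = 0] X Y c g dg.
Proof.
move=> oU UX0 CF gF0.
have [c1 hc1U] : exists c, C11 F X0 c /\ forall a, `|a - X0| < c^-1 -> U a.
  have [c0 hc0] := C11_Ck2_R3 oU UX0 CF.
  have /nbhs_ballP[r /= r0 hr] := near_open oU UX0.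
  exists (Num.max c0 r^-1); split; first by apply: C11_mono hc0; rewrite le_max lexx.
  move=> a ha; apply: hr; rewrite -ball_normE /ball_ /= distrC.
  apply: lt_le_trans ha _; rewrite invf_ple ?posrE ?lt_max ?invr_gt0 ?r0 ?orbT //.
  by rewrite le_max lexx orbT.
case: hc1U => hc1 c1U; have [c10 dF bF lF l2F] := hc1.
move eE: (grad F X0) gF0 => e gF0; pose N := `|e|; pose m := dot e e.
have N0 : 0 < N by rewrite normr_gt0.
have m0 : 0 < m by rewrite lt_def dot_eq0 gF0 dot_ge0.
have X0r r : 0 < r -> `|X0 - X0| < r by rewrite subrr normr0.
(* Half the slope of [F] at [X0] in the direction [e]; it bounds the slope from below on the ball of
   radius [r]. *)
pose q := m / 2; have q0 : 0 < q by rewrite divr_gt0.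
pose r := Num.min c1^-1 (q / (c1 * N)).
have r0 : 0 < r by rewrite lt_min invr_gt0 c10 divr_gt0 ?mulr_gt0.
have rc1 a : `|a - X0| < r -> `|a - X0| < c1^-1.
  by move=> h; apply: lt_le_trans h _; rewrite ge_min lexx.
have ic10 : 0 < c1^-1 by rewrite invr_gt0.
have qF a : `|a - X0| < r -> q <= 'D_e F a.
  move=> ar.
  have h := l2F X0 a e (X0r _ ic10) (rc1 _ ar).
  have DeE : 'D_e F X0 = m by rewrite derive_grad ?eE //; apply: dF; rewrite X0r // invr_gt0.
  have : c1 * `|a - X0| * `|e| <= q.
    rewrite mulrAC mulrC -ler_pdivlMr ?mulr_gt0 //.
    by apply: le_trans (ltW ar) _; rewrite ge_min lexx orbT.
  by move: h; rewrite DeE => /ler_normlP[h1 _]; rewrite /q in q0 *; lra.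
pose w0 := r / (2 * N); have w00 : 0 < w0 by rewrite divr_gt0 // mulr_gt0.
(* The first bound keeps the chord within half of the radius [r], the other half being left to
   corrections up to [w0]; the second makes [F] on the chord so small that a correction within [w0]
   reaches the level 0. *)
pose r' := Num.min (r / 10) (w0 * q / (4 * c1)).
have r'0 : 0 < r'.
  rewrite lt_min; apply/andP; split; first lra.
  by rewrite divr_gt0 // mulr_gt0.
have r'r : 10 * r' <= r by have : r' <= r / 10; [rewrite ge_min lexx|lra].
have r'c : 4 * c1 * r' <= w0 * q.
  have : r' <= w0 * q / (4 * c1) by rewrite ge_min lexx orbT.
  by rewrite ler_pdivlMr ?mulr_gt0 // mulrC.
(* Up to powers of the chord length, [K] is the Lipschitz constant of the curve and [K2] the
   oscillation of its velocity; the factor 3 is the length of the parameter interval. *)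
pose K := 1 + c1 / q * N; have c1q0 : 0 < c1 / q by rewrite divr_gt0.
have K1 : 1 <= K by rewrite lerDl ltW // mulr_gt0.
have K0 : 0 <= K by lra.
pose K2 := 3 * K * c1 / q * N * K.
have K20 : 0 <= K2 by rewrite /K2 !mulr_ge0 ?invr_ge0 ?ltW //; lra.
have r'I : 0 < r'^-1 by rewrite invr_gt0.
pose c := r'^-1 + 3 * K + K2.
have c0 : 0 < c by rewrite /c; lra.
have K3c : 3 * K <= c by rewrite /c; lra.
have K2c : K2 <= c by rewrite /c; lra.
have K1c : K <= c by lra.
have K2c' : K * 2 <= c by lra.
exists c => // X Y FX FY.
have lc a : `|a - X0| < c^-1 -> `|a - X0| < r'.
  by move=> /lt_le_trans; apply; rewrite invf_ple ?posrE // /c; lra.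
move=> /lc hX /lc hY; rewrite /curve_in; move VE: (Y - X) => V.
have V2 : `|V| < 2 * r'.
  have -> : V = (Y - X0) - (X - X0) by rewrite -VE opprB addrA subrK.
  by apply: le_lt_trans (ler_normB _ _) _; lra.
pose p (s : R) := X + s *: V.
have pp s s' : p s' - p s = (s' - s) *: V.
  by rewrite /p opprD addrACA subrr add0r scalerBl.
have pX (s : R) : -1 < s < 2 -> `|p s - X0| < 5 * r'.
  move=> hs; rewrite /p addrAC; apply: le_lt_trans (ler_normD _ _) _.
  have : `|s *: V| <= 2 * `|V| by rewrite normrZ ler_wpM2r // norm_le2 // hs.
  lra.
have pwX (s w : R) : -1 < s < 2 -> `|w| <= w0 -> `|p s + w *: e - X0| < r.
  move=> /pX hs hw; rewrite addrAC; apply: le_lt_trans (ler_normD _ _) _.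
  have : `|w *: e| <= r / 2.
    rewrite normrZ; apply: le_trans (ler_wpM2r (ltW N0) hw) _.
    by rewrite /w0 invfM mulrA divfK ?gt_eqF.
  lra.
have dg (s w : R) : -1 < s < 2 -> `|w| <= w0 ->
    is_derive w 1 (fun w => F (p s + w *: e)) ('D_e F (p s + w *: e)).
  by move=> hs hw; apply: is_derive_comp; [exact: is_derive_line|apply: dF; apply: rc1; exact: pwX].
have qg (s w : R) : -1 < s < 2 -> `|w| <= w0 -> q <= 'D_e F (p s + w *: e).
  by move=> hs hw; apply: qF; exact: pwX.
have w0r (w : R) : w = 0 -> `|w| <= w0 by move=> ->; rewrite normr0 ltW.
have i0 : -1 < (0 : R) < 2 by clear; lra.
have i1 : -1 < (1 : R) < 2 by clear; lra.
pose w (s : R) := xget 0 [set w | `|w| <= w0 /\ F (p s + w *: e) = 0].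
have wP (s : R) : -1 < s < 2 -> `|w s| <= w0 /\ F (p s + w s *: e) = 0.
  move=> hs; rewrite /w; case: xgetP => [y _ //|] hno; exfalso.
  have [|w' h1 h2] := implicit_root w00 q0 (fun w' => dg s w' hs) (fun w' => qg s w' hs).
    rewrite scale0r addr0 -[F _]subr0 -FX.
    have -> : F X = F (p 0) by rewrite /p scale0r addr0.
    have h0 t : -1 < t < 2 -> `|p t - X0| < c1^-1.
      by move=> ht; apply: rc1; apply: lt_le_trans (pX t ht) _; clear -r'r r'0; lra.
    apply: le_trans (lF _ _ (h0 _ i0) (h0 _ hs)) _; rewrite pp subr0 normrZ.
    have hs2 := norm_le2 hs.
    apply: le_trans r'c; rewrite (mulrC 4) -mulrA ler_wpM2l ?(ltW c10) //.
    by apply: le_trans (ler_pM _ _ hs2 (ltW V2)) _ => //; clear; lra.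
  by apply: (hno w').
have wu (s w' : R) : -1 < s < 2 -> `|w'| <= w0 -> F (p s + w' *: e) = 0 -> w s = w'.
  move=> hs hw' Fw'; have [h1 h2] := wP s hs.
  have := derive_lower (fun w' => dg s w' hs) (fun w' => qg s w' hs) h1 hw'.
  rewrite Fw' h2 subrr normr0 pmulr_rle0 // normr_le0 subr_eq0 => /eqP.
  by [].
have wz : w 0 = 0.
  by apply: wu; rewrite ?normr0 ?ltW // /p !scale0r !addr0.
have wo : w 1 = 0.
  by apply: wu; rewrite ?normr0 ?ltW // /p scale0r addr0 scale1r -VE subrKC.
have wL (s s' : R) : -1 < s < 2 -> -1 < s' < 2 -> `|w s' - w s| <= c1 / q * `|V| * `|s' - s|.
  move=> hs hs'; have [h1 h2] := wP s hs; have [h3 h4] := wP s' hs'.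
  have := derive_lower (fun w' => dg s' w' hs') (fun w' => qg s' w' hs') h1 h3.
  rewrite h4 -h2 => h5.
  have h6 := lF _ _ (rc1 _ (pwX s' _ hs' h1)) (rc1 _ (pwX s _ hs h1)).
  have := le_trans h5 h6.
  rewrite opprD addrACA subrr addr0 pp normrZ (distrC s).
  rewrite -ler_pdivlMl // => /le_trans; apply.
  by rewrite mulrA (mulrC q^-1) -mulrA [_ * `|V|]mulrC mulrA.
pose g (s : R) := p s + w s *: e.
have gX0 (s : R) : -1 < s < 2 -> `|g s - X0| < c1^-1.
  by move=> hs; apply: rc1; apply: pwX => //; have [] := wP s hs.
(* Implicit differentiation of [F (g s) = 0]. *)
pose dw (s : R) := - ('D_V F (g s) / 'D_e F (g s)).
have gg s s' : g s' - g s = (s' - s) *: V + (w s' - w s) *: e.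
  by rewrite /g opprD addrACA pp -scalerBl.
have gL (s s' : R) : -1 < s < 2 -> -1 < s' < 2 -> `|g s' - g s| <= K * `|V| * `|s' - s|.
  move=> hs hs'; rewrite gg; apply: le_trans (ler_normD _ _) _.
  rewrite !normrZ.
  have := ler_wpM2r (ltW N0) (wL s s' hs hs').
  by rewrite /K -/N; clear; lra.
have qg' (s : R) : -1 < s < 2 -> q <= 'D_e F (g s).
  by move=> hs; apply: qg => //; have [] := wP s hs.
have Dg0 (s : R) : -1 < s < 2 -> 'D_e F (g s) != 0.
  by move=> /qg' h; rewrite gt_eqF // (lt_le_trans q0).
have dwb (s : R) : -1 < s < 2 -> `|dw s| <= c1 / q * `|V|.
  move=> hs; rewrite /dw normrN normrM normfV.
  have h1 := bF (g s) V (gX0 s hs); have h2 := qg' s hs.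
  have h3 : 0 < 'D_e F (g s) by exact: lt_le_trans h2.
  rewrite (gtr0_norm h3) ler_pdivrMr //; apply: le_trans h1 _.
  have -> : c1 * `|V| = c1 / q * `|V| * q by field; rewrite gt_eqF.
  by rewrite ler_wpM2l // mulr_ge0 // ltW.
have g0X : g 0 = X by rewrite /g /p wz !scale0r !addr0.
exists g, (fun s => V + dw s *: e); split=> //.
- by rewrite /g /p wo scale0r addr0 scale1r -VE subrKC.
move=> s hs; split.
- by split; [exact/c1U/gX0|have [] := wP s hs].
- pose rr := Num.min (s + 1) (2 - s).
  have rr0 : 0 < rr by rewrite lt_min; clear -hs; lra.
  pose KK := c1 * (K * `|V|) ^+ 2 / q * N.
  apply: (is_derive_quad (r := rr) (K := KK)) => // h hrr.
  have hs' : -1 < s + h < 2.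
    move: hrr; rewrite ltr_norml => /andP[].
    have : rr <= s + 1 by rewrite ge_min lexx.
    have : rr <= 2 - s by rewrite ge_min lexx orbT.
    by clear; lra.
  have [_ Fs] := wP s hs; have [_ Fs'] := wP _ hs'.
  have T := C11_taylor hc1 (gX0 _ hs) (gX0 _ hs').
  have dFs := dF _ (gX0 _ hs).
  have gh : g (s + h) - g s = h *: V + (w (s + h) - w s) *: e.
    by rewrite gg addrAC subrr add0r.
  have De : 'D_(g (s + h) - g s) F (g s) =
      h * 'D_V F (g s) + (w (s + h) - w s) * 'D_e F (g s).
    rewrite gh derive_lin //; congr (_ + _).
    by rewrite deriveE // linearZ deriveE.
  rewrite De Fs Fs' subrr sub0r normrN in T; rewrite gh.
  have -> : h *: V + (w (s + h) - w s) *: e - h *: (V + dw s *: e) =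
            (w (s + h) - w s - h * dw s) *: e.
    by rewrite scalerDr opprD addrACA subrr add0r scalerA -scalerBl.
  have -> : KK * h ^+ 2 = (c1 * (K * `|V|) ^+ 2 * h ^+ 2 / q) * N by rewrite /KK; ring.
  rewrite normrZ ler_wpM2r ?(ltW N0) //.
  rewrite ler_pdivlMr //.
  have h2 := qg' s hs.
  have h3 : 0 < 'D_e F (g s) by exact: lt_le_trans h2.
  apply: le_trans (ler_wpM2l (normr_ge0 _) h2) _.
  rewrite -(gtr0_norm h3) -normrM /dw mulrBl mulrN mulNr opprK.
  rewrite mulrA divfK; last exact: Dg0.
  have hL := gL s _ hs hs'; rewrite (addrAC s) subrr add0r in hL.
  rewrite addrC; apply: le_trans T _.
  rewrite -mulrA ler_wpM2l ?(ltW c10) // -[h ^+ 2]real_normK ?num_real // -exprMn.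
  by rewrite ler_sqr ?nnegrE ?mulr_ge0.
- apply: le_trans (ler_normD _ _) _; rewrite normrZ.
  have := ler_wpM2r (ltW N0) (dwb s hs); rewrite -/N.
  move=> hdw; apply: (@le_trans _ _ (K * `|V|)); first by rewrite /K; clear -hdw; lra.
  by rewrite ler_wpM2r.
- have := gL 0 s i0 hs; rewrite subr0 g0X => /le_trans; apply.
  have hs2 := norm_le2 hs; apply: (@le_trans _ _ (K * `|V| * 2)).
    by rewrite ler_wpM2l // mulr_ge0.
  by rewrite mulrAC ler_wpM2r.
- move=> s' hs'; rewrite opprD addrACA subrr add0r -scalerBl normrZ.
  have G : `|g s - g s'| <= K * `|V| * 3.
    apply: le_trans (gL _ _ hs' hs) _.
    by rewrite ler_wpM2l ?mulr_ge0 // norm_le3.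
  have h1 := l2F _ _ V (gX0 _ hs') (gX0 _ hs).
  have h2 := l2F _ _ e (gX0 _ hs') (gX0 _ hs); rewrite -/N in h2.
  have h3 : `|'D_V F (g s) - 'D_V F (g s')| <= c1 * (K * `|V| * 3) * `|V|.
    by apply: le_trans h1 _; rewrite ler_wpM2r // ler_wpM2l ?(ltW c10).
  have h4 : `|'D_e F (g s) - 'D_e F (g s')| <= c1 * (K * `|V| * 3) * N.
    by apply: le_trans h2 _; rewrite ler_wpM2r ?(ltW N0) // ler_wpM2l ?(ltW c10).
  have h5 := quotient_lip q0 (qg' _ hs) (qg' _ hs') (bF _ V (gX0 s hs)) h3 h4.
  apply: le_trans (ler_wpM2r (ltW N0) h5) _.
  have -> : (c1 * (K * `|V| * 3) * `|V| + c1 * `|V| / q * (c1 * (K * `|V| * 3) * N)) / q * N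
      = K2 * `|V| ^+ 2 by rewrite /K2 {3}/K; clear; ring.
  by rewrite ler_wpM2r ?sqr_ge0.
Qed.

End ImplicitCurve.

(** * Uniform bounds on the surface by compactness *)

Section Surface.
Variable R : realType.
Implicit Type S : surface_data R.

Lemma norm_pair_lt (V W : normedModType R) (p : V * W) (r : R) :
  (`|p| < r) = (`|p.1| < r) && (`|p.2| < r).
Proof. by rewrite [`|p|]prod_normE gt_max. Qed.

Lemma norm_rV_le n (v : 'rV[R]_n) r : 0 <= r -> (forall k, `|v 0 k| <= r) -> `|v| <= r.
Proof.
move=> r0 h; rewrite [`|v|]mx_normrE; apply/bigmax_leP; split=> // -[i k] _ /=.
by rewrite (ord1 i).
Qed.

(** Here [c] is both the bound and the inverse of the radius on which it is valid, so that a single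
    constant has to be extracted. *)
Lemma compact_uniform_ball (V : normedModType R) (K : set V) (P : R -> V -> Prop) :
  compact K ->
  (forall c c' x, 0 < c -> c <= c' -> P c x -> P c' x) ->
  (forall x, K x -> exists2 c, 0 < c & forall y, K y -> `|y - x| < c^-1 -> P c y) ->
  exists2 c, 0 < c & forall x, K x -> P c x.
Proof.
move=> cK mono loc.
have [|x Kx|c c0 hc] := @compact_uniform R V K (fun c x => 0 < c /\ P c x) cK.
- move=> c c' x cc' [c0 Pc]; split; first exact: lt_le_trans cc'.
  exact: mono cc' Pc.
- have [c c0 hc] := loc x Kx; exists c.
  have : \forall y \near x, `|x - y| < c^-1.
    by apply: cvgr_dist_lt; [exact: cvg_id|rewrite invr_gt0].
  by apply: filterS => y; rewrite distrC => xy Ky; split=> //; exact: hc.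
by exists c => // x /hc[].
Qed.

Lemma time_compact S : compact (time_set S).
Proof.
rewrite (_ : time_set S = [set` `[0, Tend S]]); first exact: segment_compact.
by apply/seteqP; split=> x /=; rewrite in_itv.
Qed.

(** [f] is a local extension of the flow map off the surface and beyond the time interval; its
    bounds and its domain are measured by the same [c]. *)
Definition chart_at S (X0 : 'rV[R]_3) (t0 c : R) (f : 'rV[R]_3 * R -> 'rV[R]_3) :=
  C11 f (X0, t0) c /\
  forall X t, Gamma0 S X -> time_set S t -> `|X - X0| < c^-1 -> `|t - t0| < c^-1 ->
    f (X, t) = Phi S (X, t).

Lemma chart_exists S X0 t0 : evolving_surface S -> Gamma0 S X0 -> time_set S t0 ->
  exists c f, chart_at S X0 t0 c f.
Proof.
move=> surf GX tt; have [|U [f [oU Ux sf fE]]] := es_Phi_smooth surf (x := (X0, t0)).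
  by split.
have [c hc] := C11_Ck2_st oU Ux (sf 2%N).
have /nbhs_ballP[r /= r0 hr] := near_open oU Ux.
exists (Num.max c r^-1), f; split; first by apply: C11_mono hc; rewrite le_max lexx.
have [c0 _ _ _ _] := hc.
move=> X t GX' tt' hX ht; apply: fE => //.
apply: hr; rewrite -ball_normE /ball_ /= distrC.
rewrite (lt_le_trans (y := (Num.max c r^-1)^-1)) //.
  by rewrite norm_pair_lt hX.
by rewrite invf_ple ?posrE ?lt_max ?c0 // le_max lexx orbT.
Qed.

Lemma chart_slice S X0 t0 c f t (k : 'I_3) : chart_at S X0 t0 c f -> `|t - t0| < c^-1 ->
  forall X, `|X - X0| < c^-1 -> differentiable f (X, t).
Proof.
by move=> [[_ df _ _ _] _] ht X hX; apply: df; rewrite norm_pair_lt hX.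
Qed.

(** The time increment of [f] has a spatial derivative of order [t - t0], by the Lipschitz bound on
    the derivative; the mean value inequality in space then bounds the mixed second difference. *)
Lemma chart_time_shift S X0 t0 c f X Y t : chart_at S X0 t0 c f -> `|t - t0| < c^-1 ->
  `|X - X0| < c^-1 -> `|Y - X0| < c^-1 ->
  `|(f (Y, t) - f (X, t)) - (f (Y, t0) - f (X, t0))| <= c * `|t - t0| * `|Y - X|.
Proof.
move=> cf ht hX hY; have [[c0 _ _ _ l2] _] := cf.
have ht0 : `|t0 - t0| < c^-1 by rewrite subrr normr0 invr_gt0.
apply: norm_rV_le => [|k]; first by rewrite !mulr_ge0 // ltW.
have dfk s Z : `|s - t0| < c^-1 -> `|Z - X0| < c^-1 ->
    differentiable (fun Z => f (Z, s) 0 k : R) Z /\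
    forall v, 'D_v (fun Z => f (Z, s) 0 k : R) Z = ('D_(v, 0) f (Z, s)) 0 k.
  move=> hs hZ; have df := chart_slice k cf hs hZ.
  have [d1 d2] := diff_slicel s Z.
  have dfs : differentiable (fun Z => f (Z, s)) Z by exact: (differentiable_comp d1 df).
  split.
    exact: (differentiable_comp dfs (differentiable_coord _ 0 k)).
  move=> v; rewrite -derive_slicel // [in RHS]derive_mx ?mxE //.
  exact: diff_derivable.
pose h Z : R := f (Z, t) 0 k - f (Z, t0) 0 k.
have dh Z : `|Z - X0| < c^-1 -> differentiable h Z.
  move=> hZ; have [a1 _] := dfk _ _ ht hZ; have [a2 _] := dfk _ _ ht0 hZ.
  exact: (differentiableB a1 a2).
have Dh Z v : `|Z - X0| < c^-1 -> `|'D_v h Z| <= c * `|t - t0| * `|v|.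
  move=> hZ; have [a1 e1] := dfk _ _ ht hZ; have [a2 e2] := dfk _ _ ht0 hZ.
  have -> : 'D_v h Z = ('D_(v, 0) f (Z, t)) 0 k - ('D_(v, 0) f (Z, t0)) 0 k.
    by rewrite -e1 -e2; apply: deriveB; exact: diff_derivable.
  have := l2 (Z, t0) (Z, t) (v, 0); rewrite !norm_pair_lt /= hZ ht ht0 => /(_ isT isT).
  have -> : `|(Z, t) - (Z, t0) : 'rV[R]_3 * R| = `|t - t0|.
    by rewrite [LHS]prod_normE /= subrr normr0 max_r.
  have -> : `|(v, 0) : 'rV[R]_3 * R| = `|v|.
    by rewrite [LHS]prod_normE /= normr0 max_l.
  by apply: le_trans; have := coord_le_norm ('D_(v, 0) f (Z, t) - 'D_(v, 0) f (Z, t0)) k; rewrite !mxE.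
apply: le_trans _ (mvt_ball dh Dh hX hY).
suff -> : (f (Y, t) - f (X, t) - (f (Y, t0) - f (X, t0))) 0 k = h Y - h X by [].
by rewrite /h !mxE; ring.
Qed.

Lemma chart_lip S X0 t0 c f X Y t s : chart_at S X0 t0 c f ->
  `|X - X0| < c^-1 -> `|Y - X0| < c^-1 -> `|t - t0| < c^-1 -> `|s - t0| < c^-1 ->
  `|f (Y, s) - f (X, t)| <= c * Num.max `|Y - X| `|s - t|.
Proof.
move=> [[_ _ _ l _] _] hX hY ht hs.
by have := l (X, t) (Y, s); rewrite !norm_pair_lt /= hX hY ht hs => /(_ isT isT).
Qed.

End Surface.

Section SurfaceBounds.
Variable R : realType.
Implicit Type S : surface_data R.

Lemma C11_local_ext (V : normedModType R) m (A : set V) (f : V -> 'rV[R]_m) x :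
  (forall (U : set V) (g : V -> 'rV[R]_m), open U -> U x -> Ck 2 U g -> exists c, C11 g x c) ->
  smooth_on A f -> A x ->
  exists c g, C11 g x c /\ forall y, A y -> `|y - x| < c^-1 -> g y = f y.
Proof.
move=> hC sf Ax; have [U [g [oU Ux sg gE]]] := sf x Ax.
have [c hc] := hC _ _ oU Ux (sg 2%N); have [c0 _ _ _ _] := hc.
have /nbhs_ballP[r /= r0 hr] := near_open oU Ux.
exists (Num.max c r^-1), g; split; first by apply: C11_mono hc; rewrite le_max lexx.
move=> y Ay hy; apply: gE => //.
apply: hr; rewrite -ball_normE /ball_ /= distrC.
apply: lt_le_trans hy _.
by rewrite invf_ple ?posrE ?lt_max ?c0 // le_max lexx orbT.
Qed.

(** The inverse map is smooth at each time separately, without joint regularity in time. Near a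
    diagonal point the Lipschitz bound at time [t0] is therefore carried over to nearby times by the
    mixed difference; away from the diagonal, injectivity keeps the images apart. *)
Lemma Phi_inverse_lip S : evolving_surface S ->
  exists2 C, 0 < C & forall X Y t, Gamma0 S X -> Gamma0 S Y -> time_set S t ->
    `|Y - X| <= C * `|Phi S (Y, t) - Phi S (X, t)|.
Proof.
move=> surf.
pose P (c : R) (p : 'rV[R]_3 * 'rV[R]_3 * R) :=
  `|p.1.2 - p.1.1| <= c * `|Phi S (p.1.2, p.2) - Phi S (p.1.1, p.2)|.
have cG := es_compact surf.
have cK : compact ((Gamma0 S `*` Gamma0 S) `*` time_set S).
  by apply: compact_setX; [exact: compact_setX|exact: time_compact].
have [||C C0 hC] := @compact_uniform_ball R _ _ P cK; last first.
- by exists C => // X Y t GX GY tt; apply: (hC (X, Y, t)).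
- move=> [[X0 Y0] t0] [[/= GX0 GY0] tt0].
  have [XY|XY] := eqVneq X0 Y0.
    subst Y0.
    have [c1 [f hf]] := chart_exists surf GX0 tt0.
    have [Psi [sPsi PsiK]] := es_Phi_inv_smooth surf tt0.
    have G0 : Gamma S t0 (Phi S (X0, t0)) by exists X0.
    have [c4 [g [hg gE]]] := C11_local_ext (fun U g => @C11_Ck2_rV3 R 3 U g _) sPsi G0.
    have [c40 _ _ lg _] := hg; have [[c10 _ _ _ _] fE] := hf.
    pose c := c1 + 2 * c1 * c4 + 2 * c4.
    have c14 : 0 < c1 * c4 by rewrite mulr_gt0.
    have c0 : 0 < c by rewrite /c; lra.
    have cc1 : c1 <= c by rewrite /c; lra.
    have ic1 : c^-1 <= c1^-1 by rewrite lef_pV2.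
    exists c => // -[[X Y] t] [[/= GX GY] tt].
    rewrite !norm_pair_lt /= => /andP[/andP[hX hY] ht].
    have hX1 := lt_le_trans hX ic1; have hY1 := lt_le_trans hY ic1.
    have ht1 := lt_le_trans ht ic1.
    have ht0 : `|t0 - t0| < c1^-1 by rewrite subrr normr0 invr_gt0.
    have X00 : `|X0 - X0| < c1^-1 by rewrite subrr normr0 invr_gt0.
    have near0 Z : Gamma0 S Z -> `|Z - X0| < c^-1 ->
        `|Phi S (Z, t0) - Phi S (X0, t0)| < c4^-1.
      move=> GZ hZ; have hZ1 := lt_le_trans hZ ic1.
      rewrite -!fE //.
      apply: le_lt_trans (chart_lip hf X00 hZ1 ht0 ht0) _.
      rewrite subrr normr0 max_l // -ltr_pdivlMl // -invfM.
      by apply: lt_le_trans hZ _; rewrite lef_pV2 ?posrE // /c; lra.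
    have h1 : `|Y - X| <= c4 * `|Phi S (Y, t0) - Phi S (X, t0)|.
      have nX := near0 X GX hX; have nY := near0 Y GY hY.
      have GtX : Gamma S t0 (Phi S (X, t0)) by exists X.
      have GtY : Gamma S t0 (Phi S (Y, t0)) by exists Y.
      by have := lg _ _ nX nY; rewrite !gE ?PsiK.
    have h2 := chart_time_shift hf ht1 hX1 hY1.
    rewrite !fE // in h2.
    set A := Phi S (Y, t) - Phi S (X, t) in h2 *.
    set B := Phi S (Y, t0) - Phi S (X, t0) in h1 h2 *.
    have h3 : `|B| <= `|A| + c1 * `|t - t0| * `|Y - X|.
      by rewrite -[B](subKr A); apply: le_trans (ler_normB _ _) _; rewrite lerD2l.
    (* The error caused by the change of time is at most half of the left side, so it can be
       absorbed. *)
    have h4 : 2 * c1 * c4 * `|t - t0| <= 1.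
      rewrite -ler_pdivlMl ?mulr1; last by lra.
      by apply: le_trans (ltW ht) _; rewrite lef_pV2 ?posrE /c; lra.
    have h5 : `|Y - X| <= 2 * c4 * `|A|.
      have h6 := ler_wpM2r (normr_ge0 (Y - X)) h4.
      have h7 := ler_wpM2l (ltW c40) h3.
      by move: h1 h6 h7; clear; lra.
    by apply: le_trans h5 _; rewrite ler_wpM2r // /c; lra.
  have [c1 [f hf]] := chart_exists surf GX0 tt0.
  have [c2 [g hg]] := chart_exists surf GY0 tt0.
  have [[c10 _ _ _ _] fE] := hf; have [[c20 _ _ _ _] gE] := hg.
  pose D := `|Phi S (Y0, t0) - Phi S (X0, t0)|.
  have D0 : 0 < D.
    rewrite normr_gt0 subr_eq0; apply: contra_neq XY => e.
    by apply: (es_Phi_inj surf tt0); rewrite ?inE.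
  (* Each image moves by at most [D / 4], hence they stay [D / 2] apart; the term with 2 compares
     this with the largest possible distance of the labels. *)
  pose c := c1 + c2 + 4 * c1 / D + 4 * c2 / D + 2 * (`|Y0 - X0| + 2) / D + 1.
  have q1 : 0 < 4 * c1 / D by rewrite divr_gt0 // mulr_gt0.
  have q2 : 0 < 4 * c2 / D by rewrite divr_gt0 // mulr_gt0.
  have q3 : 0 < 2 * (`|Y0 - X0| + 2) / D by rewrite divr_gt0 // mulr_gt0 // ltr_wpDl.
  have c0 : 0 < c by rewrite /c; lra.
  exists c => // -[[X Y] t] [[/= GX GY] tt].
  rewrite !norm_pair_lt /= => /andP[/andP[hX hY] ht].
  have icl d : 0 < d -> d <= c -> c^-1 <= d^-1 by move=> d0 dc; rewrite lef_pV2.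
  have ic1 : c^-1 <= c1^-1 by apply: icl => //; rewrite /c; lra.
  have ic2 : c^-1 <= c2^-1 by apply: icl => //; rewrite /c; lra.
  have ic3 : c^-1 <= 1 by rewrite -[leRHS]invr1; apply: icl => //; rewrite /c; lra.
  have ht0 d : 0 < d -> `|t0 - t0| < d^-1 by rewrite subrr normr0 invr_gt0.
  have z0 (Z : 'rV[R]_3) d : 0 < d -> `|Z - Z| < d^-1 by rewrite subrr normr0 invr_gt0.
  have est d (Z Z0 : 'rV[R]_3) F : 0 < d -> chart_at S Z0 t0 d F -> Gamma0 S Z -> Gamma0 S Z0 ->
      d <= c -> 4 * d / D <= c ->
      `|Z - Z0| < c^-1 -> `|Phi S (Z, t) - Phi S (Z0, t0)| <= D / 4.
    move=> d0 hF GZ GZ0 dc dDc hZ; have [_ FE] := hF.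
    have hZ1 := lt_le_trans hZ (icl _ d0 dc); have ht1 := lt_le_trans ht (icl _ d0 dc).
    rewrite -!FE // ?z0 ?ht0 //.
    apply: le_trans (chart_lip hF (z0 _ _ d0) hZ1 (ht0 _ d0) ht1) _.
    have h : Num.max `|Z - Z0| `|t - t0| <= c^-1 by rewrite ge_max !ltW.
    apply: le_trans (ler_wpM2l (ltW d0) h) _.
    have h' : 4 * d <= c * D by rewrite -ler_pdivrMr.
    by rewrite ler_pdivrMr //; lra.
  have e1 : `|Phi S (X, t) - Phi S (X0, t0)| <= D / 4.
    by apply: est hf _ _ _ _ _ => //; rewrite /c; lra.
  have e2 : `|Phi S (Y, t) - Phi S (Y0, t0)| <= D / 4.
    by apply: est hg _ _ _ _ _ => //; rewrite /c; lra.
  have e3 : D / 2 <= `|Phi S (Y, t) - Phi S (X, t)|.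
    have : D <= `|Phi S (Y, t) - Phi S (X, t)| + `|Phi S (X, t) - Phi S (X0, t0)|
        + `|Phi S (Y, t) - Phi S (Y0, t0)|.
      apply: le_trans (ler_distD (Phi S (Y, t)) _ _) _.
      rewrite (distrC (Phi S (Y0, t0))) addrC lerD2r.
      by apply: le_trans (ler_distD (Phi S (X, t)) _ _) _.
    by lra.
  rewrite /P /=.
  have e4 : `|Y - X| <= `|Y0 - X0| + 2.
    have -> : Y - X = (Y - Y0) + (Y0 - X0) - (X - X0) by rewrite addrA subrK opprB addrA subrK.
    by apply: le_trans (ler_normB _ _) _; have := ler_normD (Y - Y0) (Y0 - X0); lra.
  apply: le_trans e4 _.
  have e5 : 2 * (`|Y0 - X0| + 2) <= c * D by rewrite -ler_pdivrMr // /c; lra.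
  by have := ler_wpM2l (ltW c0) e3; lra.
- by move=> c c' x c0 cc' /le_trans; apply; rewrite ler_wpM2r.
Qed.

End SurfaceBounds.

Section SurfaceCurves.
Variable R : realType.
Implicit Type S : surface_data R.

Lemma Phi_bounded S : evolving_surface S ->
  exists2 B, 0 < B & forall X t, Gamma0 S X -> time_set S t -> `|Phi S (X, t)| <= B.
Proof.
move=> surf.
have cK : compact (Gamma0 S `*` time_set S).
  by apply: compact_setX; [exact: es_compact|exact: time_compact].
have [||B B0 hB] := @compact_uniform_ball R _ _ (fun c p => `|Phi S p| <= c) cK; last first.
- by exists B => // X t GX tt; apply: (hB (X, t)).
- move=> [X0 t0] [/= GX0 tt0].
  have [c1 [f hf]] := chart_exists surf GX0 tt0; have [[c10 _ _ lf _] fE] := hf.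
  pose c := c1 + 1 + `|Phi S (X0, t0)|.
  have c0 : 0 < c by rewrite /c; have := normr_ge0 (Phi S (X0, t0)); lra.
  exists c => // -[X t] [/= GX tt] hXt.
  have ic1 : c^-1 <= c1^-1.
    by rewrite lef_pV2 // /c; have := normr_ge0 (Phi S (X0, t0)); lra.
  have h1 := lt_le_trans hXt ic1.
  have z0 : `|(X0, t0) - (X0, t0)| < c1^-1 by rewrite subrr normr0 invr_gt0.
  have := lf _ _ z0 h1; move: h1 z0; rewrite !norm_pair_lt /= => /andP[a1 a2] /andP[b1 b2].
  rewrite !fE // => h2.
  have : c1 * `|(X, t) - (X0, t0)| <= 1.
    rewrite -ler_pdivlMl // mulr1; apply: le_trans (ltW hXt) ic1.
  have := lerB_dist (Phi S (X, t)) (Phi S (X0, t0)).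
  by move: h2 c10; rewrite /c; clear; lra.
- by move=> c c' x _ cc' /le_trans; apply.
Qed.

(** [d] will be the distance of the end points in the reference surface, not that of [x] and [y]:
    the curve is the image of one in [Gamma0 S]. *)
Definition surface_curve (A : set 'rV[R]_3) (x y : 'rV[R]_3) (d c : R)
    (g dg : R -> 'rV[R]_3) :=
  [/\ g 0 = x, g 1 = y
    & forall s : R, -1 < s < 2 ->
      [/\ A (g s), is_derive s 1 g (dg s), `|dg s| <= c * d
      & forall s' : R, -1 < s' < 2 -> `|dg s' - dg s| <= c * d ^+ 2]].

Lemma surface_curve_mono A x y d c c' g dg : 0 <= d -> c <= c' ->
  surface_curve A x y d c g dg -> surface_curve A x y d c' g dg.
Proof.
move=> d0 cc' [h1 h2 h3]; split=> // s /h3[k1 k2 k3 k4]; split=> //.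
  by apply: le_trans k3 _; rewrite ler_wpM2r.
by move=> s' /k4 /le_trans; apply; rewrite ler_wpM2r // sqr_ge0.
Qed.

(** Level functions of [Gamma S t] come without uniformity in [t]. The curve is therefore
    constructed in [Gamma0 S] and pushed forward by the flow map, whose extensions are bounded near
    every point of space-time. *)
Lemma surface_curve_exists S : evolving_surface S ->
  exists2 c, 0 < c & forall X Y t, Gamma0 S X -> Gamma0 S Y -> time_set S t ->
    `|Y - X| < c^-1 -> exists g dg,
    surface_curve (Gamma S t) (Phi S (X, t)) (Phi S (Y, t)) `|Y - X| c g dg.
Proof.
move=> surf.
pose P (c : R) (p : 'rV[R]_3 * R) := forall Y, Gamma0 S Y -> `|Y - p.1| < c^-1 ->
  exists g dg, surface_curve (Gamma S p.2) (Phi S p) (Phi S (Y, p.2)) `|Y - p.1| c g dg.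
have cK : compact (Gamma0 S `*` time_set S).
  by apply: compact_setX; [exact: es_compact|exact: time_compact].
have [||c c0 hc] := @compact_uniform_ball R _ _ P cK; last first.
- by exists c => // X Y t GX GY tt; apply: (hc (X, t)).
- move=> [X0 t0] [/= GX0 tt0].
  have [c1 [f hf]] := chart_exists surf GX0 tt0; have [[c10 df bf lf l2f] fE] := hf.
  have [F [U [oU UX0 sF gF GU]]] := es_hypersurface0 surf GX0.
  have F0 Z : Gamma0 S Z -> U Z -> F Z = 0.
    by move=> GZ UZ; have : (Gamma0 S `&` U) Z by []; rewrite GU => -[].
  have GF Z : U Z /\ F Z = 0 -> Gamma0 S Z.
    by move=> h; have [] : (Gamma0 S `&` U) Z by rewrite GU.
  have [c2 c20 hcurve] := implicit_curve oU UX0 (sF 2%N) (gF _ UX0).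
  have /nbhs_ballP[r /= r0 hr] := near_open oU UX0.
  have rI : 0 < r^-1 by rewrite invr_gt0.
  have c12 : 0 < c1 * c2 by rewrite mulr_gt0.
  have c122 : 0 < c1 * c2 * c2 by rewrite mulr_gt0.
  pose c := 2 * r^-1 + 2 * c1 + 2 * c2 + 2 * c1 * c2 + c1 * c2 + 2 * (c1 * c2 * c2).
  have c0 : 0 < c by rewrite /c; lra.
  have rc : 2 * r^-1 <= c by rewrite /c; lra.
  have c1c : 2 * c1 <= c by rewrite /c; lra.
  have c2c : 2 * c2 <= c by rewrite /c; lra.
  have c12c : 2 * (c1 * c2) <= c by rewrite /c; lra.
  have c122c : c1 * c2 + 2 * (c1 * c2 * c2) <= c by rewrite /c; lra.
  clearbody c; have icl d : 0 < d -> d <= c -> c^-1 <= d^-1 by move=> d0 dc; rewrite lef_pV2.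
  exists c => // -[X t] [/= GX tt] /=; rewrite norm_pair_lt /= => /andP[hX ht] Y GY /= hY.
  have hY0 : `|Y - X0| < 2 * c^-1.
    by apply: le_lt_trans (ler_distD X _ _) _; lra.
  have lt2 d : 0 < d -> 2 * d <= c -> 2 * c^-1 <= d^-1.
    move=> d0 dc; have d20 : 0 < 2 * d by rewrite mulr_gt0.
    by have := icl _ d20 dc; rewrite invfM; lra.
  have cI : 0 < c^-1 by rewrite invr_gt0.
  have UZ Z : `|Z - X0| < 2 * c^-1 -> U Z.
    move=> hZ; apply: hr; rewrite -ball_normE /ball_ /= distrC; apply: lt_le_trans hZ _.
    by rewrite -[leRHS]invrK; exact: lt2.
  have XX0 : `|X - X0| < 2 * c^-1 by lra.
  have hc2 : 2 * c^-1 <= c2^-1 by exact: lt2.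
  have [||g [dg [g0 g1 hg]]] := hcurve X Y (F0 _ GX (UZ _ XX0)) (F0 _ GY (UZ _ hY0)).
  - exact: lt_le_trans XX0 hc2.
  - exact: lt_le_trans hY0 hc2.
  have gG s : -1 < s < 2 -> Gamma0 S (g s) by move=> /hg[h _ _ _ _]; exact: GF.
  have gX s : -1 < s < 2 -> `|g s - X0| < c1^-1.
    move=> /hg[_ _ _ h _].
    have h1 : `|g s - X| < (2 * c1)^-1.
      apply: le_lt_trans h _; rewrite -ltr_pdivlMl //.
      apply: lt_le_trans hY _; rewrite -invfM; apply: icl; rewrite ?mulr_gt0 //.
      by have -> : c2 * (2 * c1) = 2 * (c1 * c2) by ring.
    have h2 : `|X - X0| < (2 * c1)^-1.
      by apply: lt_le_trans hX _; apply: icl; rewrite ?mulr_gt0 // c1c.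
    apply: le_lt_trans (ler_distD X _ _) _.
    by move: h1 h2; rewrite invfM; lra.
  have ht1 : `|t - t0| < c1^-1.
    by apply: lt_le_trans ht _; apply: icl => //; apply: le_trans c1c; rewrite ler_peMl ?ler1n // ltW.
  have gt1 s : -1 < s < 2 -> `|(g s, t) - (X0, t0)| < c1^-1.
    by move=> hs; rewrite norm_pair_lt /= gX.
  have n0 (v : 'rV[R]_3) : `|(v, 0 : R)| = `|v|.
    by rewrite [LHS]prod_normE /= normr0 max_l.
  exists (fun s => Phi S (g s, t)), (fun s => 'D_(dg s, 0) f (g s, t)).
  split; rewrite ?g0 ?g1 //.
  move=> s hs; have [_ ds dsb _ dsl] := hg s hs; split.
  - by exists (g s) => //; exact: gG.
  - have d1 : is_derive s 1 (fun s => f (g s, t)) ('D_(dg s, 0) f (g s, t)).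
      have dfs := df _ (gt1 s hs); have [e1 e2] := diff_slicel t (g s).
      have dfs' : differentiable (fun y => f (y, t)) (g s).
        exact: (differentiable_comp e1 dfs).
      by rewrite -derive_slicel //; exact: is_derive_comp.
    apply: near_eq_is_derive d1.
    have : \forall s' \near s, -1 < s' < 2.
      have : s \in `](-1), 2[ by rewrite in_itv.
      by move=> /near_in_itvoo; apply: filterS => s'; rewrite in_itv.
    apply: filterS => s' hs'.
    by apply: fE => //; [exact: gG|exact: gX].
  - apply: le_trans (bf _ _ (gt1 s hs)) _; rewrite n0.
    apply: le_trans (ler_wpM2l (ltW c10) dsb) _; rewrite mulrA ler_wpM2r //.
    by apply: le_trans c12c; rewrite ler_peMl ?ler1n // ltW.
  - move=> s' hs'; have [_ ds' dsb' _ _] := hg s' hs'.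
    have -> : 'D_(dg s', 0) f (g s', t) - 'D_(dg s, 0) f (g s, t) =
        'D_(dg s' - dg s, 0) f (g s', t) + ('D_(dg s, 0) f (g s', t) - 'D_(dg s, 0) f (g s, t)).
      have dfs := df _ (gt1 s' hs').
      have fD : 'D_(dg s' - dg s, 0) f (g s', t) + 'D_(dg s, 0) f (g s', t) =
          'D_(dg s', 0) f (g s', t).
        rewrite !deriveE // -linearD; congr ('d f _ _).
        by apply/pair_equal_spec; split=> /=; rewrite ?subrK ?addr0.
      by rewrite -fD -addrA.
    apply: le_trans (ler_normD _ _) _.
    have b1 := bf _ (dg s' - dg s, 0) (gt1 s' hs'); rewrite n0 in b1.
    have b2 := l2f _ _ (dg s, 0) (gt1 s hs) (gt1 s' hs'); rewrite n0 in b2.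
    have b3 := ler_wpM2l (ltW c10) (dsl s' hs').
    have b4 : `|(g s', t) - (g s, t)| <= 2 * c2 * `|Y - X|.
      have -> : (g s', t) - (g s, t) = (g s' - g s, 0).
        by apply/pair_equal_spec; rewrite /= subrr.
      rewrite n0; have [_ _ _ k1 _] := hg s hs; have [_ _ _ k2 _] := hg s' hs'.
      have := ler_distD X (g s') (g s); rewrite (distrC X).
      by move: k1 k2; clear; lra.
    have b5 : c1 * `|(g s', t) - (g s, t)| * `|dg s| <= c1 * (2 * c2 * `|Y - X|) * (c2 * `|Y - X|).
      by apply: ler_pM => //; [rewrite mulr_ge0 // ltW|rewrite ler_wpM2l // ltW].
    apply: le_trans (ler_wpM2r (sqr_ge0 `|Y - X|) c122c).
    by move: b1 b2 b3 b5; clear; lra.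
- move=> c c' x c0 cc' hP Y GY hY.
  have [|g [dg h]] := hP Y GY.
    by apply: lt_le_trans hY _; rewrite lef_pV2 // posrE (lt_le_trans c0).
  by exists g, dg; exact: surface_curve_mono h.
Qed.

End SurfaceCurves.

(** * Taylor estimates along the surface and in time *)

Section TangentialGradient.
Variable R : realType.
Implicit Type S : surface_data R.

Lemma C11_in_open (U : set 'rV[R]_3) (f : 'rV[R]_3 -> R) x : open U -> U x -> Ck 2 U f ->
  exists c, C11 f x c /\ forall a, `|a - x| < c^-1 -> U a.
Proof.
move=> oU Ux Cf; have [c0 hc0] := C11_Ck2_R3 oU Ux Cf.
have /nbhs_ballP[r /= r0 hr] := near_open oU Ux.
exists (Num.max c0 r^-1); split; first by apply: C11_mono hc0; rewrite le_max lexx.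
move=> a ha; apply: hr; rewrite -ball_normE /ball_ /= distrC.
apply: lt_le_trans ha _; rewrite invf_ple ?posrE ?lt_max ?invr_gt0 ?r0 ?orbT //.
by rewrite le_max lexx orbT.
Qed.

(** As [v] is orthogonal to the gradient, the line [z + h *: v] misses the level set by a quadratic
    amount only; a quadratic correction along the gradient repairs this without changing the
    velocity at [z]. *)
Lemma tangent_curve (G : set 'rV[R]_3) z F v : G z -> local_equation G z F ->
  dot v (grad F z) = 0 ->
  exists c r, [/\ 0 < r, c 0 = z, is_derive (0 : R) 1 c v &
    forall h : R, `|h| < r -> G (c h)].
Proof.
move=> Gz [U [oU Uz sF gF GU]] ve.
have GF Z : U Z -> F Z = 0 -> G Z.
  by move=> UZ FZ; have [] : (G `&` U) Z by rewrite GU.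
have Fz : F z = 0 by have : (G `&` U) z by []; rewrite GU => -[].
have [c1 [hc1 c1U]] := C11_in_open oU Uz (sF 2%N).
have [c10 dF bF lF l2F] := hc1.
move eE: (grad F z) (gF z Uz) ve => e e0 ve.
pose N := `|e|; have N0 : 0 < N by rewrite normr_gt0.
pose m := dot e e; have m0 : 0 < m by rewrite lt_def dot_eq0 e0 dot_ge0.
pose q := m / 2; have q0 : 0 < q by rewrite divr_gt0.
pose r := Num.min c1^-1 (q / (c1 * N)).
have ic10 : 0 < c1^-1 by rewrite invr_gt0.
have r0 : 0 < r by rewrite lt_min ic10 divr_gt0 ?mulr_gt0.
have zr d : 0 < d -> `|z - z| < d by rewrite subrr normr0.
have rc1 a : `|a - z| < r -> `|a - z| < c1^-1.
  by move=> h; apply: lt_le_trans h _; rewrite ge_min lexx.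
have dFz : differentiable F z by exact: dF (zr _ ic10).
have qF a : `|a - z| < r -> q <= 'D_e F a.
  move=> ar.
  have h := l2F z a e (zr _ ic10) (rc1 _ ar).
  have DeE : 'D_e F z = m by rewrite derive_grad // eE.
  have : c1 * `|a - z| * `|e| <= q.
    rewrite mulrAC mulrC -ler_pdivlMr ?mulr_gt0 //.
    by apply: le_trans (ltW ar) _; rewrite ge_min lexx orbT.
  by move: h; rewrite DeE => /ler_normlP[h1 _]; rewrite /q in q0 *; lra.
(* With this [k] the slope [q] over a correction of size [k * h ^+ 2] outweighs the Taylor remainder
   of [F] along [v]; the summand 1 keeps [k] positive when [v = 0]. *)
pose k := c1 * `|v| ^+ 2 / q + 1.
have k0' : 0 <= c1 * `|v| ^+ 2 / q by rewrite !mulr_ge0 ?invr_ge0 ?sqr_ge0 // ltW.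
have k0 : 0 < k by rewrite ltr_wpDl.
pose M := `|v| + k * N + 1.
have M0 : 0 < M by rewrite ltr_wpDl // addr_ge0 // mulr_ge0 // ltW.
pose r1 := Num.min 1 (r / M); have r10 : 0 < r1 by rewrite lt_min ltr01 divr_gt0.
have inr (h w : R) : `|h| < r1 -> `|w| <= k * h ^+ 2 -> `|z + h *: v + w *: e - z| < r.
  rewrite lt_min ltr_pdivlMr // => /andP[h1 hM] hw.
  have -> : z + h *: v + w *: e - z = h *: v + w *: e by rewrite -(addrA z) (addrC z) addrK.
  apply: le_lt_trans (ler_normD _ _) _; rewrite !normrZ; apply: le_lt_trans _ hM.
  have hh : h ^+ 2 <= `|h| by rewrite -real_normK ?num_real // expr2 ler_piMl // ltW.
  have a1 : `|w| * `|e| <= k * `|h| * N.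
    by apply: ler_wpM2r => //; apply: le_trans hw _; rewrite ler_wpM2l // ltW.
  by have := normr_ge0 h; rewrite /M; move: a1; clear; lra.
pose w (h : R) := xget 0 [set w | `|w| <= k * h ^+ 2 /\ F (z + h *: v + w *: e) = 0].
have wP h : `|h| < r1 -> `|w h| <= k * h ^+ 2 /\ F (z + h *: v + w h *: e) = 0.
  move=> hr; rewrite /w; case: xgetP => [y _ //|] hno; exfalso.
  have [h0|h0] := eqVneq h 0.
    by apply: (hno 0); rewrite /= h0 normr0 expr2 !mulr0 !scale0r !addr0.
  have w00 : 0 < k * h ^+ 2 by rewrite mulr_gt0 // lt_def sqrf_eq0 h0 sqr_ge0.
  have dg (w' : R) : `|w'| <= k * h ^+ 2 -> is_derive w' 1 (fun w => F (z + h *: v + w *: e))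
      ('D_e F (z + h *: v + w' *: e)).
    move=> hw; apply: is_derive_comp; first exact: is_derive_line.
    by apply: dF; apply: rc1; exact: inr.
  have qg (w' : R) : `|w'| <= k * h ^+ 2 -> q <= 'D_e F (z + h *: v + w' *: e).
    by move=> hw; apply: qF; exact: inr.
  have [|w' h1 h2] := implicit_root w00 q0 dg qg; last by apply: (hno w').
  have z0 : `|0 : R| <= k * h ^+ 2 by rewrite normr0 ltW.
  have := C11_taylor hc1 (zr _ ic10) (rc1 _ (inr h 0 hr z0)).
  rewrite scale0r addr0 Fz subr0 (addrC z) addrK.
  have -> : 'D_(h *: v) F z = 0.
    by rewrite derive_grad // eE dotZr dotC ve mulr0.
  rewrite subr0 => /le_trans; apply; rewrite normrZ exprMn real_normK ?num_real //.
  have -> : k * h ^+ 2 * q = h ^+ 2 * (c1 * `|v| ^+ 2 + q) by rewrite /k; field; rewrite gt_eqF.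
  by rewrite mulrCA ler_wpM2l ?sqr_ge0 // lerDl ltW.
have w0 : w 0 = 0.
  have [|+ _] := wP 0; first by rewrite normr0.
  by rewrite expr2 !mulr0 normr_le0 => /eqP.
have cz : z + 0 *: v + w 0 *: e = z by rewrite w0 !scale0r !addr0.
exists (fun h => z + h *: v + w h *: e), r1; split=> //.
  apply: (is_derive_quad (r := r1) (K := k * N)) => // h hr.
  rewrite cz add0r; have [hw _] := wP h hr.
  have -> : z + h *: v + w h *: e - z - h *: v = w h *: e.
    by rewrite -(addrA z) (addrC z) addrK (addrC (h *: v)) addrK.
  rewrite normrZ mulrAC ler_wpM2r // ltW //.
by move=> h hr; have [hw Fw] := wP h hr; apply: GF => //; apply: c1U; apply: rc1; exact: inr.
Qed.

(** Along a curve in [G] with velocity [v] the function [D] is constant. *)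
Lemma vanish_derive (G : set 'rV[R]_3) z F v (D : 'rV[R]_3 -> R) (U : set 'rV[R]_3) :
  G z -> local_equation G z F -> dot v (grad F z) = 0 ->
  open U -> U z -> differentiable D z -> (forall y, G y -> U y -> D y = 0) ->
  'D_v D z = 0.
Proof.
move=> Gz eqF ve oU Uz dD D0; have [c [r [r0 c0 dc cG]]] := tangent_curve Gz eqF ve.
have cc : {for (0 : R), continuous c}.
  by apply/differentiable_continuous/derivable1_diffP; case: dc.
rewrite -c0 in dD *.
have [_ <-] := is_derive_comp dc dD.
rewrite -[RHS](derive_cst (0 : R) (0 : R) 1); apply: near_eq_derive.
have n1 : \forall h \near (0 : R), U (c h) by apply: (cc U); apply: open_nbhs_nbhs; rewrite ?c0.
have n2 : \forall h \near (0 : R), `|h| < r by exact: nbhs0_lt.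
by apply: filterS2 n1 n2 => h Uc hr; rewrite D0 //; exact: cG.
Qed.

Lemma orth_parallel (a e : 'rV[R]_3) : e != 0 ->
  (forall v, dot v e = 0 -> dot a v = 0) -> a = (dot a e / dot e e) *: e.
Proof.
move=> e0 h; have ee : dot e e != 0 by rewrite dot_eq0.
have we : dot (a - (dot a e / dot e e) *: e) e = 0 by rewrite !dot_simpl divfK ?subrr.
by apply/eqP; rewrite -subr_eq0 -dot_eq0 dotBr dotZr we mulr0 subr0 dotC h.
Qed.

(** The outward normal comes with one level function [F'] of its own. [F'] vanishes on the surface,
    so its derivative in all directions orthogonal to [grad F z] is zero and the two gradients are
    parallel. *)
Lemma normal_local_equation S t z F : evolving_surface S -> STbar S (z, t) ->
  local_equation (Gamma S t) z F ->
  exists k, nu S (z, t) = k *: grad F z.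
Proof.
move=> surf zt eqF; have [_ [F' [c [eqF' nE]]] _] := es_normal surf zt.
have Gz : Gamma S t z by case: zt.
have [U [oU Uz _ gF _]] := eqF; have [U' [oU' Uz' sF' gF' GU']] := eqF'.
have dF' : differentiable F' z by have [dF' _] := sF' 1%N; exact: dF'.
have h v : dot v (grad F z) = 0 -> dot (grad F' z) v = 0.
  move=> vF; rewrite -derive_grad //.
  apply: (vanish_derive Gz eqF vF oU' Uz' dF') => y Gy Uy.
  by have : (Gamma S t `&` U') y by []; rewrite GU' => -[].
by exists (c * (dot (grad F' z) (grad F z) / dot (grad F z) (grad F z)));
  rewrite -scalerA -(orth_parallel (gF z Uz) h).
Qed.

Lemma normal_unit S p : evolving_surface S -> STbar S p -> dot (nu S p) (nu S p) = 1.
Proof.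
by case: p => z t surf zt; have [/enorm_unit h _ _] := es_normal surf zt.
Qed.

Lemma gamma_local_equation S t z : evolving_surface S -> STbar S (z, t) ->
  exists F, local_equation (Gamma S t) z F.
Proof. by move=> surf [/= tt Gz]; exact: (es_hypersurface surf tt Gz). Qed.

(* Only the square of the normal enters, so its sign (orientation) is irrelevant. *)
Lemma tproj_local_equation S t z F a : evolving_surface S -> STbar S (z, t) ->
  local_equation (Gamma S t) z F ->
  tproj (nu S (z, t)) a = a - (dot a (grad F z) / dot (grad F z) (grad F z)) *: grad F z.
Proof.
move=> surf zt eqF; have [k nE] := normal_local_equation surf zt eqF.
have := normal_unit surf zt; rewrite /tproj nE !dot_simpl.
have [U [oU Uz _ gF _]] := eqF; move: (gF z Uz) => g0.
have gg : dot (grad F z) (grad F z) != 0 by rewrite dot_eq0.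
move=> h; rewrite scalerA; congr (_ - _ *: _).
have -> : (dot (grad F z) (grad F z))^-1 = k * k.
  by apply: (mulfI gg); rewrite mulfV // -[LHS]h; ring.
ring.
Qed.

Lemma is_derive_tangent S t (c : R -> 'rV[R]_3) (s : R) v : evolving_surface S ->
  time_set S t -> is_derive s 1 c v -> (\forall s' \near s, Gamma S t (c s')) ->
  dot v (nu S (c s, t)) = 0.
Proof.
move=> surf tt dc cG; have Gz : Gamma S t (c s) by exact: nbhs_singleton cG.
have [F eqF] := gamma_local_equation surf (conj tt Gz : STbar S (c s, t)).
have [k ->] := normal_local_equation surf (conj tt Gz : STbar S (c s, t)) eqF.
have [U [oU Uz sF gF GU]] := eqF.
have dF : differentiable F (c s) by have [dF' _] := sF 1%N; exact: dF'.
rewrite dotZr dotC -derive_grad //.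
have [_ <-] := is_derive_comp dc dF.
suff -> : 'D_1 (fun s => F (c s)) s = 'D_1 (cst (0 : R)) s by rewrite derive_cst mulr0.
apply: near_eq_derive.
have cc : {for s, continuous c}.
  by apply/differentiable_continuous/derivable1_diffP; case: dc.
have n1 : \forall h \near s, U (c h) by apply: (cc U); exact: open_nbhs_nbhs.
apply: filterS2 n1 cG => h Uc Gc.
by have : (Gamma S t `&` U) (c h) by []; rewrite GU => -[].
Qed.

(** Two extensions differ by a function that vanishes on the surface, so the difference of their
    gradients is normal and is removed by the projection. This makes the value chosen by [xget]
    computable. *)
Lemma tgrad_eq S f p g : evolving_surface S -> STbar S p -> is_tgrad S f p g ->
  tgrad S f p = g.
Proof.
case: p => z t surf zt hg; have Gz : Gamma S t z by case: zt.
have [F eqF] := gamma_local_equation surf zt.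
have : is_tgrad S f (z, t) (tgrad S f (z, t)).
  by rewrite /tgrad; case: xgetP => [y _ //|/(_ g)]; exact.
move=> [U1 [F1 [oU1 Uz1 [dF1 _] F1E ->]]]; case: hg => [U2 [F2 [oU2 Uz2 [dF2 _] F2E ->]]].
rewrite /= in Uz1 Uz2 F1E F2E *.
have d1 := dF1 _ Uz1; have d2 := dF2 _ Uz2.
have dD : differentiable (F1 - F2) z by exact: differentiableB.
have [U [_ Uz _ gF _]] := eqF.
have h v : dot v (grad F z) = 0 -> dot (grad F1 z - grad F2 z) v = 0.
  move=> vF; rewrite dotBl -!derive_grad //.
  rewrite -deriveB; [|exact: diff_derivable..].
  apply: (vanish_derive (U := U1 `&` U2) Gz eqF vF _ _ dD) => //; first exact: openI.
  by move=> y Gy [y1 y2]; rewrite !fctE F1E // F2E // subrr.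
have /(congr1 (fun a => a + grad F2 z)) := orth_parallel (gF z Uz) h.
rewrite subrK => E; rewrite !(tproj_local_equation _ surf zt eqF) E.
set b := _ / _; rewrite !dot_simpl mulrDl mulfK ?dot_eq0 ?(gF z Uz) //.
by rewrite scalerDl opprD addrACA subrr add0r.
Qed.

Lemma tgrad_orth S f p : evolving_surface S -> STbar S p ->
  (exists g, is_tgrad S f p g) -> dot (tgrad S f p) (nu S p) = 0.
Proof.
move=> surf hp [g hg]; rewrite (tgrad_eq surf hp hg).
case: hg => [U [F [_ _ _ _ ->]]].
by rewrite /tproj dotBl dotZl normal_unit // mulr1 subrr.
Qed.

(** The velocity of a curve in the surface is tangent, so the normal part of the gradient of an
    extension does not contribute. *)
Lemma is_derive_tgrad S f t (c : R -> 'rV[R]_3) (s : R) v : evolving_surface S ->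
  time_set S t -> is_derive s 1 c v -> (\forall s' \near s, Gamma S t (c s')) ->
  (exists g, is_tgrad S f (c s, t) g) ->
  is_derive s 1 (fun s => f (c s, t)) (dot (tgrad S f (c s, t)) v).
Proof.
move=> surf tt dc cG [g hg]; have Gz : Gamma S t (c s) by exact: nbhs_singleton cG.
have hp : STbar S (c s, t) by [].
have vn := is_derive_tangent surf tt dc cG.
rewrite (tgrad_eq surf hp hg); case: hg => [U [F [oU /= Uz [dF _] FE ->]]].
have d := dF _ Uz.
have -> : dot (tproj (nu S (c s, t)) (grad F (c s))) v = 'D_v F (c s).
  by rewrite derive_grad // /tproj dotBl dotZl (dotC (nu _ _)) vn mulr0 subr0.
apply: near_eq_is_derive (is_derive_comp dc d).
have cc : {for s, continuous c}.
  by apply/differentiable_continuous/derivable1_diffP; case: dc.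
have n1 : \forall h \near s, U (c h) by apply: (cc U); exact: open_nbhs_nbhs.
by apply: filterS2 n1 cG => h Uc Gc; rewrite FE.
Qed.

End TangentialGradient.

Section SurfaceTaylor.
Variable R : realType.
Implicit Type S : surface_data R.

Lemma in01 (s : R) : 0 <= s <= 1 -> -1 < s < 2.
Proof. lra. Qed.

Lemma is_derive_coord (g : R -> 'rV[R]_3) (s : R) v k :
  is_derive s 1 g v -> is_derive s 1 (fun s => g s 0 k : R) (v 0 k).
Proof.
move=> [dg <-]; apply: DeriveDef; first by have /derivable_mxP := dg; apply.
by rewrite derive_mx // mxE.
Qed.

(** Each coordinate of [y - x] equals that of [dg] at a mean point depending on the coordinate; the
    oscillation of [dg] makes up for the different points. *)
Lemma surface_curve_increment (A : set 'rV[R]_3) x y d c g dg s : surface_curve A x y d c g dg ->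
  0 <= d -> 0 <= c -> 0 <= s <= 1 -> `|y - x - dg s| <= c * d ^+ 2.
Proof.
move=> [g0 g1 hg] d0 c0 s01; apply: norm_rV_le => [|k].
  by rewrite mulr_ge0 // sqr_ge0.
have [s' s'01|s' s'01] := @mvt_derive R (fun s => g s 0 k : R) (fun s => dg s 0 k) 0 1 (@ler01 R).
  by apply: is_derive_coord; have [] := hg s' (in01 s'01).
rewrite g0 g1 subr0 mulr1 => e.
have [_ _ _ h] := hg s (in01 s01).
apply: le_trans _ (h s' (in01 s'01)); apply: le_trans _ (coord_le_norm _ k).
by rewrite !mxE e.
Qed.

Lemma surface_curve_tangent S t x y d c g dg (s : R) : evolving_surface S -> time_set S t ->
  surface_curve (Gamma S t) x y d c g dg -> -1 < s < 2 ->
  \forall s' \near s, Gamma S t (g s').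
Proof.
move=> surf tt [_ _ hg] hs.
have : s \in `](-1), 2[ by rewrite in_itv.
by move=> /near_in_itvoo; apply: filterS => s'; rewrite in_itv /= => /hg[].
Qed.

(** For near points [y - x] is, up to a quadratic error, the initial velocity of a connecting curve,
    which is orthogonal to the normal. For far points the distance is bounded below, so the trivial
    linear bound is also a quadratic one. *)
Lemma normal_quadratic S : evolving_surface S ->
  exists2 C, 0 < C & forall t x y, time_set S t -> Gamma S t x -> Gamma S t y ->
    `|dot (nu S (x, t)) (y - x)| <= C * enorm (y - x) ^+ 2.
Proof.
move=> surf; have [c c0 hc] := surface_curve_exists surf.
have [C0 C00 hC0] := Phi_inverse_lip surf.
have cC : 0 < c * C0 by rewrite mulr_gt0.
have cCC : 0 < 3 * c * C0 ^+ 2 by rewrite !mulr_gt0 // exprn_gt0.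
exists (3 * c * C0 ^+ 2 + c * C0); first exact: addr_gt0.
move=> t _ _ tt [X GX <-] [Y GY <-].
have nu1 : enorm (nu S (Phi S (X, t), t)) = 1.
  by apply/enorm_unit/normal_unit => //; split=> //; exists X.
set y := Phi S (Y, t); set x := Phi S (X, t) in nu1 *.
have dE : `|Y - X| <= C0 * enorm (y - x).
  apply: le_trans (hC0 _ _ _ GX GY tt) _; rewrite ler_wpM2l ?(ltW C00) //.
  exact: norm_le_enorm.
have e0 := enorm_ge0 (y - x).
have [close|far] := ltP `|Y - X| c^-1.
  have [g [dg gc]] := hc _ _ _ GX GY tt close.
  have i0 : -1 < (0 : R) < 2 by lra.
  have j0 : 0 <= (0 : R) <= 1 by lra.
  have inc := surface_curve_increment gc (normr_ge0 _) (ltW c0) j0.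
  have tg := surface_curve_tangent surf tt gc i0.
  have [g0 _ /(_ 0 i0)[_ d0 _ _]] := gc.
  have := is_derive_tangent surf tt d0 tg; rewrite g0 dotC => dn.
  have -> : dot (nu S (x, t)) (y - x) = dot (nu S (x, t)) (y - x - dg 0).
    by rewrite [RHS]dotBr dn subr0.
  apply: le_trans (dot_le _ _) _; rewrite nu1 mul1r.
  apply: le_trans (enorm_le_norm _) _.
  have h1 : `|Y - X| ^+ 2 <= C0 ^+ 2 * enorm (y - x) ^+ 2.
    by rewrite -exprMn ler_sqr ?nnegrE ?mulr_ge0 ?(ltW C00).
  have h2 := ler_wpM2l (ltW c0) h1.
  have h3 : 0 <= c * C0 * enorm (y - x) ^+ 2 by rewrite mulr_ge0 ?sqr_ge0 ?(ltW cC).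
  by move: h2 h3 inc; clear; lra.
apply: le_trans (dot_le _ _) _; rewrite nu1 mul1r.
have h1 : 1 <= c * C0 * enorm (y - x).
  rewrite -mulrA -ler_pdivrMl // mulr1; exact: le_trans far dE.
have h2 : 0 <= 3 * c * C0 ^+ 2 * enorm (y - x) ^+ 2 by rewrite mulr_ge0 ?sqr_ge0 ?(ltW cCC).
have h3 := ler_wpM2r e0 h1.
by move: h2 h3; clear; lra.
Qed.

Lemma Ck_on_slice S phi z t : Ck_on 2 (STbar S) phi -> STbar S (z, t) ->
  exists (W : set 'rV[R]_3) (g : 'rV[R]_3 -> R),
    [/\ open W, W z, Ck 2 W g & forall y, Gamma S t y -> W y -> g y = phi (y, t)].
Proof.
move=> cphi hp; have [Q [g [oQ Qz Cg gE]]] := cphi _ hp.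
exists [set y | Q (y, t)], (fun y => g (y, t)); split=> //.
- apply: (@open_comp _ _ (fun y : 'rV[R]_3 => (y, t)) Q) => // y _.
  by apply: differentiable_continuous; have [] := diff_slicel t y.
- exact: Ck_slicel.
- by move=> y Gy Wy; apply: gE => //; split=> //; case: hp.
Qed.

Lemma is_tgrad_exists S phi p : Ck_on 2 (STbar S) phi -> STbar S p ->
  exists g, is_tgrad S phi p g.
Proof.
case: p => z t cphi hp; have [W [g [oW Wz Cg gE]]] := Ck_on_slice cphi hp.
exists (tproj (nu S (z, t)) (grad g z)), W, g; split=> //.
exact: CkW.
Qed.

(** The normal field is only given pointwise. The projection is rewritten with the gradient of a
    level function, which yields an explicit C^1 extension of each coordinate of the tangential
    gradient. *)
Lemma is_tgrad_coord_exists S phi p j : evolving_surface S ->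
  Ck_on 2 (STbar S) phi -> STbar S p ->
  exists g, is_tgrad S (fun q => tgrad S phi q 0 j) p g.
Proof.
case: p => z t surf cphi hp; have [W [g [oW Wz Cg gE]]] := Ck_on_slice cphi hp.
have [F eqF] := gamma_local_equation surf hp.
have [U [oU Uz sF gF GU]] := eqF.
pose D (k : 'I_3) (y : 'rV[R]_3) : R := 'D_(delta_mx 0 k) g y.
pose E (k : 'I_3) (y : 'rV[R]_3) : R := 'D_(delta_mx 0 k) F y.
(* Coordinate [j] of the gradient of [g] minus its component along the gradient of [F]. *)
pose T (y : 'rV[R]_3) : R := D j y - (D 0 y * E 0 y + D 1 y * E 1 y + D 2%:R y * E 2%:R y) *
  (E 0 y * E 0 y + E 1 y * E 1 y + E 2%:R y * E 2%:R y)^-1 * E j y.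
have oV : open (W `&` U) by exact: openI.
have CD k : Ck 1 (W `&` U) (D k) by apply: (@Ck_sub _ _ _ 1 W (W `&` U) (D k) (@subIsetl _ W U)); exact: (Cg.2 (delta_mx 0 k)).
have CE k : Ck 1 (W `&` U) (E k) by apply: (@Ck_sub _ _ _ 1 U (W `&` U) (E k) (@subIsetr _ W U)); exact: ((sF 2%N).2 (delta_mx 0 k)).
exists (tproj (nu S (z, t)) (grad T z)), (W `&` U), T; split=> //.
  rewrite /T; apply: Ck1D => //; apply: Ck1N => //; apply: Ck1M => //.
  apply: Ck1M => //.
    apply: Ck1D => //; last exact: Ck1M.
    by apply: Ck1D => //; exact: Ck1M.
  apply: Ck1V => //; last first.
    apply: Ck1D => //; last exact: Ck1M.
    by apply: Ck1D => //; exact: Ck1M.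
  move=> y [_ Uy]; have := gF y Uy; rewrite -dot_eq0 dotE; apply: contra_neq.
  by rewrite !mxE.
move=> y /= Gy [Wy Uy].
have hy : STbar S (y, t) by split=> //; case: hp.
have eqFy : local_equation (Gamma S t) y F by exists U.
have hg : is_tgrad S phi (y, t) (tproj (nu S (y, t)) (grad g y)).
  by exists W, g; split=> //; exact: CkW.
rewrite (tgrad_eq surf hy hg) (tproj_local_equation _ surf hy eqFy) !dotE !mxE.
by [].

Qed.

(** In [tgrad2] the column index is the coordinate being differentiated and the row index the
    direction, so the gradient of one coordinate is a column. *)
Lemma tgrad2_column S phi p j :
  enorm (tgrad S (fun q => tgrad S phi q 0 j) p) <= frobenius (tgrad2 S phi p).
Proof.
rewrite /frobenius /enorm ler_wsqrtr // dotE.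
apply: (@le_trans _ _ (\sum_i tgrad2 S phi p i j ^+ 2)).
  by rewrite sum3 !mxE.
apply: ler_sum => i _; rewrite (bigD1 j) //= lerDl.
by apply: sumr_ge0 => k _; exact: sqr_ge0.
Qed.

Section Local.
Variables (S : surface_data R) (phi : 'rV[R]_3 * R -> R) (B1 B2 : R).
Hypothesis surf : evolving_surface S.
Hypothesis cphi : Ck_on 2 (STbar S) phi.
Hypothesis hB1 : forall p, STbar S p -> enorm (tgrad S phi p) <= B1.
Hypothesis hB2 : forall p, STbar S p -> frobenius (tgrad2 S phi p) <= B2.
Variables (t : R) (x y : 'rV[R]_3) (d c : R) (g dg : R -> 'rV[R]_3).
Hypothesis tt : time_set S t.
Hypothesis gc : surface_curve (Gamma S t) x y d c g dg.
Hypotheses (d0 : 0 <= d) (c0 : 0 <= c).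

Lemma curve_STbar (s : R) : -1 < s < 2 -> STbar S (g s, t).
Proof. by move=> hs; split=> //; have [_ _ /(_ s hs)[]] := gc. Qed.

Lemma curve_derive_enorm (s : R) : -1 < s < 2 -> enorm (dg s) <= 3 * c * d.
Proof.
move=> hs; apply: le_trans (enorm_le_norm _) _.
by have [_ _ /(_ s hs)[_ _ h _]] := gc; lra.
Qed.

Lemma curve_tgrad f (s : R) : (forall p, STbar S p -> exists g, is_tgrad S f p g) -> -1 < s < 2 ->
  is_derive s 1 (fun s => f (g s, t)) (dot (tgrad S f (g s, t)) (dg s)).
Proof.
move=> hf hs; apply: is_derive_tgrad => //.
- by have [_ _ /(_ s hs)[]] := gc.
- exact: surface_curve_tangent gc hs.
- by apply: hf; exact: curve_STbar.
Qed.

Lemma curve_mean f B (s : R) : (forall p, STbar S p -> exists g, is_tgrad S f p g) ->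
  (forall p, STbar S p -> enorm (tgrad S f p) <= B) -> 0 <= B ->
  0 <= s <= 1 -> `|f (g s, t) - f (x, t)| <= 3 * c * d * B.
Proof.
move=> hf hB Bge0 /andP[s0 s1].
have [s' h|s' h] := @mvt_derive R (fun s => f (g s, t))
    (fun s => dot (tgrad S f (g s, t)) (dg s)) 0 s s0.
  by apply: curve_tgrad => //; apply: in01; lra.
have [-> _ _] := gc; move=> ->.
have hs' : -1 < s' < 2 by apply: in01; lra.
rewrite subr0 normrM (ger0_norm s0).
apply: (@le_trans _ _ (`|dot (tgrad S f (g s', t)) (dg s')|)); first by rewrite ler_piMr.
apply: le_trans (dot_le _ _) _; rewrite mulrC.
apply: ler_pM; rewrite ?enorm_ge0 //; first exact: curve_derive_enorm.
by apply: hB; exact: curve_STbar.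
Qed.

Lemma curve_lip : 0 <= B1 -> `|phi (y, t) - phi (x, t)| <= 3 * c * d * B1.
Proof.
move=> B10; have [_ <- _] := gc; apply: curve_mean => //; last by lra.
by move=> p; exact: is_tgrad_exists.
Qed.

(** By the mean value theorem the increment is the product of the gradient at some [g s] with
    [dg s]. Replacing the former by the gradient at [x] costs second derivatives, replacing the
    latter by [y - x] costs the curvature of the curve; this is why [B1] appears next to [B2]. *)
Lemma curve_taylor : 0 <= B1 -> 0 <= B2 ->
  `|phi (y, t) - phi (x, t) - dot (tgrad S phi (x, t)) (y - x)| <=
    (27 * c ^+ 2 * B2 + 3 * c * B1) * d ^+ 2.
Proof.
move=> B10 B20; have [g0 g1 hg] := gc.
have htg p : STbar S p -> exists g, is_tgrad S phi p g by exact: is_tgrad_exists.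
have [s h|s h] := @mvt_derive R (fun s => phi (g s, t))
    (fun s => dot (tgrad S phi (g s, t)) (dg s)) 0 1 (@ler01 R).
  by apply: curve_tgrad => //; apply: in01; lra.
rewrite g0 g1 subr0 mulr1 => ->.
have hs := in01 h.
have -> : dot (tgrad S phi (g s, t)) (dg s) - dot (tgrad S phi (x, t)) (y - x) =
    dot (tgrad S phi (g s, t) - tgrad S phi (x, t)) (dg s)
    - dot (tgrad S phi (x, t)) (y - x - dg s).
  by rewrite dotBl [in RHS]dotBr opprB addrA subrK.
apply: le_trans (ler_normB _ _) _.
have dT : enorm (tgrad S phi (g s, t) - tgrad S phi (x, t)) <= 9 * c * d * B2.
  apply: le_trans (enorm_sum_le _) _.
  have dTj j : `|(tgrad S phi (g s, t) - tgrad S phi (x, t)) 0 j| <= 3 * c * d * B2.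
    rewrite !mxE.
    apply: (@curve_mean (fun q => tgrad S phi q 0 j)) => // p hp.
      exact: is_tgrad_coord_exists.
    exact: le_trans (tgrad2_column _ _ _ _) (hB2 hp).
  by have := dTj 0; have := dTj 1; have := dTj 2%:R; lra.
have a1 := dot_le (tgrad S phi (g s, t) - tgrad S phi (x, t)) (dg s).
have a2 := ler_pM (enorm_ge0 _) (enorm_ge0 _) dT (curve_derive_enorm hs).
have a3 := dot_le (tgrad S phi (x, t)) (y - x - dg s).
have hx : STbar S (x, t) by rewrite -g0; apply: curve_STbar; lra.
have a4 : enorm (y - x - dg s) <= 3 * (c * d ^+ 2).
  apply: le_trans (enorm_le_norm _) _; rewrite ler_wpM2l //.
  exact: surface_curve_increment gc d0 c0 h.
have a5 := ler_pM (enorm_ge0 _) (enorm_ge0 _) (hB1 hx) a4.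
by have := le_trans a1 a2; have := le_trans a3 a5; lra.
Qed.

End Local.
End SurfaceTaylor.

Section GlobalTaylor.
Variable R : realType.
Implicit Type S : surface_data R.

Definition tgrad_bound S phi (B1 : R) :=
  [/\ Ck_on 2 (STbar S) phi, 0 <= B1
    & forall p, STbar S p -> enorm (tgrad S phi p) <= B1].

(** The labels are taken in [Gamma0 S] and the bound is required at all times at once, so that one
    chain of points serves every [Gamma S t]. *)
Definition osc_bound S K (X Y : 'rV[R]_3) := forall phi B1 t,
  tgrad_bound S phi B1 -> time_set S t ->
  `|phi (Phi S (Y, t), t) - phi (Phi S (X, t), t)| <= K * B1.

Lemma osc_bound_sym S K X Y : osc_bound S K X Y -> osc_bound S K Y X.
Proof. by move=> h phi B1 t hb tt; rewrite distrC; exact: h. Qed.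

Lemma osc_bound_trans S K K' X Y Z : osc_bound S K X Y -> osc_bound S K' Y Z ->
  osc_bound S (K + K') X Z.
Proof.
move=> h h' phi B1 t hb tt; have := h phi B1 t hb tt; have := h' phi B1 t hb tt.
have := ler_distD (phi (Phi S (Y, t), t)) (phi (Phi S (Z, t), t)) (phi (Phi S (X, t), t)).
by rewrite mulrDl; lra.
Qed.

Lemma osc_bound_mono S K K' X Y : K <= K' -> osc_bound S K X Y -> osc_bound S K' X Y.
Proof.
move=> KK h phi B1 t hb tt; apply: le_trans (h phi B1 t hb tt) _.
by case: hb => _ B10 _; rewrite ler_wpM2r.
Qed.

Lemma open_balls (V : normedModType R) (Q : set V) (r : R) :
  open [set z | exists2 y, Q y & `|y - z| < r].
Proof.
rewrite (_ : [set z | _] = \bigcup_(y in Q) ball y r).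
  by apply: bigcup_open => y _; exact: ball_open.
by apply/seteqP; split=> z /= [y Qy h]; exists y => //; move: h; rewrite -ball_normE.
Qed.

(* Connectedness chains the local estimates along nearby points. *)
Lemma osc_bound_global S : evolving_surface S ->
  exists2 K, 0 < K & forall X Y, Gamma0 S X -> Gamma0 S Y -> osc_bound S K X Y.
Proof.
move=> surf; have [c c0 hc] := surface_curve_exists surf.
(* [curve_lip] has the factor [3 * c * d], and here [c * d < 1]. *)
have step X Y : Gamma0 S X -> Gamma0 S Y -> `|Y - X| < c^-1 -> osc_bound S 3 X Y.
  move=> GX GY XY phi B1 t [cphi B10 hB1] tt.
  have [g [dg gc]] := hc X Y t GX GY tt XY.
  apply: le_trans (curve_lip surf cphi hB1 tt gc B10) _.
  rewrite ler_wpM2r // -mulrA ler_piMr // -ler_pdivlMl // mulr1 ltW //.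
have [[X0 GX0]|G0] := pselect (exists X, Gamma0 S X); last first.
  by exists 1 => // X Y GX; exfalso; apply: G0; exists X.
pose A := [set Y | Gamma0 S Y /\ exists K, osc_bound S K X0 Y].
have AE : A = Gamma0 S.
  apply: (es_connected surf).
  - exists X0; split=> //; exists 0 => phi B1 t _ _.
    by rewrite subrr normr0 mul0r.
  - exists [set z | exists2 y, A y & `|y - z| < c^-1]; first exact: open_balls.
    apply/seteqP; split=> [z Az|z [Gz [y [Gy [K hK]] yz]]].
      by split; [case: Az|exists z => //; rewrite subrr normr0 invr_gt0].
    split=> //; exists (K + 3); apply: osc_bound_trans hK _.
    by apply: step => //; rewrite distrC.
  - exists (~` [set z | exists2 y, (Gamma0 S `\` A) y & `|y - z| < c^-1]).
      by apply: open_closedC; exact: open_balls.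
    apply/seteqP; split=> [z [Gz [K hK]]|z [Gz nz]].
      split=> // -[y [Gy nAy] yz]; apply: nAy; split=> //; exists (K + 3).
      by apply: osc_bound_trans hK _; exact: step.
    apply: contrapT => nAz; apply: nz; exists z => //.
    by rewrite subrr normr0 invr_gt0.
have [||K K0 hK] := @compact_uniform_ball R _ _ (fun K Y => osc_bound S K X0 Y)
    (es_compact surf); last first.
- exists (K + K); first exact: addr_gt0.
  move=> X Y GX GY; apply: osc_bound_trans (hK Y GY).
  exact/osc_bound_sym/hK.
- move=> Y0; rewrite -AE => -[GY0 [K hK]].
  exists (`|K| + 3 + c) => [|Y GY hY]; first by have := normr_ge0 K; lra.
  rewrite AE in GY.
  apply: (@osc_bound_mono _ (K + 3)).
    by have := ler_norm K; lra.
  apply: osc_bound_trans hK _; apply: step => //.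
  apply: lt_le_trans hY _; rewrite lef_pV2 ?posrE //; have := normr_ge0 K; lra.
- by move=> K K' Y _; exact: osc_bound_mono.
Qed.

(** The curve estimate covers labels at distance below [c^-1]. Otherwise [k * enorm (y - x)] is at
    least 1, and the oscillation of [phi] and the linear term are absorbed into the square of the
    distance. *)
Lemma surface_taylor S : evolving_surface S ->
  exists2 C, 0 < C & forall phi B1 B2 t x y, tgrad_bound S phi B1 -> 0 <= B2 ->
    (forall p, STbar S p -> frobenius (tgrad2 S phi p) <= B2) ->
    time_set S t -> Gamma S t x -> Gamma S t y ->
    `|phi (y, t) - phi (x, t) - dot (tgrad S phi (x, t)) (y - x)| <=
      C * (B1 + B2) * enorm (y - x) ^+ 2.
Proof.
move=> surf; have [c c0 hc] := surface_curve_exists surf.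
have [C0 C00 hC0] := Phi_inverse_lip surf.
have [K K0 hK] := osc_bound_global surf.
pose k := c * C0; have k0 : 0 < k by rewrite mulr_gt0.
pose C1 := (27 * c ^+ 2 + 3 * c) * C0 ^+ 2.
have C10 : 0 < C1.
  by rewrite mulr_gt0 ?exprn_gt0 // addr_gt0 ?mulr_gt0 ?exprn_gt0.
pose C2 := K * k ^+ 2 + k.
have C20 : 0 < C2 by rewrite addr_gt0 // mulr_gt0 // exprn_gt0.
exists (C1 + C2); first exact: addr_gt0.
move=> phi B1 B2 t _ _ hphi B20 hB2 tt [X GX <-] [Y GY <-].
have [cphi B10 hB1] := hphi.
have hx : STbar S (Phi S (X, t), t) by split=> //; exists X.
have osc := hK X Y GX GY phi B1 t hphi tt.
set y := Phi S (Y, t) in osc *; set x := Phi S (X, t) in hx osc *.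
have dE : `|Y - X| <= C0 * enorm (y - x).
  apply: le_trans (hC0 _ _ _ GX GY tt) _; rewrite ler_wpM2l ?(ltW C00) //.
  exact: norm_le_enorm.
have e0 := enorm_ge0 (y - x); have B0 : 0 <= B1 + B2 by rewrite addr_ge0.
have [close|far] := ltP `|Y - X| c^-1.
  have [g [dg gc]] := hc _ _ _ GX GY tt close.
  apply: le_trans (curve_taylor surf cphi hB1 hB2 tt gc (normr_ge0 _) (ltW c0) B10 B20) _.
  have h1 : `|Y - X| ^+ 2 <= C0 ^+ 2 * enorm (y - x) ^+ 2.
    by rewrite -exprMn ler_sqr ?nnegrE ?mulr_ge0 ?(ltW C00).
  have h2 : 27 * c ^+ 2 * B2 + 3 * c * B1 <= (27 * c ^+ 2 + 3 * c) * (B1 + B2).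
    have : 0 <= c ^+ 2 * B1 by rewrite mulr_ge0 ?sqr_ge0.
    by have : 0 <= c * B2; [rewrite mulr_ge0 ?(ltW c0)|lra].
  have h0 : 0 <= 27 * c ^+ 2 * B2 + 3 * c * B1.
    by rewrite addr_ge0 // !mulr_ge0 ?sqr_ge0 ?(ltW c0).
  apply: le_trans (ler_pM h0 (sqr_ge0 _) h2 h1) _.
  have -> : (27 * c ^+ 2 + 3 * c) * (B1 + B2) * (C0 ^+ 2 * enorm (y - x) ^+ 2) =
     C1 * (B1 + B2) * enorm (y - x) ^+ 2 by rewrite /C1; ring.
  by rewrite ler_wpM2r ?sqr_ge0 // ler_wpM2r // lerDl ltW.
have h1 : 1 <= k * enorm (y - x).
  rewrite -mulrA -ler_pdivrMl // mulr1; exact: le_trans far dE.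
have a1 := le_trans (dot_le _ _) (ler_wpM2r e0 (hB1 _ hx)).
apply: le_trans (ler_normB _ _) _.
have h2 : 1 <= k ^+ 2 * enorm (y - x) ^+ 2 by rewrite -exprMn exprn_ege1.
have h3 : K * B1 <= K * B1 * (k ^+ 2 * enorm (y - x) ^+ 2).
  by rewrite ler_peMr // mulr_ge0 // ltW.
have h4 : B1 * enorm (y - x) <= B1 * enorm (y - x) * (k * enorm (y - x)).
  by rewrite ler_peMr // mulr_ge0.
apply: (@le_trans _ _ (C2 * B1 * enorm (y - x) ^+ 2)).
  by rewrite /C2; move: osc a1 h3 h4; clear; lra.
rewrite ler_wpM2r ?sqr_ge0 //.
apply: ler_pM => //; [exact: ltW|by rewrite lerDr ltW|by rewrite lerDl].
Qed.

End GlobalTaylor.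

(** * Material derivatives and the normal tube *)

Section TimeTaylor.
Variable R : realType.
Implicit Type S : surface_data R.

(** Limits along this filter are unique only at an accumulation point. Before the final time it is
    approached from the right, at the final time from the left, which is possible because [Tend S]
    is positive. *)
Lemma time_dnbhs_proper S t : evolving_surface S -> time_set S t ->
  ProperFilter (within (time_set S) t^').
Proof.
move=> surf /andP[t0 tT]; have T0 := es_Tend surf.
apply: Build_ProperFilter_ex => A hA.
have : \forall s \near t^', time_set S s -> A s by exact: hA.
move=> /nbhs_ballP[e /= e0 he].
have [tlt|tge] := ltP t (Tend S).
  pose u := Num.min (e / 2) (Tend S - t).
  have u0 : 0 < u by rewrite lt_min divr_gt0 // subr_gt0.
  have u1 : u <= e / 2 by rewrite ge_min lexx.
  have u2 : u <= Tend S - t by rewrite ge_min lexx orbT.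
  exists (t + u); apply: he.
  - by rewrite -ball_normE /ball_ /= opprD addrA subrr sub0r normrN gtr0_norm //; lra.
  - by rewrite -subr_eq0 addrC addKr gt_eqF.
  - by apply/andP; split; lra.
pose u := Num.min (e / 2) t.
have u0 : 0 < u by rewrite lt_min divr_gt0 //; lra.
have u1 : u <= e / 2 by rewrite ge_min lexx.
have u2 : u <= t by rewrite ge_min lexx orbT.
exists (t - u); apply: he.
- by rewrite -ball_normE /ball_ /= opprB addrC subrK gtr0_norm //; lra.
- by rewrite -subr_eq0 addrC addKr oppr_eq0 gt_eqF.
- by apply/andP; split; lra.
Qed.

Lemma derive_within_local S (f k : R -> R) t l : time_set S t ->
  is_derive t 1 k l -> (\forall s \near t, time_set S s -> f s = k s) ->
  derive_within (time_set S) (f : R -> R^o) t l.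
Proof.
move=> tt [dk <-] fk.
have ft : f t = k t by exact: (nbhs_singleton fk).
have /cvgrPdist_lt cv : h^-1 *: ((k \o shift t) (h *: (1 : R)) - k t) @[h --> 0^'] --> 'D_1 k t.
  exact: dk.
rewrite /derive_within; apply/cvgrPdist_lt => e e0.
have /nbhs_ballP[r /= r0 hr] := cv e e0.
have /nbhs_ballP[r' /= r'0 hr'] := fk.
have rr0 : 0 < Num.min r r' by rewrite lt_min r0.
apply/nbhs_ballP; exists (Num.min r r') => //= s.
rewrite -ball_normE /ball_ /= lt_min => /andP[h1 h2] st ts.
have hs : f s = k s by apply: hr' => //; rewrite -ball_normE.
have := hr (s - t).
rewrite -ball_normE /ball_ /= sub0r normrN distrC subr_eq0 => /(_ h1 st).
have -> : (s - t) *: (1 : R) = s - t by rewrite [_ *: _]mulr1.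
by rewrite /= subrK hs ft.
Qed.

Lemma matder_eq S f p l : evolving_surface S -> STbar S p -> is_matder S f p l ->
  matder S f p = l.
Proof.
case: p => x t surf [/= tt _] hl.
have : is_matder S f (x, t) (matder S f (x, t)).
  by rewrite /matder; case: xgetP => [y _ //|/(_ l)]; exact.
case: hl => X [GX /= EX] dX [Y [GY /= EY] dY].
have XY : Y = X by apply: (es_Phi_inj surf tt); rewrite ?inE // EX EY.
subst Y; have PF := time_dnbhs_proper surf tt.
exact: (cvg_unique _ dY dX).
Qed.

Lemma Phi_time_extension S X t : evolving_surface S -> Gamma0 S X -> time_set S t ->
  exists (I : set R) (a : R -> 'rV[R]_3), [/\ open I, I t, Ck 2 I a &
    forall s, I s -> time_set S s -> a s = Phi S (X, s)].
Proof.
move=> surf GX tt; have [|W [f [oW Wx sf fE]]] := es_Phi_smooth surf (x := (X, t)).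
  by split.
exists [set s | W (X, s)], (fun s => f (X, s)); split=> //.
- apply: (@open_comp _ _ (fun s : R => (X, s)) W) => // y _.
  by apply: differentiable_continuous; have [] := diff_slicer X y.
- exact: Ck_slicer (sf 2%N).
- by move=> s Ws ts; apply: fE.
Qed.

(** Composing extensions of the path and of [phi] gives a twice differentiable function on an open
    set of times around [t], so that one-sided derivatives at the ends of the time interval become
    ordinary ones. *)
Lemma material_extension S phi X t : evolving_surface S -> Ck_on 2 (STbar S) phi ->
  Gamma0 S X -> time_set S t ->
  exists (I : set R) (k k1 k2 : R -> R), [/\ open I, I t,
    forall s, I s -> is_derive s 1 k (k1 s), forall s, I s -> is_derive s 1 k1 (k2 s) &
    forall s, I s -> time_set S s -> k s = phi (Phi S (X, s), s)].
Proof.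
move=> surf cphi GX tt.
have [I [a [oI It Ca aE]]] := Phi_time_extension surf GX tt.
have hp : STbar S (a t, t) by split=> //=; rewrite aE //; exists X.
have [Q [g [oQ Qt Cg gE]]] := cphi _ hp.
pose p s := (a s, s).
have da s : I s -> is_derive s 1 a ('D_1 a s).
  by move=> Is; apply: DeriveDef => //; apply: diff_derivable; exact: Ca.1.
have dda s : I s -> derivable ('D_1 a) s 1.
  by move=> Is; apply: diff_derivable; exact: (Ca.2 1).1.
have dp s : I s -> is_derive s 1 p ('D_1 a s, 1).
  move=> Is; have d1 : differentiable a s by exact: Ca.1.
  have d2 : differentiable (id : R -> R) s by exact: ex_diff.
  have d12 := differentiable_pair d1 d2.
  apply: DeriveDef; first exact: diff_derivable.
  by rewrite deriveE // (diff_pair d1 d2) /= -deriveE // diff_val.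
have cp s : I s -> {for s, continuous p}.
  by move=> Is; apply/differentiable_continuous/derivable1_diffP; case: (dp s Is).
pose J := I `&` [set s | Q (p s)].
have JI s : J s -> I s by case.
have JQ s : J s -> Q (p s) by case.
have oJ : open J.
  rewrite openE => s [Is Qs].
  have n1 : \forall u \near s, I u by exact: open_nbhs_nbhs.
  have n2 : \forall u \near s, Q (p u) by apply: (cp s Is Q); exact: open_nbhs_nbhs.
  by apply: filterS2 n1 n2 => u.
pose v s := ('D_1 a s, 1 : R) : 'rV[R]_3 * R.
(* The chain rule yields a derivative of [g] in the moving direction [v s]. Expanded in a fixed
   basis it can be differentiated again, since [Ck] speaks of constant directions only. *)
pose k1 s := \sum_k stcoord k (v s) * 'D_(stbasis R k) g (p s).
exists J, (fun s => g (p s)), k1, ('D_1 k1); split=> //.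
- move=> s [Is Qs]; have dg : differentiable g (p s) by exact: Cg.1.
  have := is_derive_comp (dp s Is) dg.
  by rewrite (derive_coord (@stcoordE R)).
- move=> s [Is Qs]; apply: DeriveDef => //.
  have -> : k1 = \sum_k (fun s => stcoord k (v s) * 'D_(stbasis R k) g (p s)).
    by apply/funext => u; rewrite /k1 fct_sumE.
  apply: derivable_sum => k; apply: derivableM.
    rewrite /stcoord; case: (fintype.split k) => [i|_] /=.
      by have /derivable_mxP := dda s Is; apply.
    exact: derivable_cst.
  have dDg : differentiable ('D_(stbasis R k) g) (p s) by exact: (Cg.2 _).1.
  by have [] := is_derive_comp (dp s Is) dDg.
- move=> s [Is Qs] ts; rewrite gE //= /p ?aE //.
  by split=> //=; exists X.
Qed.

Section Path.
Variables (S : surface_data R) (phi : 'rV[R]_3 * R -> R) (X : 'rV[R]_3).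
Hypothesis surf : evolving_surface S.
Hypothesis cphi : Ck_on 2 (STbar S) phi.
Hypothesis GX : Gamma0 S X.

Lemma path_STbar s : time_set S s -> STbar S (Phi S (X, s), s).
Proof. by move=> ts; split=> //; exists X. Qed.

Lemma material_path t : time_set S t ->
  exists k k1 : R -> R, [/\ is_derive t 1 k (k1 t),
    is_derive t 1 k1 (matder S (matder S phi) (Phi S (X, t), t)) &
    \forall s \near t, time_set S s ->
      phi (Phi S (X, s), s) = k s /\ matder S phi (Phi S (X, s), s) = k1 s].
Proof.
move=> tt; have [I [k [k1 [k2 [oI It dk dk1 kE]]]]] := material_extension surf cphi GX tt.
have nI s : I s -> \forall u \near s, I u by move=> Is; exact: open_nbhs_nbhs.
have m1 s : I s -> time_set S s -> matder S phi (Phi S (X, s), s) = k1 s.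
  move=> Is ts; apply: matder_eq => //; first exact: path_STbar.
  exists X => //=; apply: (derive_within_local ts (dk s Is)).
  by apply: filterS (nI s Is) => u Iu tu; rewrite kE.
have m2 : matder S (matder S phi) (Phi S (X, t), t) = k2 t.
  apply: matder_eq => //; first exact: path_STbar.
  exists X => //=; apply: (derive_within_local tt (dk1 t It)).
  by apply: filterS (nI t It) => u Iu tu; rewrite m1.
exists k, k1; split; [exact: dk|by rewrite m2; exact: dk1|].
by apply: filterS (nI t It) => s Is ts; rewrite kE // m1.
Qed.

(** The extension [k] may vary with the time [t]; this suffices, as differentiability inside the
    interval and continuity up to its ends are local. *)
Lemma mvt_time (F dF : R -> R) (a b : R) : a < b -> time_set S a -> time_set S b ->
  (forall t, time_set S t -> exists2 k : R -> R, is_derive t 1 k (dF t) &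
     \forall s \near t, time_set S s -> F s = k s) ->
  exists2 s, a < s < b & F b - F a = dF s * (b - a).
Proof.
move=> ab ta tb hF.
have tab s : a <= s <= b -> time_set S s.
  move: ta tb => /andP[a0 _] /andP[_ bT] /andP[as_ sb].
  by apply/andP; split; [exact: le_trans a0 as_|exact: le_trans sb bT].
have [||s] := @MVT R F dF a b ab.
- move=> s sab; have ts : time_set S s.
    by apply: tab; move: sab; rewrite in_itv /= => /andP[/ltW -> /ltW ->].
  have [k dk Fk] := hF s ts; apply: near_eq_is_derive dk.
  apply: filterS2 Fk (near_in_itvoo sab) => u h; rewrite in_itv /= => /andP[h1 h2].
  by rewrite h //; apply: tab; rewrite !ltW.
- apply/subspace_continuousP => s /=; rewrite in_itv /= => sab.
  have [k [dk _] Fk] := hF s (tab _ sab).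
  have ck : {for s, continuous k} by apply/differentiable_continuous/derivable1_diffP.
  have Fs : F s = k s := nbhs_singleton Fk (tab _ sab).
  have cF : F u @[u --> within [set` `[a, b]] (nbhs s)] --> F s.
    rewrite Fs; apply: cvg_trans _ (cvg_trans (cvg_app k (cvg_within _)) ck).
    apply: near_eq_cvg; apply: filterS Fk => u h; rewrite /= in_itv /= => uab.
    by rewrite h //; apply: tab.
  exact: cF.
- by rewrite in_itv /= => sab ->; exists s.
Qed.

(** The mean value theorem is used twice on the same path, first for [phi] and then for its material
    derivative. *)
Lemma time_taylor B3 a b : a < b -> time_set S a -> time_set S b ->
  (forall p, STbar S p -> `|matder S (matder S phi) p| <= B3) ->
  `|(phi (Phi S (X, b), b) - phi (Phi S (X, a), a)) / (b - a) -
    matder S phi (Phi S (X, a), a)| <= B3 * (b - a).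
Proof.
move=> ab ta tb hB3.
have ba : b - a != 0 by rewrite subr_eq0 gt_eqF.
have B30 : 0 <= B3 by apply: le_trans (normr_ge0 _) (hB3 _ (path_STbar ta)).
have [t tt|s /andP[s1 s2] ->] := mvt_time (F := fun s => phi (Phi S (X, s), s))
    (dF := fun s => matder S phi (Phi S (X, s), s)) ab ta tb.
  have [k [k1 [dk _ n]]] := material_path tt; exists k.
    by have [_ ->] := nbhs_singleton n tt.
  by apply: filterS n => s h /h[].
have ts : time_set S s.
  move: ta tb => /andP[a0 _] /andP[_ bT].
  by apply/andP; split; [exact: le_trans a0 (ltW s1)|exact: le_trans (ltW s2) bT].
have [t tt|u /andP[u1 u2]] := mvt_time (F := fun s => matder S phi (Phi S (X, s), s))
    (dF := fun s => matder S (matder S phi) (Phi S (X, s), s)) s1 ta ts.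
  have [k [k1 [_ dk1 n]]] := material_path tt; exists k1 => //.
  by apply: filterS n => s' h /h[].
rewrite mulfK // => ->; rewrite normrM.
have tu : time_set S u.
  move: ta ts => /andP[a0 _] /andP[_ bT].
  by apply/andP; split; [exact: le_trans a0 (ltW u1)|exact: le_trans (ltW u2) bT].
apply: ler_pM => //; first by apply: hB3; exact: path_STbar.
by rewrite gtr0_norm ?subr_gt0 // lerD2r ltW.
Qed.

End Path.

Lemma between_norm (u w v : R) : 0 < u * w -> `|u| <= `|w| ->
  (u <= v) || (w <= v) -> (v <= u) || (v <= w) -> 0 < `|v| <= `|w|.
Proof.
have [w0|w0|->] := ltgtP w 0; last by rewrite mulr0 ltxx.
  rewrite nmulr_lgt0 // => u0; rewrite (ltr0_norm u0) (ltr0_norm w0) => uw h1 h2.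
  have v0 : v < 0 by case/orP: h2; lra.
  by rewrite (ltr0_norm v0); apply/andP; split; [lra|case/orP: h1; lra].
rewrite pmulr_lgt0 // => u0; rewrite (gtr0_norm u0) (gtr0_norm w0) => uw h1 h2.
have v0 : 0 < v by case/orP: h1; lra.
by rewrite (gtr0_norm v0); apply/andP; split; [lra|case/orP: h2; lra].
Qed.

(** By the quadratic bound on the normal component, no point of the surface is closer to
    [z + s *: nu S (z, t)] than [z], so the distance is the absolute value of [s]. Each half of the
    normal segment thus avoids the surface and stays in one component of the complement; whether it
    is inside is decided near [z], by the outward normal. *)
Lemma normal_tube S : evolving_surface S ->
  exists2 r, 0 < r & forall t z s, time_set S t -> Gamma S t z -> `|s| <= r ->
    signed_dist (Gamma S t) (z + s *: nu S (z, t)) = s.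
Proof.
move=> surf; have [C C0 hC] := normal_quadratic surf.
exists (2 * C)^-1; first by rewrite invr_gt0 mulr_gt0.
move=> t z s tt Gz hs.
have nu1 : dot (nu S (z, t)) (nu S (z, t)) = 1 by apply: normal_unit.
set n := nu S (z, t) in nu1 *.
have dist u w : `|u| <= (2 * C)^-1 -> Gamma S t w -> `|u| <= enorm (z + u *: n - w).
  move=> hu Gw; rewrite -[leLHS]ger0_norm // -ler_sqr ?nnegrE ?enorm_ge0 // !real_normK ?num_real //.
  rewrite sqr_enorm.
  have -> : z + u *: n - w = u *: n - (w - z) by rewrite addrAC opprB addrC.
  have := hC t z w tt Gz Gw; rewrite -/n; move: (w - z) => m h.
  rewrite dotBl !dotBr !dotZl !dotZr nu1 (dotC m n) -(sqr_enorm m).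
  have h1 : `|u * dot n m| <= (2 * C)^-1 * (C * enorm m ^+ 2).
    by rewrite normrM; apply: ler_pM.
  have h2 : (2 * C)^-1 * (C * enorm m ^+ 2) = enorm m ^+ 2 / 2.
    by field; rewrite gt_eqF.
  by move: h1; rewrite h2 => /ler_normlP[_ h3]; lra.
have infE : inf [set enorm (z + s *: n - y) | y in Gamma S t] = `|s|.
  apply/eqP; rewrite eq_le; apply/andP; split.
    apply: ge_inf; first by exists 0 => _ [y _ <-]; exact: enorm_ge0.
    exists z => //; rewrite addrC addKr enormZ.
    by have /enorm_unit -> := nu1; rewrite mulr1.
  apply: lb_le_inf; first by exists (enorm (z + s *: n - z)), z.
  by move=> _ [y Gy <-]; exact: dist.
have [_ _ nio] := es_normal surf (conj tt Gz : STbar S (z, t)); rewrite -/n in nio.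
have component u w : 0 < u * w -> `|u| <= `|w| -> `|w| <= (2 * C)^-1 ->
    inside (Gamma S t) (z + u *: n) <-> inside (Gamma S t) (z + w *: n).
  move=> uw luw hw.
  pose B := (fun v : R => z + v *: n) @` [set` `[Num.min u w, Num.max u w]].
  have cB : connected B.
    apply: connected_continuous_connected; first exact: segment_connected.
    apply: continuous_subspaceT => v; apply/differentiable_continuous/derivable1_diffP.
    by have [] := is_derive_line z n v.
  have BG : B `<=` ~` Gamma S t.
    move=> _ [v /= + <-] Gv; rewrite in_itv /= ge_min le_max => /andP[h1 h2].
    have hv := between_norm uw luw h1 h2.
    have := dist v _ (le_trans (proj2 (andP hv)) hw) Gv.
    by rewrite subrr enorm0 leNgt; case/andP: hv => ->.
  have Bu : B (z + u *: n) by exists u => //=; rewrite in_itv /= ge_min le_max !lexx.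
  have Bw : B (z + w *: n) by exists w => //=; rewrite in_itv /= ge_min le_max !lexx !orbT.
  have E := same_connected_component (connected_component_max Bu BG cB Bw).
  by rewrite /inside /= E; split=> -[_ ?]; split=> //; apply: BG.
rewrite /signed_dist infE.
have small : exists2 u, 0 < u & [/\ `|u| <= `|s| \/ s = 0, inside (Gamma S t) (z - u *: n)
    & ~ inside (Gamma S t) (z + u *: n)].
  (* For [s = 0] any small offset will do; the value 1 keeps the range of [u] nonempty. *)
  pose m := if s == 0 then 1 else `|s|.
  have m0 : 0 < m by rewrite /m; case: eqVneq => // s0; rewrite normr_gt0.
  have n1 : \forall u \near (0 : R)^'+, 0 < u by exact: nbhs_right_gt.
  have n2 : \forall u \near (0 : R)^'+, u < m by exact: nbhs_right_lt.
  have [u [[u0 um] [i1 i2]]] := filter_ex (filterI (filterI n1 n2) nio).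
  exists u => //; split=> //; rewrite gtr0_norm //.
  by move: um; rewrite /m; case: eqVneq => [->|_ /ltW]; [right|left].
have [u u0 [us i1 i2]] := small.
case: (ltgtP s 0) => s0.
- rewrite ltr0_norm // opprK; case: asboolP => // ni; exfalso; apply: ni.
  apply/(component (- u) s); [nra|rewrite normrN; case: us => // s0'; lra|exact: hs|].
  by rewrite scaleNr.
- rewrite gtr0_norm //; case: asboolP => // hi; exfalso; apply: i2.
  by apply/(component u s) => //; [nra|case: us => // s0'; lra].
- by rewrite s0 normr0 oppr0; case: asboolP.
Qed.

End TimeTaylor.

(** * Triangles and volumes *)

Section Triangle.
Variable R : realType.
Implicit Types (o u v w e f : 'rV[R]_3).

Lemma sum_set3 (M : nat) (V : nmodType) (F : 'I_M -> V) (i j k : 'I_M) :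
  i != j -> i != k -> j != k ->
  \sum_(l in [set i; j; k]%SET) F l = F i + F j + F k.
Proof.
move=> ij ik jk; rewrite -finset.setUA !big_setU1 /= ?big_set1; first by rewrite addrA.
  by rewrite !finset.inE.
by rewrite !finset.inE negb_or ij.
Qed.

Lemma card_set3 (M : nat) (i j k : 'I_M) : #|[set i; j; k]%SET| = 3%N ->
  [/\ i != j, i != k & j != k].
Proof.
rewrite -finset.setUA cardsU1 cards2 !finset.inE.
by case: (i == j); case: (i == k); case: (j == k).
Qed.

Definition tri o u v y := exists a b,
  [/\ 0 <= a, 0 <= b, a + b <= 1 & y = o + a *: u + b *: v].

Lemma hull3P (M : nat) (x : 'I_M -> 'rV[R]_3) (i j k : 'I_M) y :
  i != j -> i != k -> j != k ->
  hull x [set i; j; k]%SET y <-> tri (x i) (x j - x i) (x k - x i) y.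
Proof.
move=> ij ik jk; split=> [[w [w0 w1 ->]]|[a [b [a0 b0 ab ->]]]].
  move: w1; rewrite !sum_set3 // => w1.
  exists (w j), (w k); split.
  - by apply: w0; rewrite !finset.inE eqxx orbT.
  - by apply: w0; rewrite !finset.inE eqxx orbT.
  - have : 0 <= w i by apply: w0; rewrite !finset.inE eqxx.
    lra.
  - have -> : w i = 1 - w j - w k by lra.
    by apply: rV3P; rewrite !mxE; ring.
exists (fun l => if l == i then 1 - a - b else if l == j then a else b).
rewrite !sum_set3 // !eqxx (eq_sym j i) (negPf ij) (eq_sym k i) (negPf ik).
rewrite (eq_sym k j) (negPf jk); split.
- by move=> l _; case: ifP => _; [lra|case: ifP].
- by ring.
- by apply: rV3P; rewrite !mxE; ring.
Qed.

Lemma aff3P (M : nat) (x : 'I_M -> 'rV[R]_3) (i j k : 'I_M) y :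
  i != j -> i != k -> j != k ->
  aff x [set i; j; k]%SET y <->
  exists a b, y = x i + a *: (x j - x i) + b *: (x k - x i).
Proof.
move=> ij ik jk; split=> [[w [w1 ->]]|[a [b ->]]].
  move: w1; rewrite !sum_set3 // => w1.
  exists (w j), (w k); have -> : w i = 1 - w j - w k by lra.
  by apply: rV3P; rewrite !mxE; ring.
exists (fun l => if l == i then 1 - a - b else if l == j then a else b).
rewrite !sum_set3 // !eqxx (eq_sym j i) (negPf ij) (eq_sym k i) (negPf ik).
rewrite (eq_sym k j) (negPf jk); split.
- by ring.
- by apply: rV3P; rewrite !mxE; ring.
Qed.

Lemma tri_sym o u v y : tri o u v y -> tri o v u y.
Proof. by move=> [a [b [a0 b0 ab ->]]]; exists b, a; rewrite addrC addrAC; split=> //; lra. Qed.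

Lemma tri_dist o u v y y' : tri o u v y -> tri o u v y' ->
  enorm (y - y') <= enorm u + enorm v.
Proof.
move=> [a [b [a0 b0 ab ->]]] [a' [b' [a'0 b'0 ab' ->]]].
have -> : o + a *: u + b *: v - (o + a' *: u + b' *: v) = (a - a') *: u + (b - b') *: v.
  by apply: rV3P; rewrite !mxE; ring.
apply: le_trans (enormD _ _) _; rewrite !enormZ; apply: lerD.
  by rewrite ler_piMl ?enorm_ge0 // ler_norml; lra.
by rewrite ler_piMl ?enorm_ge0 // ler_norml; lra.
Qed.

Lemma tri_vertices o u v : [/\ tri o u v o, tri o u v (o + u) & tri o u v (o + v)].
Proof.
split; [exists 0, 0|exists 1, 0|exists 0, 1]; split=> //; rewrite ?scale0r ?scale1r ?addr0 //.
Qed.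

(* The projection of the disc on the direction normal to the edge [u] has length
   [2 r], that of the triangle is the height [|u x v| / |u|]. *)
Lemma disc_edge o u v c r : cross u v != 0 -> 0 <= r ->
  (exists a b, c = o + a *: u + b *: v) ->
  (forall y, (exists a b, y = o + a *: u + b *: v) -> enorm (y - c) <= r -> tri o u v y) ->
  2 * r * enorm u <= enorm (cross u v).
Proof.
move=> N0 r0 [a [b cE]] disc.
set N := cross u v in N0 *.
have Np : 0 < enorm N by rewrite enorm_gt0.
have u0 : u != 0.
  by apply: contraNneq N0 => u0; apply/eqP; rewrite /N u0; apply: rV3P; rewrite !rv3E; ring.
have up : 0 < enorm u by rewrite enorm_gt0.
(* [q] is normal to [u] in the plane of the triangle, and [k] below scales it to length [r]: the
   centre moved by [k *: q] to either side stays in the disc. *)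
pose q := dot u u *: v - dot u v *: u.
have qu : dot q u = 0 by rewrite /q !dot_simpl (dotC v u); ring.
have qv : dot q v = enorm N ^+ 2.
  by rewrite sqr_enorm dot_cross_cross /q !dot_simpl; ring.
have qq : enorm q = enorm u * enorm N.
  apply/eqP; rewrite -(@eqrXn2 _ 2) ?mulr_ge0 ?enorm_ge0 //; apply/eqP.
  rewrite exprMn !sqr_enorm dot_cross_cross /q !dot_simpl (dotC v u); ring.
pose k := r / (enorm u * enorm N).
have uN : 0 < enorm u * enorm N by rewrite mulr_gt0.
have k0 : 0 <= k by rewrite divr_ge0 // ltW.
have pt (s : R) : `|s| = k -> tri o u v (c + s *: q).
  move=> sk; apply: disc.
    exists (a - s * dot u v), (b + s * dot u u).
    by rewrite cE /q; apply: rV3P; rewrite !rv3E; ring.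
  by rewrite addrC addKr enormZ sk qq /k divfK // gt_eqF.
clearbody q.
have [a1 [b1 [a10 b10 ab1 e1]]] := pt k (ger0_norm k0).
have [a2 [b2 [a20 b20 ab2 e2]]] := pt (- k) (etrans (normrN k) (ger0_norm k0)).
have d1 : dot (c + k *: q - (c + - k *: q)) q = (b1 - b2) * enorm N ^+ 2.
  rewrite e1 e2 !dot_simpl !(dotC _ q) qu qv; ring.
have d2 : dot (c + k *: q - (c + - k *: q)) q = 2 * k * (enorm u * enorm N) ^+ 2.
  by rewrite -qq sqr_enorm !dot_simpl; ring.
have d3 : 2 * k * (enorm u * enorm N) ^+ 2 <= enorm N ^+ 2.
  rewrite -d2 d1 ler_piMl ?sqr_ge0 //; lra.
have d4 : 2 * k * (enorm u * enorm N) ^+ 2 = 2 * r * enorm u * enorm N.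
  by rewrite /k; field; rewrite !gt_eqF.
by rewrite d4 expr2 ler_pM2r in d3.
Qed.

(** [D] plays the role of the diameter. The last inequality replaces the inradius in the regularity
    condition: the area is comparable to the square of the diameter. *)
Definition shape (gamma D : R) u v :=
  [/\ 0 < D, enorm u <= D, enorm v <= D, enorm (v - u) <= D
    & D ^+ 2 <= gamma * enorm (cross u v)].

Lemma shape_sym gamma D u v : shape gamma D u v -> shape gamma D v u.
Proof. by case=> *; split=> //; rewrite 1?enormB // crossC enormN. Qed.

Lemma diam_le (A : set 'rV[R]_3) B : A !=set0 ->
  (forall y y', A y -> A y' -> enorm (y - y') <= B) -> diam A <= B.
Proof.
move=> [y Ay] h; apply: ge_sup; first by exists (enorm (y - y)), (y, y).
by move=> _ [[z z'] [Az Az'] <-]; exact: h.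
Qed.

Lemma diam_ge (A : set 'rV[R]_3) B y y' :
  (forall y y', A y -> A y' -> enorm (y - y') <= B) -> A y -> A y' ->
  enorm (y - y') <= diam A.
Proof.
move=> h Ay Ay'; apply: ub_le_sup; last by exists (y, y').
by exists B => _ [[z z'] [Az Az'] <-]; exact: h.
Qed.

(** [disc_edge] for both edges at [x i] bounds the inradius times the sum of their lengths by the
    length of the cross product, and this sum is at least the diameter. *)
Lemma triangle_shape (M : nat) (x : 'I_M -> 'rV[R]_3) (i j k : 'I_M) gamma :
  i != j -> i != k -> j != k -> 0 < gamma ->
  cross (x j - x i) (x k - x i) != 0 ->
  diam (hull x [set i; j; k]%SET) <= gamma * inradius x [set i; j; k]%SET ->
  shape gamma (diam (hull x [set i; j; k]%SET)) (x j - x i) (x k - x i).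
Proof.
move=> ij ik jk g0 N0 hreg.
set K := [set i; j; k]%SET in hreg *; set u := x j - x i in N0 *; set v := x k - x i in N0 *.
have hK y : hull x K y <-> tri (x i) u v y by exact: hull3P.
have bnd y y' : hull x K y -> hull x K y' -> enorm (y - y') <= enorm u + enorm v.
  by move=> /hK h /hK; exact: tri_dist.
have [/hK Ki /hK Kj /hK Kk] := tri_vertices (x i) u v.
have uD : enorm u <= diam (hull x K).
  by have := diam_ge bnd Kj Ki; rewrite addrC addKr.
have vD : enorm v <= diam (hull x K).
  by have := diam_ge bnd Kk Ki; rewrite addrC addKr.
have vuD : enorm (v - u) <= diam (hull x K).
  by have := diam_ge bnd Kk Kj; rewrite opprD addrACA subrr add0r.
have Duv : diam (hull x K) <= enorm u + enorm v by apply: diam_le => //; exists (x i).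
have Np : 0 < enorm (cross u v) by rewrite enorm_gt0.
have Np' : 0 < enorm (cross v u) by rewrite crossC enormN.
have u0 : 0 < enorm u.
  rewrite enorm_gt0; apply: contraNneq N0 => u0.
  by apply/eqP; rewrite u0; apply: rV3P; rewrite !rv3E; ring.
have D0 : 0 < diam (hull x K) by exact: lt_le_trans uD.
split=> //.
suff : inradius x K * diam (hull x K) <= enorm (cross u v).
  move=> h; rewrite expr2; apply: le_trans (ler_wpM2r (ltW D0) hreg) _.
  by rewrite -mulrA ler_wpM2l // ltW.
rewrite -ler_pdivlMr //; apply: ge_sup.
  exists 0; split=> //; exists (x i); split; first by apply/aff3P => //; exists 0, 0; rewrite !scale0r !addr0.
  move=> y _; rewrite le_eqVlt ltNge enorm_ge0 orbF enorm_eq0 subr_eq0 => /eqP ->.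
  exact: Ki.
move=> r [r0 [c [/aff3P-/(_ ij ik jk)[a [b cE]] disc]]].
have disc1 y : (exists a b, y = x i + a *: u + b *: v) -> enorm (y - c) <= r -> tri (x i) u v y.
  by move=> hy hr; apply/hK; apply: disc => //; apply/aff3P.
have h1 := disc_edge N0 r0 (ex_intro _ a (ex_intro _ b cE)) disc1.
have h2 : 2 * r * enorm v <= enorm (cross v u).
  apply: (@disc_edge (x i) v u c r) => //.
  - by rewrite -enorm_gt0.
  - by exists b, a; rewrite cE addrAC.
  - by move=> y [b' [a' ->]] hr; apply: tri_sym; apply: disc1 => //; exists a', b'; rewrite addrAC.
rewrite (crossC v) enormN in h2.
rewrite ler_pdivlMr //; apply: le_trans (ler_wpM2l r0 Duv) _.
lra.
Qed.

Lemma shape_edge gamma D u v : 0 < gamma -> shape gamma D u v -> D <= gamma * enorm u.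
Proof.
move=> g0 [D0 uD vD _ h].
have := enorm_cross_le u v; have := enorm_ge0 u; have := enorm_ge0 v => v0 u0 uv.
have : D * D <= gamma * enorm u * D.
  rewrite -expr2; apply: le_trans h _; rewrite -mulrA ler_wpM2l ?(ltW g0) //.
  by apply: le_trans uv _; rewrite ler_wpM2l.
by rewrite ler_pM2r.
Qed.

Definition unitv u := (enorm u)^-1 *: u.

Lemma unitv_unit u : u != 0 -> dot (unitv u) (unitv u) = 1.
Proof.
rewrite -enorm_gt0 => u0; rewrite /unitv dotZl dotZr -sqr_enorm; field.
by rewrite gt_eqF.
Qed.

Lemma unitvK u : u != 0 -> enorm u *: unitv u = u.
Proof. by move=> u0; rewrite scalerA mulfV ?scale1r // enorm_eq0. Qed.

(** For unit vectors the length of the cross product is the sine of the angle, so the last condition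
    keeps the angle away from 0 and from the straight angle. *)
Definition frame (gamma : R) e f :=
  [/\ dot e e = 1, dot f f = 1 & 1 <= gamma * enorm (cross e f)].

Lemma shape_frame gamma D u v : 0 < gamma -> shape gamma D u v ->
  [/\ u != 0, v != 0 & frame gamma (unitv u) (unitv v)].
Proof.
move=> g0 sh; have [D0 uD vD _ h] := sh.
have u0 : 0 < enorm u.
  by have := shape_edge g0 sh; rewrite -(pmulr_rgt0 _ g0); exact: lt_le_trans.
have v0 : 0 < enorm v.
  by have := shape_edge g0 (shape_sym sh); rewrite -(pmulr_rgt0 _ g0); exact: lt_le_trans.
rewrite -!enorm_gt0 u0 v0; split=> //; split; rewrite ?unitv_unit -?enorm_gt0 //.
rewrite /unitv crossZl crossZr !enormZ !normfV !ger0_norm ?enorm_ge0 //.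
have -> : gamma * ((enorm u)^-1 * ((enorm v)^-1 * enorm (cross u v))) =
  gamma * enorm (cross u v) / (enorm u * enorm v) by field; rewrite !gt_eqF.
rewrite ler_pdivlMr ?mulr_gt0 // mul1r; apply: le_trans h.
by rewrite expr2; apply: ler_pM; rewrite ?enorm_ge0.
Qed.

End Triangle.

(** * Half-angle tangents, corners and incircles *)

Section Volume.
Variable R : realType.
Implicit Types (o u v w e f : 'rV[R]_3).

(** The sine over 1 plus the cosine of an angle is the tangent of its half. *)
Definition half_tan e f : R := enorm (cross e f) / (1 + dot e f).

Lemma frame_facts (gamma : R) e f : 0 < gamma -> frame gamma e f ->
  [/\ 0 < enorm (cross e f), enorm (cross e f) <= 1, 0 < 1 + dot e f, dot e f <= 1
    & enorm (cross e f) ^+ 2 = 1 - dot e f ^+ 2].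
Proof.
move=> g0 [ee ff gs].
have s0 : 0 < enorm (cross e f).
  by rewrite -(pmulr_rgt0 _ g0); exact: lt_le_trans ltr01 gs.
have s2 : enorm (cross e f) ^+ 2 = 1 - dot e f ^+ 2.
  by rewrite sqr_enorm dot_cross_cross ee ff mulr1.
have := exprn_gt0 2 s0; rewrite s2 => c2.
by split=> //; nra.
Qed.

Lemma half_tan_gt0 (gamma : R) e f : 0 < gamma -> frame gamma e f -> 0 < half_tan e f.
Proof. by move=> g0 /(frame_facts g0)[s0 _ c0 _ _]; rewrite divr_gt0. Qed.

(** The double cross product equals [(1 - dot e f) *: (e + f)], and (1 - cos) / sin = sin / (1 +
    cos). *)
Lemma half_tan_rotate (gamma : R) e f : 0 < gamma -> frame gamma e f ->
  half_tan e f *: (e + f) = (enorm (cross e f))^-1 *: cross (cross e f) (e - f).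
Proof.
move=> g0 fr; have [s0 _ c0 _ s2] := frame_facts g0 fr; have [ee ff _] := fr.
have -> : cross (cross e f) (e - f) = (1 - dot e f) *: (e + f).
  have -> : cross (cross e f) (e - f) =
      (dot e e - dot e f) *: f - (dot e f - dot f f) *: e.
    by apply: rV3P; rewrite !rv3E; ring.
  by rewrite ee ff; apply: rV3P; rewrite !mxE; ring.
rewrite scalerA; congr (_ *: _); rewrite /half_tan.
apply: (mulIf (lt0r_neq0 s0)); apply: (mulIf (lt0r_neq0 c0)).
have -> : enorm (cross e f) / (1 + dot e f) * enorm (cross e f) * (1 + dot e f) =
   enorm (cross e f) ^+ 2 by field; rewrite gt_eqF.
rewrite s2; field; rewrite gt_eqF //.
Qed.

(** The chord is twice the sine of the half angle. With the tangent on the right, errors come with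
    the same weights that make up the volume, and they can be summed without a bound on the number
    of triangles. *)
Lemma enormB_half_tan (gamma : R) e f : 0 < gamma -> frame gamma e f ->
  enorm (e - f) <= 2 * half_tan e f.
Proof.
move=> g0 fr; have [s0 _ c0 c1 s2] := frame_facts g0 fr; have [ee ff _] := fr.
have t0 := half_tan_gt0 g0 fr.
have t2 : 0 <= 2 * half_tan e f by lra.
rewrite (enorm_le _ t2) !dot_simpl ee ff (dotC f e) exprMn /half_tan.
rewrite expr_div_n s2.
have -> : (1 - dot e f ^+ 2) / (1 + dot e f) ^+ 2 = (1 - dot e f) / (1 + dot e f).
  by field; rewrite gt_eqF.
have : (1 - dot e f) / 2 <= (1 - dot e f) / (1 + dot e f).
  by rewrite ler_wpM2l ?subr_ge0 // lef_pV2 ?posrE //; lra.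
lra.
Qed.

Lemma corner_unique (gamma d a b : R) e f : 0 < gamma -> frame gamma e f ->
  dot (a *: e + b *: f - d *: e) e = 0 -> dot (a *: e + b *: f - d *: f) f = 0 ->
  a *: e + b *: f = (d / (1 + dot e f)) *: (e + f).
Proof.
move=> g0 fr; have [s0 _ c0 c1 s2] := frame_facts g0 fr; have [ee ff _] := fr.
rewrite !dot_simpl ee ff (dotC f e) => h1 h2.
have c1' : 0 < 1 - dot e f.
  have : 0 < (1 - dot e f) * (1 + dot e f).
    by have := exprn_gt0 2 s0; rewrite s2; lra.
  by rewrite pmulr_lgt0.
have ab : a = b.
  apply/eqP; rewrite -subr_eq0; have : (a - b) * (1 - dot e f) = 0 by lra.
  by move/eqP; rewrite mulf_eq0 (gt_eqF c1') orbF.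
have aE : a = d / (1 + dot e f).
  by apply: (mulIf (lt0r_neq0 c0)); rewrite divfK ?gt_eqF //; rewrite -ab in h1; lra.
by rewrite -ab aE scalerDr.
Qed.

Lemma corner_len (gamma d : R) e f : 0 < gamma -> frame gamma e f -> 0 <= d ->
  enorm ((d / (1 + dot e f)) *: (e + f) - d *: e) = d * half_tan e f.
Proof.
move=> g0 fr d0; have [s0 _ c0 c1 s2] := frame_facts g0 fr; have [ee ff _] := fr.
have t0 := half_tan_gt0 g0 fr.
have -> : (d / (1 + dot e f)) *: (e + f) - d *: e =
    (d / (1 + dot e f)) *: (f - dot e f *: e).
  by apply: rV3P; rewrite !mxE; field; rewrite gt_eqF.
rewrite enormZ ger0_norm ?divr_ge0 ?(ltW c0) // /half_tan mulrAC -mulrA.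
congr (_ * _); congr (_ / _).
apply/eqP; rewrite -(@eqrXn2 _ 2) ?enorm_ge0 //; apply/eqP.
by rewrite s2 sqr_enorm !dot_simpl ee ff (dotC f e); ring.
Qed.

Lemma corner_area (gamma d : R) o e f : 0 < gamma -> frame gamma e f -> 0 <= d ->
  triangle_area o (o + d *: e) (o + (d / (1 + dot e f)) *: (e + f)) +
  triangle_area o (o + (d / (1 + dot e f)) *: (e + f)) (o + d *: f) =
  d ^+ 2 * half_tan e f.
Proof.
move=> g0 fr d0; have [s0 _ c0 c1 s2] := frame_facts g0 fr.
have oE w : o + w - o = w by rewrite addrC addKr.
rewrite /triangle_area !oE.
have -> : cross (d *: e) ((d / (1 + dot e f)) *: (e + f)) =
    (d ^+ 2 / (1 + dot e f)) *: cross e f.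
  by apply: rV3P; rewrite !rv3E; ring.
have -> : cross ((d / (1 + dot e f)) *: (e + f)) (d *: f) =
    (d ^+ 2 / (1 + dot e f)) *: cross e f.
  by apply: rV3P; rewrite !rv3E; ring.
rewrite enormZ ger0_norm ?divr_ge0 ?sqr_ge0 ?(ltW c0) // /half_tan.
by field; rewrite gt_eqF.
Qed.

(** The centre is the barycentre of the vertices weighted by the lengths of the opposite edges, the
    radius is twice the area over the perimeter, and the contact point lies at distance (a + b - c)
    / 2 from [o]. *)
Lemma incircle_edge o u v (a b c : R) : enorm u = a -> enorm v = b -> enorm (v - u) = c ->
  0 < a -> 0 < a + b + c -> 0 <= a + b - c -> c <= a + b -> b <= a + c ->
  touches (o + (a + b + c)^-1 *: (b *: u + a *: v)) (enorm (cross u v) / (a + b + c))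
    o (o + u) (o + ((a + b - c) / (2 * a)) *: u).
Proof.
move=> ua vb wc a0 P0 t0 cab bac.
have uu : dot u u = a ^+ 2 by rewrite -sqr_enorm ua.
have vv : dot v v = b ^+ 2 by rewrite -sqr_enorm vb.
have uv : dot u v = ((a + b - c) * (a + b + c)) / 2 - a * b.
  have : dot (v - u) (v - u) = c ^+ 2 by rewrite -sqr_enorm wc.
  by rewrite !dot_simpl uu vv (dotC v u) => h; lra.
have P0' : a + b + c != 0 by rewrite gt_eqF.
have a0' : a != 0 by rewrite gt_eqF.
set P := a + b + c in P0 P0' uv *.
have oE w : o + w - o = w by rewrite addrC addKr.
split.
- exists ((a + b - c) / (2 * a)); last by rewrite oE.
  by rewrite /= divr_ge0 ?mulr_ge0 ?(ltW a0) //= ler_pdivrMr ?mulr_gt0 //; lra.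
- rewrite oE opprD addrACA subrr add0r !dot_simpl uu (dotC v u) uv.
  by rewrite /P; field; rewrite -/P P0' a0'.
- rewrite opprD addrACA subrr add0r.
  apply/eqP; rewrite -(@eqrXn2 _ 2) ?enorm_ge0 ?divr_ge0 ?enorm_ge0 ?(ltW P0) //; apply/eqP.
  rewrite expr_div_n !sqr_enorm dot_cross_cross !dot_simpl uu vv (dotC v u) uv.
  by rewrite /P; field; rewrite -/P P0' a0'.
Qed.

(** Pythagoras for the centre, the contact point and an end of the edge. Consequently the two
    tangents from one vertex have equal length. *)
Lemma touches_dist (z : 'rV[R]_3) r a b p : touches z r a b p ->
  [/\ enorm (a - p) ^+ 2 = enorm (z - a) ^+ 2 - r ^+ 2,
      enorm (b - p) ^+ 2 = enorm (z - b) ^+ 2 - r ^+ 2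
    & enorm (a - p) + enorm (b - p) = enorm (b - a)].
Proof.
move=> [[s /= /andP[s0 s1] <-] h <-].
have e1 : a - (a + s *: (b - a)) = (- s) *: (b - a) by apply: rV3P; rewrite !mxE; ring.
have e2 : b - (a + s *: (b - a)) = (1 - s) *: (b - a) by apply: rV3P; rewrite !mxE; ring.
have e3 : z - a = (z - (a + s *: (b - a))) + s *: (b - a).
  by apply: rV3P; rewrite !mxE; ring.
have e4 : z - b = (z - (a + s *: (b - a))) - (1 - s) *: (b - a).
  by apply: rV3P; rewrite !mxE; ring.
split.
- rewrite e1 [in RHS]e3 !sqr_enorm; move: (z - (a + _)) h => w h.
  by move: (b - a) h => q h; rewrite !dot_simpl (dotC q w) h; ring.
- rewrite e2 [in RHS]e4 !sqr_enorm; move: (z - (a + _)) h => w h.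
  by move: (b - a) h => q h; rewrite !dot_simpl (dotC q w) h; ring.
- rewrite e1 e2 !enormZ normrN (ger0_norm s0) ger0_norm ?subr_ge0 //; ring.
Qed.

(** Equal tangent lengths turn the contact conditions into a linear system for three numbers, which
    fixes the distance whatever point [xget] selects. A contact point exists by [incircle_edge] at
    each of the three vertices. *)
Lemma contact_distE (M : nat) (x : 'I_M -> 'rV[R]_3) (i j k : 'I_M) gamma D :
  i != j -> i != k -> j != k -> 0 < gamma -> shape gamma D (x j - x i) (x k - x i) ->
  contact_dist x i j k =
    (enorm (x j - x i) + enorm (x k - x i) - enorm (x k - x j)) / 2.
Proof.
move=> ij ik jk g0 sh; have [u0 v0 _] := shape_frame g0 sh.
have [D0 _ _ _ hD] := sh.
pose a := enorm (x j - x i); pose b := enorm (x k - x i); pose c := enorm (x k - x j).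
have a0 : 0 < a by rewrite enorm_gt0.
have b0 : 0 < b by rewrite enorm_gt0.
have N0 : 0 < enorm (cross (x j - x i) (x k - x i)).
  by rewrite -(pmulr_rgt0 _ g0); apply: lt_le_trans hD; rewrite exprn_gt0.
have cE : x k - x i - (x j - x i) = x k - x j by rewrite opprB addrA subrK.
have c0 : 0 < c.
  rewrite enorm_gt0 -cE; apply: contraTneq N0 => /subr0_eq ->.
  by rewrite crossuu enorm0 ltxx.
have h1 : c <= a + b.
  by have := enorm_triangle (x i) (x k) (x j); rewrite (enormB (x i)) -/a -/b -/c; lra.
have h2 : b <= a + c by have := enorm_triangle (x j) (x k) (x i); rewrite -/a -/b -/c; lra.
have h3 : a <= b + c.
  by have := enorm_triangle (x k) (x j) (x i); rewrite (enormB _ (x k)) -/a -/b -/c; lra.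
have P0 : 0 < a + b + c by lra.
have key : forall p, is_contact x i j k p -> enorm (x i - p) = (a + b - c) / 2.
  move=> p [z [r [_ r0 /touches_dist[p1 p2 p3] [q /touches_dist[q1 q2 q3]]
    [q' /touches_dist[r1 r2 r3]]]]].
  have sq (s s' : R) : 0 <= s -> 0 <= s' -> s ^+ 2 = s' ^+ 2 -> s = s'.
    by move=> s0 s'0 /eqP; rewrite eqrXn2 // => /eqP.
  have E1 := sq _ _ (enorm_ge0 _) (enorm_ge0 _) (etrans p1 (esym r2)).
  have E2 := sq _ _ (enorm_ge0 _) (enorm_ge0 _) (etrans p2 (esym q1)).
  have E3 := sq _ _ (enorm_ge0 _) (enorm_ge0 _) (etrans q2 (esym r1)).
  move: p3 q3 r3; rewrite -E1 -E2 -E3 (enormB (x i) (x k)) -/a -/b -/c; lra.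
rewrite /contact_dist; case: xgetP => [p _ /key //|hno]; exfalso.
set z := x i + (a + b + c)^-1 *: (b *: (x j - x i) + a *: (x k - x i)).
set r := enorm (cross (x j - x i) (x k - x i)) / (a + b + c).
apply: (hno (x i + ((a + b - c) / (2 * a)) *: (x j - x i))).
exists z, r; split.
- apply/aff3P => //; exists (b / (a + b + c)), (a / (a + b + c)).
  by rewrite /z; apply: rV3P; rewrite !mxE; ring.
- by rewrite divr_gt0.
- have := @incircle_edge (x i) (x j - x i) (x k - x i) a b c.
  by rewrite cE subrKC; apply=> //; lra.
- exists (x j + ((c + a - b) / (2 * c)) *: (x k - x j)).
  have := @incircle_edge (x j) (x k - x j) (x i - x j) c a b.
  have -> : x i - x j - (x k - x j) = x i - x k by rewrite opprB addrA subrK.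
  rewrite subrKC.
  have -> : cross (x k - x j) (x i - x j) = cross (x j - x i) (x k - x i).
    by apply: rV3P; rewrite !rv3E; ring.
  have -> : x j + (c + a + b)^-1 *: (a *: (x k - x j) + c *: (x i - x j)) = z.
    by rewrite /z; apply: rV3P; rewrite !mxE; field; rewrite !gt_eqF //; lra.
  have -> : c + a + b = a + b + c by ring.
  by apply=> //; rewrite 1?enormB //; lra.
- exists (x k + ((b + c - a) / (2 * b)) *: (x i - x k)).
  have := @incircle_edge (x k) (x i - x k) (x j - x k) b c a.
  have -> : x j - x k - (x i - x k) = x j - x i by rewrite opprB addrA subrK.
  rewrite subrKC.
  have -> : cross (x i - x k) (x j - x k) = cross (x j - x i) (x k - x i).
    by apply: rV3P; rewrite !rv3E; ring.
  have -> : x k + (b + c + a)^-1 *: (c *: (x i - x k) + b *: (x j - x k)) = z.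
    by rewrite /z; apply: rV3P; rewrite !mxE; field; rewrite !gt_eqF //; lra.
  have -> : b + c + a = a + b + c by ring.
  by apply=> //; rewrite 1?enormB //; lra.
Qed.

Lemma law_of_cosines u v : u != 0 -> v != 0 ->
  enorm (v - u) ^+ 2 = enorm u ^+ 2 + enorm v ^+ 2 -
    2 * (enorm u * enorm v * dot (unitv u) (unitv v)).
Proof.
rewrite -!enorm_gt0 => u0 v0.
have -> : enorm u * enorm v * dot (unitv u) (unitv v) = dot u v.
  by rewrite /unitv dotZl dotZr; field; rewrite !gt_eqF.
by rewrite !sqr_enorm !dot_simpl (dotC v u); ring.
Qed.

(** The law of cosines gives (a + b - c)(a + b + c) = 2 a b (1 + cos). The angle condition bounds 1
    + cos below by 1 / (2 gamma^2), both edges are at least [D / gamma], and the perimeter is at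
    most [3 * D]. *)
Lemma contact_dist_ge (M : nat) (x : 'I_M -> 'rV[R]_3) (i j k : 'I_M) gamma D :
  i != j -> i != k -> j != k -> 0 < gamma -> shape gamma D (x j - x i) (x k - x i) ->
  D <= 6 * gamma ^+ 4 * contact_dist x i j k.
Proof.
move=> ij ik jk g0 sh; rewrite (contact_distE ij ik jk g0 sh).
have [u0 v0 fr] := shape_frame g0 sh; have [D0 uD vD wD hD] := sh.
have [s0 s1 c0 c1 s2] := frame_facts g0 fr; have [_ _ gs] := fr.
have uD' := shape_edge g0 sh; have vD' := shape_edge g0 (shape_sym sh).
have cE : x k - x i - (x j - x i) = x k - x j by rewrite opprB addrA subrK.
rewrite cE in wD.
have E : enorm (x k - x j) ^+ 2 = enorm (x j - x i) ^+ 2 + enorm (x k - x i) ^+ 2 -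
    2 * (enorm (x j - x i) * enorm (x k - x i) * dot (unitv (x j - x i)) (unitv (x k - x i))).
  by rewrite -cE law_of_cosines.
move: E gs s0 s1 c0 c1 s2; set C := dot (unitv _) _; set s := enorm (cross (unitv _) _).
move=> E gs s0 s1 c0 c1 s2.
move: (enorm (x j - x i)) (enorm (x k - x i)) (enorm (x k - x j)) uD vD wD uD' vD' E (enorm_ge0 (x k - x j)).
move=> a b c aD bD cD aD' bD' E c00.
have a0 : 0 < a by rewrite -(pmulr_rgt0 _ g0); exact: lt_le_trans aD'.
have b0 : 0 < b by rewrite -(pmulr_rgt0 _ g0); exact: lt_le_trans bD'.
have g2 : 1 <= gamma ^+ 2 * s ^+ 2 by rewrite -exprMn exprn_ege1.
have h1 : 1 <= 2 * gamma ^+ 2 * (1 + C).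
  have cc : 1 - C ^+ 2 <= 2 * (1 + C) by nra.
  by have := ler_wpM2l (sqr_ge0 gamma) cc; rewrite -s2; lra.
have h2 : D ^+ 2 <= gamma ^+ 2 * (a * b).
  have := ler_pM (ltW D0) (ltW D0) aD' bD'; rewrite -expr2; lra.
have h3 : (a + b - c) * (a + b + c) = 2 * (a * b) * (1 + C) by nra.
have h4 : D ^+ 2 <= gamma ^+ 4 * ((a + b - c) * (a + b + c)).
  have q : gamma ^+ 2 * (a * b) <= gamma ^+ 2 * (a * b) * (2 * gamma ^+ 2 * (1 + C)).
    by rewrite ler_peMr // mulr_ge0 ?sqr_ge0 // mulr_ge0 // ltW.
  rewrite h3; apply: le_trans (le_trans h2 q) _; rewrite le_eqVlt; apply/orP; left; apply/eqP; ring.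
have P0 : 0 < a + b + c by lra.
have abc : 0 < a + b - c.
  by have : 0 < (a + b - c) * (a + b + c); [rewrite h3 !mulr_gt0|rewrite pmulr_lgt0].
have h5 : (a + b - c) * (a + b + c) <= (a + b - c) * (3 * D) by rewrite ler_wpM2l ?(ltW abc) //; lra.
have h6 : D * D <= (3 * gamma ^+ 4 * (a + b - c)) * D.
  have := ler_wpM2l (exprn_ge0 4 (ltW g0)) h5; rewrite -expr2; lra.
rewrite ler_pM2r // in h6; lra.
Qed.

End Volume.

(** * Small triangles with a common vertex do not overlap *)

Section Overlap.
Variable R : realType.
Implicit Types (o u v w e f : 'rV[R]_3).

Lemma frame_gamma_ge1 (gamma : R) e f : 0 < gamma -> frame gamma e f -> 1 <= gamma.
Proof.
move=> g0 fr; have [s0 s1 _ _ _] := frame_facts g0 fr; have [_ _ gs] := fr.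
by apply: le_trans gs _; rewrite ler_piMr // ltW.
Qed.

(** Decomposition along [e], [f] and their normal, divided by the squared sine, which is at least 1
    / gamma^2. *)
Lemma frame_bound (gamma : R) e f w : 0 < gamma -> frame gamma e f ->
  enorm w <= `|dot w (unitv (cross e f))| + 2 * gamma ^+ 2 * (`|dot w e| + `|dot w f|).
Proof.
move=> g0 fr; have [s0 s1 c0 c1 s2] := frame_facts g0 fr; have [ee ff gs] := fr.
have := frame_decomp e f w; rewrite ee ff !mulr1 -sqr_enorm => dec.
set s := enorm (cross e f) in s0 s1 s2 gs dec *.
have wn : dot w (cross e f) = s * dot w (unitv (cross e f)).
  by rewrite /unitv dotZr -/s mulrA mulfV ?gt_eqF // mul1r.
have cabs : `|dot e f| <= 1 by rewrite ler_norml; apply/andP; split; lra.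
have e1 : enorm e = 1 by apply/enorm_unit.
have f1 : enorm f = 1 by apply/enorm_unit.
have b1 : `|dot w e - dot w f * dot e f| <= `|dot w e| + `|dot w f|.
  by apply: le_trans (ler_normB _ _) _; rewrite lerD2l normrM ler_piMr.
have b2 : `|dot w f - dot w e * dot e f| <= `|dot w e| + `|dot w f|.
  by apply: le_trans (ler_normB _ _) _; rewrite addrC lerD2r normrM ler_piMr.
have h : s ^+ 2 * enorm w <= s ^+ 2 * `|dot w (unitv (cross e f))| +
    2 * (`|dot w e| + `|dot w f|).
  have -> : s ^+ 2 * enorm w = enorm (s ^+ 2 *: w) by rewrite enormZ ger0_norm ?sqr_ge0.
  rewrite dec; apply: le_trans (enormD _ _) _; rewrite mulrDl mul1r addrA.
  rewrite enormZ f1 mulr1; apply: lerD => //.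
  apply: le_trans (enormD _ _) _; rewrite !enormZ e1 mulr1; apply: lerD => //.
  by rewrite wn -/s normrM (ger0_norm (ltW s0)) mulrAC expr2.
have gs2 : 1 <= gamma ^+ 2 * s ^+ 2 by rewrite -exprMn exprn_ege1.
rewrite -(ler_pM2l (exprn_gt0 2 s0)); apply: le_trans h _; rewrite [leRHS]mulrDr lerD2l.
have t0 : 0 <= 2 * (`|dot w e| + `|dot w f|) by rewrite mulr_ge0 // addr_ge0.
by have := ler_wpM2r t0 gs2; lra.
Qed.

Lemma unitv_cross (gamma : R) e f : 0 < gamma -> frame gamma e f ->
  [/\ dot (unitv (cross e f)) (unitv (cross e f)) = 1, dot (unitv (cross e f)) e = 0
    & dot (unitv (cross e f)) f = 0].
Proof.
move=> g0 fr; have [s0 _ _ _ _] := frame_facts g0 fr.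
split; first by rewrite unitv_unit // -enorm_gt0.
- by rewrite /unitv dotZl dotC dot_crossl mulr0.
- by rewrite /unitv dotZl dotC dot_crossr mulr0.
Qed.

(** The part of [n] orthogonal to the triangle normal has small products with [e] and [f], so
    [frame_bound] makes it short; its squared length is the left side. *)
Lemma normal_defect (gamma d : R) e f n : 0 < gamma -> frame gamma e f -> dot n n = 1 ->
  `|dot n e| <= d -> `|dot n f| <= d ->
  1 - dot n (unitv (cross e f)) ^+ 2 <= (4 * gamma ^+ 2 * d) ^+ 2.
Proof.
move=> g0 fr n1 ne nf; have [mm me mf] := unitv_cross g0 fr.
have fb w := frame_bound w g0 fr.
set m := unitv (cross e f) in mm me mf fb *; clearbody m.
have := fb (n - dot n m *: m).
have -> : dot (n - dot n m *: m) m = 0 by rewrite dotBl dotZl mm mulr1 subrr.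
have -> : dot (n - dot n m *: m) e = dot n e by rewrite dotBl dotZl me mulr0 subr0.
have -> : dot (n - dot n m *: m) f = dot n f by rewrite dotBl dotZl mf mulr0 subr0.
rewrite normr0 add0r => h.
have h2 : enorm (n - dot n m *: m) <= 4 * gamma ^+ 2 * d.
  have := sqr_ge0 gamma; nra.
have -> : 1 - dot n m ^+ 2 = enorm (n - dot n m *: m) ^+ 2.
  by rewrite sqr_enorm dotBl !dotBr !dotZl !dotZr n1 mm (dotC m n); ring.
by rewrite ler_sqr ?nnegrE ?enorm_ge0 // (le_trans (enorm_ge0 _) h2).
Qed.

Lemma frame_coord (gamma a b : R) e f : 0 < gamma -> frame gamma e f ->
  `|a| <= gamma * enorm (a *: e + b *: f) /\ `|b| <= gamma * enorm (a *: e + b *: f).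
Proof.
move=> g0 fr; have [s0 _ _ _ _] := frame_facts g0 fr; have [ee ff gs] := fr.
have e1 : enorm e = 1 by apply/enorm_unit.
have f1 : enorm f = 1 by apply/enorm_unit.
split.
- have := enorm_cross_le (a *: e + b *: f) f; rewrite f1 mulr1.
  have -> : cross (a *: e + b *: f) f = a *: cross e f.
    by apply: rV3P; rewrite !rv3E; ring.
  rewrite enormZ => h; have := ler_wpM2l (ltW g0) h; apply: le_trans.
  by rewrite mulrCA ler_peMr.
- have := enorm_cross_le e (a *: e + b *: f); rewrite e1 mul1r.
  have -> : cross e (a *: e + b *: f) = b *: cross e f.
    by apply: rV3P; rewrite !rv3E; ring.
  rewrite enormZ => h; have := ler_wpM2l (ltW g0) h; apply: le_trans.
  by rewrite mulrCA ler_peMr.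
Qed.

Lemma frame_span (gamma : R) e f w : 0 < gamma -> frame gamma e f ->
  dot w (unitv (cross e f)) = 0 -> exists a b, w = a *: e + b *: f.
Proof.
move=> g0 fr wn; have [s0 _ _ _ _] := frame_facts g0 fr; have [ee ff _] := fr.
have s2 : enorm (cross e f) ^+ 2 != 0 by rewrite expf_eq0 /= gt_eqF.
have wN : dot w (cross e f) = 0.
  by move: wn; rewrite /unitv dotZr => /eqP; rewrite mulf_eq0 invr_eq0 gt_eqF //= => /eqP.
have := frame_decomp e f w; rewrite wN scale0r add0r -sqr_enorm => dec.
exists (enorm (cross e f) ^- 2 * (dot w e * dot f f - dot w f * dot e f)),
  (enorm (cross e f) ^- 2 * (dot w f * dot e e - dot w e * dot e f)).
by rewrite -!scalerA -scalerDr -dec scalerA mulVf // scale1r.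
Qed.

(* What is used of the surface [G], its normal [nu], the polyhedral surface [Gh]
   and the closest point projection [pr]. *)
Definition tubular (C d0 : R) (G : set 'rV[R]_3) (nu : 'rV[R]_3 -> 'rV[R]_3)
    (Gh : set 'rV[R]_3) (pr : 'rV[R]_3 -> 'rV[R]_3) :=
  [/\ forall z, G z -> dot (nu z) (nu z) = 1,
      forall z w, G z -> G w -> `|dot (nu z) (w - z)| <= C * enorm (w - z) ^+ 2,
      forall y, Gh y -> G (pr y) /\ exists2 d, y = pr y + d *: nu (pr y) &
        forall w, G w -> `|d| <= enorm (y - w),
      forall z s, G z -> `|s| <= d0 -> Gh (z + s *: nu z) -> pr (z + s *: nu z) = z
    & forall y y', Gh y -> Gh y' -> pr y = pr y' -> y = y'].

(** The normal belongs to a foot point [z] instead of a vertex. Its product with the edge is a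
    difference of two quadratic terms, at distances [2 * D] and [D] from [z]; hence 5 = 4 + 1. *)
Lemma normal_edge (C gamma D : R) nu o u z : 0 < C -> 1 <= gamma ->
  `|dot nu (o + u - z)| <= C * enorm (o + u - z) ^+ 2 ->
  `|dot nu (o - z)| <= C * enorm (o - z) ^+ 2 ->
  enorm u <= D -> D <= gamma * enorm u -> 0 < enorm u -> enorm (o - z) <= D ->
  `|dot nu (unitv u)| <= 5 * C * gamma * D.
Proof.
move=> C0 g1 h1 h2 uD Du u0 zD.
have D0 : 0 < D by exact: lt_le_trans uD.
have e1 : enorm (o + u - z) <= 2 * D.
  by rewrite addrAC; apply: le_trans (enormD _ _) _; lra.
have s1 : enorm (o + u - z) ^+ 2 <= (2 * D) ^+ 2.
  by rewrite ler_sqr ?nnegrE ?enorm_ge0 // mulr_ge0 // ltW.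
have s2 : enorm (o - z) ^+ 2 <= D ^+ 2 by rewrite ler_sqr ?nnegrE ?enorm_ge0 // ltW.
have b1 := le_trans h1 (ler_wpM2l (ltW C0) s1).
have b2 := le_trans h2 (ler_wpM2l (ltW C0) s2).
have uE : dot nu u = dot nu (o + u - z) - dot nu (o - z).
  by rewrite -dotBr; congr (dot _ _); apply: rV3P; rewrite !mxE; ring.
have b3 : `|dot nu u| <= 5 * C * D ^+ 2.
  by rewrite uE; apply: le_trans (ler_normB _ _) _; lra.
rewrite /unitv dotZr normrM normfV (gtr0_norm u0) ler_pdivrMl //.
apply: le_trans b3 _.
have h : D * (5 * C * D) <= gamma * enorm u * (5 * C * D).
  by rewrite ler_wpM2r // !mulr_ge0 // ltW.
by rewrite expr2; lra.
Qed.

(** Below this size the displacement along the normal in [overlap] is at most [d0] and, relative to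
    the scale [rho] of the points, at most [k / (4 * gamma)]; 52 is 4 times 13, the sum of the
    factors 12 and 1 of the two heights. *)
Definition overlap_size (C d0 gamma k : R) : R :=
  Num.min 1 (Num.min (d0 / (12 * 28 * (C * gamma ^+ 3))) (k / (52 * 28 * (C * gamma ^+ 4)))).

Lemma overlap_size_gt0 C d0 gamma k : 0 < C -> 0 < d0 -> 0 < gamma -> 0 < k ->
  0 < overlap_size C d0 gamma k.
Proof.
move=> C0 d00 g0 k0.
have h3 : 0 < C * gamma ^+ 3 by rewrite mulr_gt0 // exprn_gt0.
have h4 : 0 < C * gamma ^+ 4 by rewrite mulr_gt0 // exprn_gt0.
rewrite !lt_min ltr01 /=; apply/andP; split; apply: divr_gt0; [exact: d00|lra|exact: k0|lra].
Qed.

Lemma scaled_coord_le (gamma D rho w x c : R) : 0 < gamma -> 0 < rho -> 0 < w -> 0 <= c ->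
  D <= gamma * w -> 8 * gamma * rho <= D -> x <= c -> rho * x / w <= c / 8.
Proof.
move=> g0 r0 w0 c0 Dw rD xc; rewrite ler_pdivrMr //.
have h : 8 * rho <= w by rewrite -(ler_pM2l g0); lra.
have := ler_wpM2l (ltW r0) xc; have := ler_wpM2r c0 h; lra.
Qed.

(** A point [y] of the first triangle is pushed along the normal at its foot point into the plane of
    the second. As the two direction combinations almost agree, the coordinates of the pushed point
    [y'] are close to [a'] and [b'], which are at least [k]; so [y'] lies in the second triangle. It
    has the same projection as [y], and injectivity gives [y' = y]. *)
Lemma overlap (C d0 gamma k : R) G nu Gh pr o u v u' v' D D' a b a' b' :
  0 < C -> 0 < d0 -> 0 < gamma -> 0 < k <= 1 -> tubular C d0 G nu Gh pr ->
  G o -> G (o + u) -> G (o + v) -> G (o + u') -> G (o + v') ->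
  (forall y, tri o u v y -> Gh y) -> (forall y, tri o u' v' y -> Gh y) ->
  shape gamma D u v -> shape gamma D' u' v' ->
  D <= overlap_size C d0 gamma k -> D' <= overlap_size C d0 gamma k ->
  0 < a <= 2 -> 0 < b <= 2 -> k <= a' <= 2 -> k <= b' <= 2 ->
  enorm ((a *: unitv u + b *: unitv v) - (a' *: unitv u' + b' *: unitv v'))
    <= k / (4 * gamma) ->
  exists al be, [/\ 0 < al, 0 < be, al + be < 1 & tri o u' v' (o + al *: u + be *: v)].
Proof.
move=> C0 d00 g0 /andP[k0 k1] [nu1 nuC hpr tube inj] Go Gu Gv Gu' Gv' Th Th' sh sh' Dd D'd
  /andP[a0 a2] /andP[b0 b2] /andP[ak' a2'] /andP[bk' b2'] close.
have [u0 v0 fr] := shape_frame g0 sh; have [u0' v0' fr'] := shape_frame g0 sh'.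
have g1 := frame_gamma_ge1 g0 fr.
have [D0 uD vD _ _] := sh; have [D0' uD' vD' _ _] := sh'.
have Du := shape_edge g0 sh; have Dv := shape_edge g0 (shape_sym sh).
have Du' := shape_edge g0 sh'; have Dv' := shape_edge g0 (shape_sym sh').
rewrite -enorm_gt0 in u0; rewrite -enorm_gt0 in v0.
rewrite -enorm_gt0 in u0'; rewrite -enorm_gt0 in v0'.
have e1 : enorm (unitv u) = 1 by apply/enorm_unit; case: fr.
have f1 : enorm (unitv v) = 1 by apply/enorm_unit; case: fr.
set d := overlap_size _ _ _ _ in Dd D'd.
have g30 : 0 < C * gamma ^+ 3 by rewrite mulr_gt0 // exprn_gt0.
have g40 : 0 < C * gamma ^+ 4 by rewrite mulr_gt0 // exprn_gt0.
have d1 : d <= 1 by rewrite ge_min lexx.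
have d2 : 12 * 28 * (C * gamma ^+ 3) * d <= d0.
  have h : 0 < 12 * 28 * (C * gamma ^+ 3) by lra.
  by rewrite -ler_pdivlMl // mulrC !ge_min lexx !orbT.
have d3 : 52 * 28 * (C * gamma ^+ 4) * d <= k.
  have h : 0 < 52 * 28 * (C * gamma ^+ 4) by lra.
  by rewrite -ler_pdivlMl // mulrC !ge_min lexx !orbT.
have d3' : 52 * 28 * (C * gamma ^+ 3) * d * gamma <= k by move: d3; rewrite [gamma ^+ 4]exprSr; lra.
have dpos : 0 < d by exact: lt_le_trans Dd.
have d4 : 52 * 28 * (C * gamma ^+ 3) * d <= 1.
  apply: le_trans k1; apply: le_trans d3'; rewrite ler_peMr //.
  by apply: mulr_ge0; [apply: mulr_ge0; [lra|exact: ltW]|exact: ltW].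
(* Scaled by the smaller diameter, so that points with direction coordinates up to 3 stay inside
   both triangles. *)
pose rho := Num.min D D' / (8 * gamma).
have g80 : 0 < 8 * gamma by rewrite mulr_gt0.
have r0 : 0 < rho by rewrite divr_gt0 // lt_min D0.
have rD : 8 * gamma * rho <= D by rewrite mulrC divfK ?gt_eqF // ge_min lexx.
have rD' : 8 * gamma * rho <= D' by rewrite mulrC divfK ?gt_eqF // ge_min lexx orbT.
have r8 : 8 * rho <= 8 * gamma * rho by rewrite ler_pM2r //; clear -g1; lra.
clearbody rho d.
pose y := o + (rho * a / enorm u) *: u + (rho * b / enorm v) *: v.
have yE : y - o = rho *: (a *: unitv u + b *: unitv v).
  by rewrite /y /unitv; apply: rV3P; rewrite !mxE; ring.
have ab4 : rho * a / enorm u + rho * b / enorm v < 1.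
  have t1 := scaled_coord_le g0 r0 u0 (ler0n R 2) Du rD a2.
  have t2 := scaled_coord_le g0 r0 v0 (ler0n R 2) Dv rD b2.
  by apply: le_lt_trans (lerD t1 t2) _; clear; lra.
have al0 : 0 < rho * a / enorm u by rewrite divr_gt0 // mulr_gt0.
have be0 : 0 < rho * b / enorm v by rewrite divr_gt0 // mulr_gt0.
have Ty : tri o u v y by exists (rho * a / enorm u), (rho * b / enorm v); split=> //; exact: ltW.
have yo : enorm (y - o) <= 4 * rho.
  rewrite yE enormZ gtr0_norm // mulrC ler_wpM2r ?(ltW r0) //.
  apply: le_trans (enormD _ _) _; rewrite (enormZ a) (enormZ b) e1 f1 !gtr0_norm //; clear -a2 b2; lra.
have [Gz [dd yz dmin]] := hpr y (Th y Ty).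
set z := pr y in Gz yz; set n := nu z in yz.
have n1 : dot n n = 1 by exact: nu1.
have en1 : enorm n = 1 by apply/enorm_unit.
have dd4 := le_trans (dmin o Go) yo.
have oz : enorm (o - z) <= 8 * rho.
  have -> : o - z = (y - z) - (y - o) by apply: rV3P; rewrite !mxE; ring.
  apply: le_trans (enormD _ _) _; rewrite enormN.
  have -> : y - z = dd *: n by rewrite {1}yz addrC addKr.
  by rewrite enormZ en1 mulr1; move: dd4 yo; clear; lra.
have r8D : 8 * rho <= D by exact: le_trans rD.
have r8D' : 8 * rho <= D' by exact: le_trans rD'.
have ozD := le_trans oz r8D.
have ozD' := le_trans oz r8D'.
have nC w : G w -> `|dot n (w - z)| <= C * enorm (w - z) ^+ 2 by move=> Gw; exact: nuC.
have nue : `|dot n (unitv u)| <= 5 * C * gamma * D by exact: (normal_edge C0 g1 (nC _ Gu) (nC _ Go)).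
have nuf : `|dot n (unitv v)| <= 5 * C * gamma * D by exact: (normal_edge C0 g1 (nC _ Gv) (nC _ Go)).
have nue' : `|dot n (unitv u')| <= 5 * C * gamma * D' by exact: (normal_edge C0 g1 (nC _ Gu') (nC _ Go)).
have nuf' : `|dot n (unitv v')| <= 5 * C * gamma * D' by exact: (normal_edge C0 g1 (nC _ Gv') (nC _ Go)).
have noz x : 8 * rho <= x -> `|dot n (o - z)| <= C * (8 * rho * x).
  move=> rx; apply: le_trans (nC _ Go) _; rewrite ler_wpM2l ?(ltW C0) // expr2.
  by apply: ler_pM; rewrite ?enorm_ge0 //; exact: le_trans oz rx.
have gg3 : gamma <= gamma ^+ 3.
  by rewrite exprS ler_peMr ?(ltW g0) // exprn_ege1.
have g31 : 1 <= gamma ^+ 3 by rewrite exprn_ege1.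
(* [y = z + dd n] lies over the foot point [z]; its height [dd] is quadratically small. *)
have ddB : `|dd| <= 28 * (C * gamma ^+ 3) * d * rho.
  have e : dd = dot n (y - o) + dot n (o - z).
    have -> : dot n (y - o) + dot n (o - z) = dot n (dd *: n).
      by rewrite -dotDr; congr (dot _ _); rewrite {1}yz; apply: rV3P; rewrite !mxE; ring.
    by rewrite dotZr n1 mulr1.
  have b1 : `|dot n (y - o)| <= rho * (20 * C * gamma * D).
    rewrite yE dotZr normrM (gtr0_norm r0) ler_wpM2l ?(ltW r0) // dotDr (dotZr a) (dotZr b).
    apply: le_trans (ler_normD _ _) _; rewrite (normrM a) (normrM b) (gtr0_norm a0) (gtr0_norm b0).
    have t1 := ler_pM (ltW a0) (normr_ge0 _) a2 nue.
    have t2 := ler_pM (ltW b0) (normr_ge0 _) b2 nuf.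
    by apply: le_trans (lerD t1 t2) _; clear; lra.
  have b3 := noz D r8D.
  have c1 : gamma * D <= gamma ^+ 3 * d by apply: ler_pM => //; exact: ltW.
  have c2 : D <= gamma ^+ 3 * d.
    by apply: le_trans c1; rewrite ler_peMl // ltW.
  have Cr : 0 <= C * rho by rewrite mulr_ge0 // ltW.
  have c1' := ler_wpM2l Cr c1; have c2' := ler_wpM2l Cr c2.
  rewrite e; apply: le_trans (ler_normD _ _) _.
  by move: b1 b3 c1' c2'; clear; lra.
set m := unitv (cross (unitv u') (unitv v')).
have [mm me mf] := unitv_cross g0 fr'; rewrite -/m in mm me mf.
have em1 : enorm m = 1 by apply/enorm_unit.
have def := normal_defect g0 fr' n1 nue' nuf'; rewrite -/m in def.
have span w := frame_span (w := w) g0 fr'; rewrite -/m in span.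
clearbody m.
pose q := 20 * (C * gamma ^+ 3) * D'.
have q0 : 0 <= q by rewrite /q !mulr_ge0 // ltW.
have {}def : 1 - dot n m ^+ 2 <= q ^+ 2.
  apply: le_trans def _; rewrite le_eqVlt; apply/orP; left; apply/eqP; rewrite /q; ring.
have qd : q <= 20 * (C * gamma ^+ 3) * d by rewrite /q ler_wpM2l // mulr_ge0 // ltW.
have q12 : q <= 1 / 2 by apply: le_trans qd _; move: d4; clear; lra.
(* The normal at the foot point is transversal to the plane of the second triangle, so the line
   through [z] along [n] meets this plane. *)
have nm : 1 / 2 <= `|dot n m|.
  have : (1 / 2) ^+ 2 <= `|dot n m| ^+ 2 by rewrite real_normK ?num_real //; move: q0 q12 def; clear; nra.
  by rewrite ler_sqr ?nnegrE.
have nm0 : dot n m != 0 by rewrite -normr_gt0; apply: lt_le_trans nm; clear; lra.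
pose s := dot (o - z) m / dot n m.
pose y' := z + s *: n.
have y'm : dot (y' - o) m = 0.
  have -> : y' - o = s *: n - (o - z) by rewrite /y'; apply: rV3P; rewrite !mxE; ring.
  by rewrite dotBl dotZl /s divfK // subrr.
have sB : `|s| <= 12 * 28 * (C * gamma ^+ 3) * d * rho.
  pose r := m - dot n m *: n.
  have er : enorm r <= q.
    rewrite enorm_le //; apply: le_trans def; rewrite /r dotBl !dotBr !dotZl !dotZr n1 mm (dotC m n).
    by rewrite le_eqVlt; apply/orP; left; apply/eqP; ring.
  have e : dot (o - z) m = dot n m * dot n (o - z) + dot (o - z) r.
    by rewrite /r (dotBr m) (dotZr (dot n m)) (dotC n (o - z)); ring.
  have b3 := noz D' r8D'.
  have nmle : `|dot n m| <= 1.
    by have := dot_le n m; rewrite en1 em1 mulr1.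
  have b4 : `|dot (o - z) m| <= C * (8 * rho * D') + 8 * rho * q.
    rewrite e; apply: le_trans (ler_normD _ _) _; apply: lerD.
      by rewrite normrM; apply: le_trans b3; rewrite ler_piMl.
    by apply: le_trans (dot_le _ _) _; apply: ler_pM; rewrite ?enorm_ge0.
  have c2 : D' <= gamma ^+ 3 * d.
    by apply: le_trans D'd _; rewrite ler_peMl // ltW.
  have Cr : 0 <= C * rho by rewrite mulr_ge0 // ltW.
  have c2' := ler_wpM2l Cr c2; have qd' := ler_wpM2r (ltW r0) qd.
  rewrite /s normrM normfV ler_pdivrMr ?normr_gt0 //.
  apply: le_trans b4 _.
  have X0 : 0 <= 12 * 28 * (C * gamma ^+ 3) * d * rho by rewrite !mulr_ge0 // ltW.
  by move: (ler_wpM2l X0 nm) c2' qd'; clear; lra.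
have yy' : enorm (y' - y) <= rho * (k / (4 * gamma)).
  have -> : y' - y = (s - dd) *: n by rewrite {1}yz /y'; apply: rV3P; rewrite !mxE; ring.
  rewrite enormZ en1 mulr1; apply: le_trans (ler_normB _ _) _.
  have t : 13 * 28 * (C * gamma ^+ 3) * d <= k / (4 * gamma).
    by rewrite ler_pdivlMr ?mulr_gt0 //; move: d3'; clear; lra.
  by move: (ler_wpM2l (ltW r0) t) sB ddB; clear; lra.
have sd0 : `|s| <= d0.
  apply: le_trans sB _; apply: le_trans d2.
  have rho1 : rho <= 1.
    by move: r8D Dd d1 r0; clear; lra.
  rewrite ler_piMr // !mulr_ge0 // ltW //.
have [a1 [b1 w1E]] : exists a1 b1, rho^-1 *: (y' - o) = a1 *: unitv u' + b1 *: unitv v'.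
  by apply: span; rewrite dotZl y'm mulr0.
(* One half of this bound comes from the displacement, the other from [close]. *)
have wB : enorm ((a1 - a') *: unitv u' + (b1 - b') *: unitv v') <= k / (2 * gamma).
  have -> : (a1 - a') *: unitv u' + (b1 - b') *: unitv v' =
     rho^-1 *: (y' - y) + ((a *: unitv u + b *: unitv v) - (a' *: unitv u' + b' *: unitv v')).
    have -> : rho^-1 *: (y' - y) = rho^-1 *: (y' - o) - rho^-1 *: (y - o).
      by rewrite -scalerBr; congr (_ *: _); apply: rV3P; rewrite !mxE; ring.
    rewrite w1E yE (scalerA rho^-1 rho) mulVf ?gt_eqF // scale1r.
    by apply: rV3P; rewrite !mxE; ring.
  apply: le_trans (enormD _ _) _.
  have h1 : enorm (rho^-1 *: (y' - y)) <= k / (4 * gamma).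
    by rewrite enormZ gtr0_norm ?invr_gt0 // ler_pdivrMl.
  apply: le_trans (lerD h1 close) _.
  by rewrite le_eqVlt; apply/orP; left; apply/eqP; field; rewrite gt_eqF.
have [ca cb] := frame_coord (a1 - a') (b1 - b') g0 fr'.
have gk : gamma * (k / (2 * gamma)) = k / 2 by field; rewrite gt_eqF.
have {}ca : `|a1 - a'| <= k / 2 by apply: le_trans ca _; rewrite -gk ler_wpM2l // ltW.
have {}cb : `|b1 - b'| <= k / 2 by apply: le_trans cb _; rewrite -gk ler_wpM2l // ltW.
move: ca cb; rewrite !ler_distl => /andP[ca1 ca2] /andP[cb1 cb2].
have y'E : y' = o + (rho * a1 / enorm u') *: u' + (rho * b1 / enorm v') *: v'.
  have -> : y' = o + rho *: (rho^-1 *: (y' - o)).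
    by rewrite (scalerA rho) mulfV ?gt_eqF // scale1r subrKC.
  by rewrite w1E /unitv; apply: rV3P; rewrite !mxE; ring.
have Ty' : tri o u' v' y'.
  exists (rho * a1 / enorm u'), (rho * b1 / enorm v'); split=> //.
  - by rewrite divr_ge0 ?enorm_ge0 // mulr_ge0 ?(ltW r0) //; clear -ca1 ca2 ak' k0; lra.
  - by rewrite divr_ge0 ?enorm_ge0 // mulr_ge0 ?(ltW r0) //; clear -cb1 cb2 bk' k0; lra.
  - have a13 : a1 <= 3 by clear -ca1 ca2 a2' k1; lra.
    have b13 : b1 <= 3 by clear -cb1 cb2 b2' k1; lra.
    have t1 := scaled_coord_le g0 r0 u0' (ler0n R 3) Du' rD' a13.
    have t2 := scaled_coord_le g0 r0 v0' (ler0n R 3) Dv' rD' b13.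
    by apply: le_trans (lerD t1 t2) _; clear; lra.
have y'y : y' = y.
  apply: (inj _ _ (Th' _ Ty') (Th _ Ty)).
  by apply: tube => //; exact: Th'.
exists (rho * a / enorm u), (rho * b / enorm v); split=> //.
by rewrite -/y -y'y.
Qed.

End Overlap.

(** * The star of a vertex *)

Section Star.
Variable R : realType.
Implicit Type S : surface_data R.

Lemma tubular_surface S hstar gamma M (m : mesh R M) t C d0 :
  evolving_surface S -> triangulation S hstar gamma m -> time_set S t ->
  (forall t x y, time_set S t -> Gamma S t x -> Gamma S t y ->
    `|dot (nu S (x, t)) (y - x)| <= C * enorm (y - x) ^+ 2) ->
  (forall t z s, time_set S t -> Gamma S t z -> `|s| <= d0 ->
    signed_dist (Gamma S t) (z + s *: nu S (z, t)) = s) ->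
  tubular C d0 (Gamma S t) (fun z => nu S (z, t)) (Gamma_h S m t) (fun y => Defs.proj S (y, t)).
Proof.
move=> surf tri tt hC htube; split.
- by move=> z Gz; apply: normal_unit.
- by move=> z w; exact: hC.
- move=> y Gy; have yN := tr_nbh tri tt Gy.
  have /(es_proj surf tt yN)[Gp yE] : Defs.proj S (y, t) = Defs.proj S (y, t) by [].
  split=> //; exists (signed_dist (Gamma S t) y) => // w Gw.
  rewrite /signed_dist; set r := inf _.
  have r0 : 0 <= r.
    apply: lb_le_inf; first by exists (enorm (y - w)), w.
    by move=> _ [z _ <-]; exact: enorm_ge0.
  have rw : r <= enorm (y - w).
    by apply: ge_inf; [exists 0 => _ [z _ <-]; exact: enorm_ge0|exists w].
  rewrite /=; case: ifP => _; last by rewrite ger0_norm.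
  by rewrite ler0_norm ?oppr_le0 // opprK.
- move=> z s Gz hs Gy; have yN := tr_nbh tri tt Gy.
  apply/esym/(es_proj surf tt yN); split=> //.
  by rewrite htube.
- move=> y y' Gy Gy' E; have [[_ inj _] _ _] := tr_homeo tri tt.
  exact: (inj y y' (mem_set Gy) (mem_set Gy') E).
Qed.

Lemma plane_coord_unique (u v : 'rV[R]_3) a b a' b' : cross u v != 0 ->
  a *: u + b *: v = a' *: u + b' *: v -> a = a' /\ b = b'.
Proof.
move=> N0 h; split.
- have : cross (a *: u + b *: v - (a' *: u + b' *: v)) v = 0.
    by rewrite h subrr; apply: rV3P; rewrite !rv3E; ring.
  have -> : cross (a *: u + b *: v - (a' *: u + b' *: v)) v = (a - a') *: cross u v.
    by apply: rV3P; rewrite !rv3E; ring.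
  by move/eqP; rewrite scaler_eq0 (negPf N0) orbF subr_eq0 => /eqP.
- have : cross u (a *: u + b *: v - (a' *: u + b' *: v)) = 0.
    by rewrite h subrr; apply: rV3P; rewrite !rv3E; ring.
  have -> : cross u (a *: u + b *: v - (a' *: u + b' *: v)) = (b - b') *: cross u v.
    by apply: rV3P; rewrite !rv3E; ring.
  by move/eqP; rewrite scaler_eq0 (negPf N0) orbF subr_eq0 => /eqP.
Qed.

Section FixedMesh.
Variables (S : surface_data R) (hstar gamma : R) (M : nat) (m : mesh R M) (t : R).
Hypothesis surf : evolving_surface S.
Hypothesis g0 : 0 < gamma.
Hypothesis trm : triangulation S hstar gamma m.
Hypothesis tt : time_set S t.

Local Notation x := (vtx S m t).
Local Notation nx i := (next (nbrs m i)).
Local Notation star i j := [set i; j; next (nbrs m i) j]%SET.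

Lemma vtx_Gamma i : Gamma S t (x i).
Proof. by exists (vtx0 m i) => //; exact: (tr_vtx0 trm). Qed.

Lemma star_tris i j : j \in nbrs m i -> star i j \in tris m.
Proof.
move=> ji.
have : star i j \in [set [set i; j; nx i j]%SET | j in nbrs m i]%SET.
  by apply/imsetP; exists j.
by rewrite -(tr_nbrs_tris trm) finset.inE => /andP[].
Qed.

Lemma star_neq i j : j \in nbrs m i -> [/\ i != j, i != nx i j & j != nx i j].
Proof. by move=> ji; apply: card_set3; exact: (tr_card trm (star_tris ji)). Qed.

(** The list has as many entries as there are triangles at [i], and it is mapped onto these
    triangles. *)
Lemma star_inj i : {in nbrs m i &, injective (fun j => star i j)}.
Proof.
apply/imset_injP; rewrite -(tr_nbrs_tris trm) -(tr_nbrs_size trm).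
by have /card_uniqP -> := tr_nbrs_uniq trm i.
Qed.

Lemma next_mem i j : j \in nbrs m i -> nx i j \in nbrs m i.
Proof. by rewrite mem_next. Qed.

Lemma nbrs_nonempty i : exists j, j \in nbrs m i.
Proof.
have [K Km iK] := tr_cover trm i.
have : K \in [set K in tris m | i \in K]%SET by rewrite finset.inE Km.
by rewrite (tr_nbrs_tris trm) => /imsetP[j ji _]; exists j.
Qed.

Definition tdiam i j := diam (hull x (star i j)).

Lemma star_shape i j : j \in nbrs m i ->
  shape gamma (tdiam i j) (x j - x i) (x (nx i j) - x i).
Proof.
move=> ji; have [ij ik jk] := star_neq ji; have Km := star_tris ji.
by apply: triangle_shape => //; [exact: (tr_nondeg trm)|exact: (tr_regular trm)].
Qed.

Lemma star_hull i j y : j \in nbrs m i ->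
  tri (x i) (x j - x i) (x (nx i j) - x i) y -> hull x (star i j) y.
Proof. by move=> ji hy; have [ij ik jk] := star_neq ji; apply/hull3P. Qed.

Lemma star_Gamma_h i j y : j \in nbrs m i ->
  tri (x i) (x j - x i) (x (nx i j) - x i) y -> Gamma_h S m t y.
Proof. by move=> ji hy; exists (star i j); [exact: star_tris|exact: star_hull]. Qed.

(** By conformity the point would lie in the hull of the common vertices. Its barycentric
    coordinates in the first triangle are unique and positive at [j] and at the successor of [j], so
    both are common vertices, and the triangles coincide. *)
Lemma no_overlap i j j' al be : j \in nbrs m i -> j' \in nbrs m i -> j != j' ->
  0 < al -> 0 < be -> al + be < 1 ->
  ~ tri (x i) (x j' - x i) (x (nx i j') - x i)
      (x i + al *: (x j - x i) + be *: (x (nx i j) - x i)).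
Proof.
move=> ji j'i jj' al0 be0 ab1 h'.
have [ij ik jk] := star_neq ji.
set y := x i + _ + _ in h'.
have hy : hull x (star i j) y.
  by apply: star_hull => //; exists al, be; split=> //; exact: ltW.
have : (hull x (star i j) `&` hull x (star i j')) y by split=> //; exact: star_hull.
rewrite (tr_conform trm tt (star_tris ji) (star_tris j'i)) => -[w [w0 w1 yE]].
(* The weights on the common vertices, extended by 0 to the other vertices of the first triangle. *)
pose w' l := if l \in star i j' then w l else 0.
have sumw (V : nmodType) (F : 'I_M -> V) (F' : 'I_M -> V) :
    (forall l, l \in star i j' -> F' l = F l) -> (forall l, l \notin star i j' -> F' l = 0) ->
    \sum_(l in star i j :&: star i j') F l = \sum_(l in star i j) F' l.
  move=> h1 h2; rewrite [RHS](bigID (mem (star i j'))) /=.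
  rewrite [X in _ = _ + X]big1 ?addr0; last by move=> l /andP[_ /h2].
  apply: eq_big => [l|l]; first by rewrite finset.inE.
  by rewrite finset.inE => /andP[_ /h1].
rewrite (sumw _ _ w') in w1; first last.
- by move=> l /negPf h; rewrite /w' h.
- by move=> l h; rewrite /w' h.
rewrite (sumw _ _ (fun l => w' l *: x l)) in yE; first last.
- by move=> l /negPf h; rewrite /w' h scale0r.
- by move=> l h; rewrite /w' h.
rewrite !sum_set3 // in w1 yE.
have N0 : cross (x j - x i) (x (nx i j) - x i) != 0.
  by apply: (tr_nondeg trm tt); exact: star_tris.
have [alE beE] : al = w' j /\ be = w' (nx i j).
  apply: (plane_coord_unique N0).
  have wi : w' i = 1 - w' j - w' (nx i j) by rewrite -w1; ring.
  have : y - x i = y - x i by [].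
  rewrite {2}yE wi /y => h.
  have -> : al *: (x j - x i) + be *: (x (nx i j) - x i) =
      x i + al *: (x j - x i) + be *: (x (nx i j) - x i) - x i.
    by rewrite -(addrA (x i)) (addrC (x i)) addrK.
  by rewrite h; apply: rV3P; rewrite !mxE; ring.
have sub : star i j \subset star i j'.
  apply/fintype.subsetP => l; rewrite !finset.inE -orbA => /or3P[] /eqP ->.
  - by rewrite eqxx.
  - have : w' j != 0 by rewrite -alE gt_eqF.
    by rewrite /w' !finset.inE; case: ifP => //; rewrite eqxx.
  - have : w' (nx i j) != 0 by rewrite -beE gt_eqF.
    by rewrite /w' !finset.inE; case: ifP => //; rewrite eqxx.
have : star i j == star i j'.
  by rewrite eqEcard sub (tr_card trm (star_tris ji)) (tr_card trm (star_tris j'i)).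
by move/eqP/(star_inj ji j'i)/eqP; rewrite (negPf jj').
Qed.

Lemma star_overlap C d0 k i j j' a b a' b' :
  0 < C -> 0 < d0 -> 0 < k <= 1 ->
  tubular C d0 (Gamma S t) (fun z => nu S (z, t)) (Gamma_h S m t) (fun y => Defs.proj S (y, t)) ->
  j \in nbrs m i -> j' \in nbrs m i -> j != j' ->
  tdiam i j <= overlap_size C d0 gamma k -> tdiam i j' <= overlap_size C d0 gamma k ->
  0 < a <= 2 -> 0 < b <= 2 -> k <= a' <= 2 -> k <= b' <= 2 ->
  ~ enorm ((a *: unitv (x j - x i) + b *: unitv (x (nx i j) - x i)) -
           (a' *: unitv (x j' - x i) + b' *: unitv (x (nx i j') - x i)))
    <= k / (4 * gamma).
Proof.
move=> C0 d00 k01 tub ji j'i jj' hj hj' ha hb ha' hb' close.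
have G l : Gamma S t (x i + (x l - x i)) by rewrite subrKC; exact: vtx_Gamma.
have [||al [be [al0 be0 ab ov]]] := overlap C0 d00 g0 k01 tub (vtx_Gamma i) (G j) (G (nx i j))
  (G j') (G (nx i j')) _ _ (star_shape ji) (star_shape j'i) hj hj' ha hb ha' hb' close.
- by move=> y; exact: star_Gamma_h.
- by move=> y; exact: star_Gamma_h.
exact: (no_overlap ji j'i jj' al0 be0 ab ov).
Qed.

Lemma tdiam_edge i j : j \in nbrs m i -> tdiam i (nx i j) <= gamma * tdiam i j.
Proof.
move=> ji; have h1 := shape_edge g0 (star_shape (next_mem ji)).
have [_ _ h2 _ _] := star_shape ji.
by apply: le_trans h1 _; rewrite ler_wpM2l // ltW.
Qed.

Lemma nbrs_from i j : j \in nbrs m i -> exists q : seq 'I_M,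
  [/\ nth j q 0 = j, uniq q, q =i nbrs m i &
    forall l, (l.+1 < size q)%N -> nth j q l.+1 = nx i (nth j q l)].
Proof.
move=> ji; have [r q E] := rot_to ji; have U := tr_nbrs_uniq trm i.
have Uq : uniq (j :: q) by rewrite -E rot_uniq.
exists (j :: q); split=> // [l|l hl]; first by rewrite -E mem_rot.
rewrite -(next_rot r U) E next_nth mem_nth; last exact: ltn_trans hl.
by rewrite index_uniq //; exact: ltn_trans hl.
Qed.

Lemma star_induction (P : 'I_M -> Prop) i j : j \in nbrs m i -> P j ->
  (forall k, k \in nbrs m i -> P k -> P (nx i k)) -> forall k, k \in nbrs m i -> P k.
Proof.
move=> ji Pj step k; have [q [q0 Uq qE qn]] := nbrs_from ji.
rewrite -qE => kq; rewrite -(nth_index j kq).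
have : (index k q < size q)%N by rewrite index_mem.
elim: (index k q) => [|l IH] hl; first by rewrite q0.
rewrite qn //; apply: step; last by apply: IH; exact: ltnW.
by rewrite -qE mem_nth // ltnW.
Qed.

End FixedMesh.
End Star.

(** * Comparable triangle sizes in a star *)

Section StarRatio.
Variable R : realType.
Implicit Type S : surface_data R.

(** Pigeonhole: a cube of side 4 is cut into cells of side [r / 3], and two vectors in one cell have
    distance at most [r], the sum of three coordinate differences. *)
Lemma separated_bound (r : R) : 0 < r -> exists P : nat,
  forall (I : eqType) (s : seq I) (f : I -> 'rV[R]_3), uniq s ->
    (forall i k, i \in s -> `|f i 0 k| <= 2) ->
    (forall i j, i \in s -> j \in s -> i != j -> ~ enorm (f i - f j) <= r) ->
    (size s <= P)%N.
Proof.
move=> r0; pose h := r / 3; have h0 : 0 < h by rewrite divr_gt0.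
pose N := (Num.truncn (4 / h)).+1.
pose T : finType := ('I_N * 'I_N * 'I_N)%type.
exists #|T| => I s f Us fb sep.
pose z i k := (f i 0 k + 2) / h.
have zb i k : i \in s -> 0 <= z i k <= 4 / h.
  move=> /fb-/(_ k); rewrite ler_norml => /andP[h1 h2].
  by rewrite divr_ge0 ?(ltW h0) //= ?ler_pM2r ?invr_gt0 //; lra.
pose cl i k : 'I_N := inord (Num.truncn (z i k)).
have clE i j k : i \in s -> j \in s -> cl i k = cl j k -> `|(f i - f j) 0 k| <= h.
  move=> si sj E; have /andP[zi0 zi4] := zb i k si; have /andP[zj0 zj4] := zb j k sj.
  have E' : Num.truncn (z i k) = Num.truncn (z j k).
    by move/(congr1 val): E; rewrite /= !inordK // ltnS le_truncn.
  have /andP[i1 i2] := truncn_itv zi0; have /andP[j1 j2] := truncn_itv zj0.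
  rewrite E' in i1 i2.
  have : `|z i k - z j k| <= 1.
    move: i1 i2 j1 j2; rewrite -natr1 => i1 i2 j1 j2; rewrite ler_norml; lra.
  have -> : z i k - z j k = (f i - f j) 0 k / h by rewrite /z !mxE; field; rewrite gt_eqF.
  by rewrite normrM normfV (gtr0_norm h0) ler_pdivrMr // mul1r.
pose c i : T := (cl i 0, cl i 1, cl i 2%:R).
have Uc : uniq (map c s).
  rewrite map_inj_in_uniq // => i j si sj [E0 E1 E2]; apply: contraPeq (sep i j si sj) => ij /(_ ij).
  apply; apply: le_trans (enorm_sum_le _) _.
  have := clE _ _ _ si sj E0; have := clE _ _ _ si sj E1; have := clE _ _ _ si sj E2.
  rewrite /h; lra.
by rewrite -(size_map c) -(card_uniqP Uc) max_card.
Qed.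

Lemma tdiam_bound S hstar gamma M (m : mesh R M) t B i j :
  evolving_surface S -> 0 < gamma -> triangulation S hstar gamma m -> time_set S t ->
  (forall X t, Gamma0 S X -> time_set S t -> `|Phi S (X, t)| <= B) ->
  j \in nbrs m i -> tdiam S m t i j <= 6 * gamma * B.
Proof.
move=> surf g0 trm tt hB ji; have sh := star_shape g0 trm tt ji.
have h1 := shape_edge g0 sh.
have h2 : enorm (vtx S m t j - vtx S m t i) <= 6 * B.
  apply: le_trans (enorm_le_norm _) _.
  have hi := hB _ _ (tr_vtx0 trm i) tt; have hj := hB _ _ (tr_vtx0 trm j) tt.
  by have := ler_normB (vtx S m t j) (vtx S m t i); rewrite /vtx in hi hj *; lra.
by apply: le_trans h1 _; have := ler_wpM2l (ltW g0) h2; lra.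
Qed.

(** The size grows by at most a fixed factor from one triangle to the next, but the number of steps
    is not bounded in advance. Among [P + 1] successive triangles not all are small, since otherwise
    their direction sums would be separated. So within [P] steps from [j'] either [j] or a triangle
    larger than [d] is met, and no triangle exceeds [D]. *)
Lemma star_ratio S hstar gamma C d0 : evolving_surface S -> 0 < gamma -> 0 < C -> 0 < d0 ->
  exists2 k, 0 < k & forall M (m : mesh R M) t i j j',
    triangulation S hstar gamma m -> time_set S t ->
    tubular C d0 (Gamma S t) (fun z => nu S (z, t)) (Gamma_h S m t) (fun y => Defs.proj S (y, t)) ->
    j \in nbrs m i -> j' \in nbrs m i -> tdiam S m t i j <= k * tdiam S m t i j'.
Proof.
move=> surf g0 C0 d00; have [B B0 hB] := Phi_bounded surf.
have r0 : 0 < 1 / (4 * gamma) by rewrite divr_gt0 // mulr_gt0.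
have [P hP] := separated_bound r0.
pose d := overlap_size C d0 gamma 1.
have dp : 0 < d by exact: overlap_size_gt0.
pose D := 6 * gamma * B; have Dp : 0 < D by rewrite !mulr_gt0.
pose G := Num.max 1 gamma.
have G1 : 1 <= G by rewrite le_max lexx.
have Gp : 0 < G by exact: lt_le_trans G1.
(* [G ^+ P] accounts for the walk, [D / d] for the comparison with a triangle larger than [d]. *)
exists (G ^+ P * (1 + D / d)).
  by rewrite mulr_gt0 ?exprn_gt0 // addr_gt0 // divr_gt0.
move=> M m t i j k trm tt tub ji ki.
have [q [q0 Uq qE qn]] := nbrs_from trm ki.
have qmem l : (l < size q)%N -> nth k q l \in nbrs m i by move=> hl; rewrite -qE mem_nth.
have td0 l : l \in nbrs m i -> 0 < tdiam S m t i l.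
  by move=> li; have [h _ _ _ _] := star_shape g0 trm tt li.
have grow l : (l < size q)%N -> tdiam S m t i (nth k q l) <= G ^+ l * tdiam S m t i k.
  elim: l => [|l IH] hl; first by rewrite q0 expr0 mul1r.
  rewrite qn //; have hl' := ltnW hl.
  apply: le_trans (tdiam_edge g0 trm tt (qmem _ hl')) _.
  rewrite exprS -mulrA; apply: ler_pM => //; last exact: IH.
  - exact: ltW.
  - by apply: ltW; apply: td0; exact: qmem.
  - by rewrite le_max lexx orbT.
have [n hn jE] : exists2 n, (n < size q)%N & j = nth k q n.
  by exists (index j q); rewrite ?index_mem ?nth_index ?qE.
have tk := td0 _ ki.
have bound l : (l < size q)%N -> (l <= P)%N -> tdiam S m t i (nth k q l) <= G ^+ P * tdiam S m t i k.
  move=> hl lP; apply: le_trans (grow l hl) _; rewrite ler_wpM2r ?(ltW tk) //.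
  by rewrite ler_weXn2l.
have e0 : 0 <= D / d by rewrite divr_ge0 ?ltW.
have GP : 0 < G ^+ P by rewrite exprn_gt0.
rewrite mulrAC mulrDr mulr1.
have GPt : 0 < G ^+ P * tdiam S m t i k by rewrite mulr_gt0.
have [nP|Pn] := leqP n P.
  rewrite jE; apply: le_trans (bound n hn nP) _.
  by rewrite lerDl mulr_ge0 // ltW.
have [l [hl lP big]] : exists l, [/\ (l < size q)%N, (l <= P)%N & d < tdiam S m t i (nth k q l)].
  apply: contrapT => /forallNP no.
  pose s := take P.+1 q.
  have sq : size s = P.+1 by rewrite size_takel // (leq_trans Pn) // ltnW.
  have small l : l \in s -> l \in nbrs m i /\ tdiam S m t i l <= d.
    move=> ls; have hl : (index l s < P.+1)%N by rewrite -sq index_mem.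
    have hq : (index l s < size q)%N by rewrite (leq_trans hl) // (leq_trans Pn) // ltnW.
    have lE : l = nth k q (index l s) by rewrite -(nth_take k hl) -/s nth_index.
    rewrite lE; split; first exact: qmem.
    by rewrite leNgt; apply/negP => h; apply: (no (index l s)); rewrite -ltnS.
  have := hP _ s (fun l => unitv (vtx S m t l - vtx S m t i) +
      unitv (vtx S m t (next (nbrs m i) l) - vtx S m t i)).
  rewrite sq ltnn => h; suff : false by []; apply: h.
  - exact: take_uniq.
  - move=> l c /small[li _]; have [_ _ [e1 f1 _]] := shape_frame g0 (star_shape g0 trm tt li).
    move/enorm_unit: e1 => e1; move/enorm_unit: f1 => f1.
    apply: le_trans (coord_le_enorm _ _) _; apply: le_trans (enormD _ _) _.
    by rewrite e1 f1; lra.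
  - move=> l l' /small[li sl] /small[l'i sl'] ll' close.
    have i12 : (0 : R) < (1 : R) <= 2 by rewrite ltr01 ler1n.
    have i11 : (1 : R) <= (1 : R) <= 2 by rewrite lexx ler1n.
    have i01 : (0 : R) < (1 : R) <= 1 by rewrite ltr01 lexx.
    have nov := star_overlap g0 trm tt C0 d00 i01 tub li l'i ll' sl sl' i12 i12 i11 i11.
    by rewrite !scale1r in nov; exact: nov close.
have h1 := bound l hl lP.
have h2 : tdiam S m t i j <= D := tdiam_bound surf g0 trm tt hB ji.
have h3 : D <= G ^+ P * tdiam S m t i k * (D / d).
  rewrite mulrA ler_pdivlMr // mulrC ler_wpM2r ?(ltW Dp) //.
  exact: le_trans (ltW big) h1.
by apply: le_trans h2 _; apply: le_trans h3 _; rewrite lerDr ltW.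
Qed.

End StarRatio.

(** * Orientation of the triangle normals *)

Section Orientation.
Variable R : realType.
Implicit Type S : surface_data R.

(** [normal_defect] bounds 1 - c^2 for the product c of the two unit vectors. After the choice of
    sign c lies in [0, 1], so this dominates 1 - c, and the squared distance is 2 (1 - c). *)
Lemma normal_near (gamma d : R) (e f n : 'rV[R]_3) : 0 < gamma -> frame gamma e f ->
  dot n n = 1 -> `|dot n e| <= d -> `|dot n f| <= d ->
  exists2 s : R, s = 1 \/ s = -1 &
    enorm (unitv (cross e f) - s *: n) <= 8 * gamma ^+ 2 * d.
Proof.
move=> g0 fr n1 ne nf; have [mm _ _] := unitv_cross g0 fr.
have := normal_defect g0 fr n1 ne nf; move: (unitv (cross e f)) mm => m mm def.
have d0 : 0 <= d by exact: le_trans ne.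
have g2 : 0 <= gamma ^+ 2 * d by rewrite mulr_ge0 ?sqr_ge0.
have em1 : enorm m = 1 by apply/enorm_unit.
have en1 : enorm n = 1 by apply/enorm_unit.
have := dot_le n m; rewrite en1 em1 mulr1 ler_norml => /andP[c1 c2].
have fin (s : R) : s ^+ 2 = 1 -> 0 <= s * dot n m ->
    enorm (m - s *: n) <= 8 * gamma ^+ 2 * d.
  move=> s2 sc; rewrite enorm_le; last by rewrite -mulrA mulr_ge0.
  have -> : dot (m - s *: n) (m - s *: n) = 2 - 2 * (s * dot n m).
    rewrite dotBl !dotBr !dotZl !dotZr mm n1 (dotC m n).
    have -> : s * (s * 1) = 1 by rewrite mulr1 -expr2.
    ring.
  have sc1 : s * dot n m <= 1.
    have : (s * dot n m) ^+ 2 <= 1 by rewrite exprMn s2 mul1r; nra.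
    by move: sc; move: (s * dot n m) => z z0 z1; nra.
  have : 1 - s * dot n m <= (4 * gamma ^+ 2 * d) ^+ 2.
    apply: le_trans def; have <- : (s * dot n m) ^+ 2 = dot n m ^+ 2 by rewrite exprMn s2 mul1r.
    by move: sc sc1; move: (s * dot n m) => z z0 z1; nra.
  move: g2; rewrite -!mulrA; move: (gamma ^+ 2 * d) => z z0 h; nra.
have [c0|c0] := leP 0 (dot n m).
  by exists 1; [left|apply: fin; rewrite ?expr1n // mul1r].
by exists (-1); [right|apply: fin; rewrite ?sqrrN ?expr1n // mulN1r; lra].
Qed.

Lemma cross_left (gamma : R) (e f : 'rV[R]_3) : 0 < gamma -> frame gamma e f ->
  cross (unitv (cross e f)) f =
    (enorm (cross e f))^-1 *: (dot e f *: f - e) /\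
  cross (unitv (cross e f)) e =
    (enorm (cross e f))^-1 *: (f - dot e f *: e).
Proof.
move=> g0 [ee ff _]; rewrite /unitv !crossZl; split; congr (_ *: _).
- have -> : cross (cross e f) f = dot e f *: f - dot f f *: e.
    by apply: rV3P; rewrite !rv3E; ring.
  by rewrite ff scale1r.
- have -> : cross (cross e f) e = dot e e *: f - dot e f *: e.
    by apply: rV3P; rewrite !rv3E; ring.
  by rewrite ee scale1r.
Qed.

(* If the normals of the two triangles on both sides of the edge [f] were almost
   opposite, points of both of them close to [f] would almost coincide. *)
Lemma fold_points (gamma : R) (e f h : 'rV[R]_3) : 0 < gamma ->
  frame gamma e f -> frame gamma f h ->
  enorm (unitv (cross e f) + unitv (cross f h)) <= 1 / (4 * gamma) ->
  let k := 1 / (2 * gamma) in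
  exists a b a' b', [/\ [/\ 0 < a <= 2, 0 < b <= 2, k <= a' <= 2 & k <= b' <= 2] &
    enorm ((a *: e + b *: f) - (a' *: f + b' *: h)) <= k / (4 * gamma)].
Proof.
move=> g0 fr fr' close k.
have g1 := frame_gamma_ge1 g0 fr.
have k0 : 0 < k by rewrite divr_gt0 // mulr_gt0.
have k2 : k <= 1 / 2 by rewrite /k ler_pdivrMr ?mulr_gt0 //; lra.
have kg : k * gamma = 1 / 2 by rewrite /k; field; rewrite gt_eqF.
have [s0 s1 c0 c1 s2] := frame_facts g0 fr; have [_ ff gs] := fr.
have [s0' s1' c0' c1' s2'] := frame_facts g0 fr'; have [_ _ gs'] := fr'.
have [E1 _] := cross_left g0 fr; have [_ E2] := cross_left g0 fr'.
have f1 : enorm f = 1 by apply/enorm_unit.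
move: (unitv (cross e f)) (unitv (cross f h)) close E1 E2 => n n' close E1 E2.
set s := enorm (cross e f) in s0 s1 s2 gs E1.
set s' := enorm (cross f h) in s0' s1' s2' gs' E2.
have iv (z : R) : 0 < z -> z <= 1 -> 1 <= gamma * z -> k <= k / z <= 1 / 2.
  move=> z0 z1 gz; rewrite ler_pdivlMr // ler_piMr ?(ltW k0) //=.
  rewrite ler_pdivrMr // -kg -mulrA ler_peMr // ltW //.
have ivc (z c : R) : 0 < z -> z <= 1 -> 1 <= gamma * z -> -1 <= c <= 1 -> `|k * c / z| <= 1 / 2.
  move=> z0 z1 gz hc; have /andP[_ h1] := iv z z0 z1 gz.
  rewrite mulrAC normrM (gtr0_norm (divr_gt0 k0 z0)).
  by apply: le_trans h1; rewrite ler_piMr ?ler_norml // ltW // divr_gt0.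
have /andP[a1 a2] := iv _ s0 s1 gs; have /andP[b1 b2] := iv _ s0' s1' gs'.
have C1 := ivc _ (dot e f) s0 s1 gs ltac:(lra).
have C2 := ivc _ (dot f h) s0' s1' gs' ltac:(lra).
move: C1 C2; rewrite !ler_norml => /andP[C1 C1'] /andP[C2 C2'].
(* The two points are [f] minus [k *: cross n f] and [f] plus [k *: cross n' f], one in the plane of
   each triangle; they differ by a multiple of [cross (n + n') f]. *)
exists (k / s), (1 - k * dot e f / s), (1 - k * dot f h / s'), (k / s').
split; first by clear -k0 k2 a1 a2 b1 b2 C1 C1' C2 C2'; split; apply/andP; split; lra.
have -> : (k / s) *: e + (1 - k * dot e f / s) *: f -
    ((1 - k * dot f h / s') *: f + (k / s') *: h) = (- k) *: cross (n + n') f.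
  rewrite crossDl E1 E2; apply: rV3P; rewrite !mxE; field; rewrite !gt_eqF //.
rewrite enormZ normrN (gtr0_norm k0) ler_wpM2l ?(ltW k0) //.
apply: le_trans (enorm_cross_le _ _) _; rewrite f1 mulr1.
by move: close; rewrite div1r.
Qed.

Section FixedMesh.
Variables (S : surface_data R) (hstar gamma C d0 : R) (M : nat) (m : mesh R M) (t : R).
Hypothesis surf : evolving_surface S.
Hypotheses (g0 : 0 < gamma) (C0 : 0 < C) (d00 : 0 < d0).
Hypothesis trm : triangulation S hstar gamma m.
Hypothesis tt : time_set S t.
Hypothesis tub : tubular C d0 (Gamma S t) (fun z => nu S (z, t)) (Gamma_h S m t)
  (fun y => Defs.proj S (y, t)).

Local Notation x := (vtx S m t).
Local Notation nx i := (next (nbrs m i)).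
Definition edir i j := unitv (x j - x i).
Definition tnormal i j := unitv (cross (edir i j) (edir i (nx i j))).

Lemma star_frame i j : j \in nbrs m i -> frame gamma (edir i j) (edir i (nx i j)).
Proof. by move=> ji; have [_ _] := shape_frame g0 (star_shape g0 trm tt ji). Qed.

Lemma normal_edir i j : j \in nbrs m i -> `|dot (nu S (x i, t)) (edir i j)| <= C * tdiam S m t i j.
Proof.
move=> ji; have [_ nC _ _ _] := tub; have [u0 _ _] := shape_frame g0 (star_shape g0 trm tt ji).
have [D0 uD _ _ _] := star_shape g0 trm tt ji.
have := nC _ _ (vtx_Gamma t trm i) (vtx_Gamma t trm j).
rewrite -enorm_gt0 in u0.
rewrite /edir /unitv dotZr normrM normfV (gtr0_norm u0) => h.
rewrite ler_pdivrMl //; apply: le_trans h _; rewrite expr2 mulrCA.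
by rewrite ler_wpM2l ?(ltW u0) // ler_wpM2l ?(ltW C0).
Qed.

Lemma normal_edir_next i j : j \in nbrs m i ->
  `|dot (nu S (x i, t)) (edir i (nx i j))| <= C * tdiam S m t i j.
Proof.
move=> ji; have [_ nC _ _ _] := tub; have [_ u0 _] := shape_frame g0 (star_shape g0 trm tt ji).
have [D0 _ uD _ _] := star_shape g0 trm tt ji.
have := nC _ _ (vtx_Gamma t trm i) (vtx_Gamma t trm (nx i j)).
rewrite -enorm_gt0 in u0.
rewrite /edir /unitv dotZr normrM normfV (gtr0_norm u0) => h.
rewrite ler_pdivrMl //; apply: le_trans h _; rewrite expr2 mulrCA.
by rewrite ler_wpM2l ?(ltW u0) // ler_wpM2l ?(ltW C0).
Qed.

Lemma tnormal_near i j : j \in nbrs m i -> exists2 s : R, s = 1 \/ s = -1 &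
  enorm (tnormal i j - s *: nu S (x i, t)) <= 8 * gamma ^+ 2 * (C * tdiam S m t i j).
Proof.
move=> ji; have [n1 _ _ _ _] := tub.
apply: normal_near => //; [exact: star_frame|exact: n1 (vtx_Gamma t trm i)| | ].
- exact: normal_edir.
- exact: normal_edir_next.
Qed.

Lemma next_neq i j : j \in nbrs m i -> j != nx i j.
Proof. by move=> ji; have [_ _] := star_neq trm ji. Qed.

(** A change of sign between successive triangles would make their normals nearly opposite, and by
    [fold_points] they would overlap next to their common edge. Hence the sign is passed on around
    the vertex. *)
Lemma star_orientation i :
  (forall j, j \in nbrs m i -> tdiam S m t i j <= overlap_size C d0 gamma (1 / (2 * gamma))) ->
  (forall j, j \in nbrs m i -> 64 * gamma ^+ 3 * (C * tdiam S m t i j) <= 1) ->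
  exists2 s : R, s = 1 \/ s = -1 & forall j, j \in nbrs m i ->
    enorm (tnormal i j - s *: nu S (x i, t)) <= 8 * gamma ^+ 2 * (C * tdiam S m t i j).
Proof.
move=> small1 small2; have [j0 j0i] := nbrs_nonempty trm i.
have [s hs hj0] := tnormal_near j0i; exists s => //.
apply: (star_induction trm j0i) => // j ji hj.
have j'i := next_mem ji.
have [s' hs' hj'] := tnormal_near j'i.
have [E|E] := eqVneq s' s; first by rewrite -E.
have {E} sE : s' = - s.
  by case: hs hs' E => -> [] ->; rewrite ?eqxx ?opprK.
have fr := star_frame ji; have fr' := star_frame j'i.
have hnear : enorm (tnormal i j + tnormal i (nx i j)) <= 1 / (4 * gamma).
  have -> : tnormal i j + tnormal i (nx i j) = (tnormal i j - s *: nu S (x i, t)) +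
      (tnormal i (nx i j) - s' *: nu S (x i, t)).
    by rewrite sE scaleNr opprK addrACA addNr addr0.
  (* By the second smallness condition each normal is within [1 / (8 * gamma)] of its multiple of
     [nu]. *)
  apply: le_trans (enormD _ _) _; apply: le_trans (lerD hj hj') _.
  rewrite ler_pdivlMr ?mulr_gt0 //.
  have := small2 j ji; have := small2 _ j'i; rewrite [gamma ^+ 3]exprS; lra.
have [a [b [a' [b' [[ha hb ha' hb'] close]]]]] := fold_points g0 fr fr' hnear.
have k01 : 0 < 1 / (2 * gamma) <= 1.
  have g1 := frame_gamma_ge1 g0 fr.
  by rewrite divr_gt0 ?mulr_gt0 //= ler_pdivrMr ?mulr_gt0 //; lra.
by have := star_overlap g0 trm tt C0 d00 k01 tub ji j'i (next_neq ji) (small1 _ ji)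
  (small1 _ j'i) ha hb ha' hb'.
Qed.

End FixedMesh.
End Orientation.

(** * Consistency at a vertex *)

Section Vertex.
Variable R : realType.
Implicit Type S : surface_data R.

Lemma seqmax_ge (s : seq R) a : a \in s -> a <= seqmax s.
Proof.
rewrite /seqmax; elim: s => // b s IH; rewrite in_cons big_cons le_max => /orP[/eqP ->|/IH ->].
  by rewrite lexx.
by rewrite orbT.
Qed.

Lemma seqmax_le (s : seq R) b : 0 <= b -> (forall a, a \in s -> a <= b) -> seqmax s <= b.
Proof.
move=> b0; rewrite /seqmax; elim: s => [|c s IH] h; first by rewrite big_nil.
rewrite big_cons ge_max h ?mem_head // IH // => a sa.
by apply: h; rewrite in_cons sa orbT.
Qed.

Lemma seqmin_le (s : seq R) a : a \in s -> seqmin s <= a.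
Proof.
rewrite /seqmin; move: (head 0 s) => z; elim: s => // b s IH.
rewrite in_cons big_cons ge_min => /orP[/eqP ->|/IH ->]; first by rewrite lexx.
by rewrite orbT.
Qed.

Lemma seqmin_ge (s : seq R) b : s != [::] -> (forall a, a \in s -> b <= a) -> b <= seqmin s.
Proof.
move=> s0 h; rewrite /seqmin.
have : b <= head 0 s by case: s s0 h => // c s _ h; apply: h; rewrite mem_head.
move: (head 0 s) => z bz; elim: s h {s0} => [|c s IH] h; first by rewrite big_nil.
rewrite big_cons le_min h ?mem_head // IH // => a sa.
by apply: h; rewrite in_cons sa orbT.
Qed.

Lemma half_tanC (e f : 'rV[R]_3) : half_tan e f = half_tan f e.
Proof. by rewrite /half_tan crossC enormN dotC. Qed.

Lemma frame_sym (gamma : R) (e f : 'rV[R]_3) : frame gamma e f -> frame gamma f e.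
Proof. by case=> ee ff gs; split=> //; rewrite crossC enormN. Qed.

Lemma unitvZ (w : 'rV[R]_3) c : 0 < c -> unitv (c *: w) = unitv w.
Proof.
by move=> c0; rewrite /unitv enormZ gtr0_norm // invfM scalerA mulrAC mulVf ?gt_eqF // mul1r.
Qed.

Lemma dot_translate (o w p q : 'rV[R]_3) l :
  dot (o + w - (o + p)) (l *: q) = l * dot (w - p) q.
Proof. by rewrite opprD addrACA subrr add0r dotZr. Qed.

Section FixedMesh.
Variables (S : surface_data R) (hstar gamma : R) (M : nat) (m : mesh R M) (t : R).
Hypothesis g0 : 0 < gamma.
Hypothesis trm : triangulation S hstar gamma m.
Hypothesis tt : time_set S t.
Variable i : 'I_M.

Local Notation x := (vtx S m t).
Local Notation nx := (next (nbrs m i)).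
Local Notation e := (edir S m t i).
Local Notation D := (tdiam S m t i).

Definition star_tan j := half_tan (e j) (e (nx j)).

Lemma edge_neq0 j : j \in nbrs m i -> 0 < edge_len x i j.
Proof.
by move=> ji; have [u0 _ _] := shape_frame g0 (star_shape g0 trm tt ji); rewrite enorm_gt0.
Qed.

Lemma edge_le j : j \in nbrs m i -> edge_len x i j <= D j.
Proof. by move=> ji; have [_ h _ _ _] := star_shape g0 trm tt ji. Qed.

Lemma edge_edir j : j \in nbrs m i -> x j - x i = edge_len x i j *: e j.
Proof. by move=> ji; rewrite unitvK // -enorm_gt0; exact: edge_neq0. Qed.

Lemma edge_ptE j : j \in nbrs m i -> edge_pt m x i j = x i + vol_dist m x i *: e j.
Proof. by move=> ji; rewrite /edge_pt /edir /unitv scalerA. Qed.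

Lemma sfr j : j \in nbrs m i -> frame gamma (e j) (e (nx j)).
Proof. by move=> ji; exact: (star_frame g0 trm tt ji). Qed.

(** An explicit solution shows that [xget] does not fall back on its default; [corner_unique] then
    identifies the chosen point. *)
Lemma cornerE j : j \in nbrs m i -> corner m x i j (nx j) =
  x i + (vol_dist m x i / (1 + dot (e j) (e (nx j)))) *: (e j + e (nx j)).
Proof.
move=> ji; have j'i := next_mem ji; have fr := sfr ji.
have [ij ik jk] := star_neq trm ji.
have l0 := edge_neq0 ji; have l1 := edge_neq0 j'i.
have [s0 s1 c0 c1 s2] := frame_facts g0 fr; have [ee ff _] := fr.
set d := vol_dist m x i.
have eqv a b : (dot (x i + (a *: e j + b *: e (nx j)) - edge_pt m x i j) (x j - x i) = 0 <->
    dot (a *: e j + b *: e (nx j) - d *: e j) (e j) = 0) /\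
  (dot (x i + (a *: e j + b *: e (nx j)) - edge_pt m x i (nx j)) (x (nx j) - x i) = 0 <->
    dot (a *: e j + b *: e (nx j) - d *: e (nx j)) (e (nx j)) = 0).
  rewrite (edge_ptE ji) (edge_ptE j'i) (edge_edir ji) (edge_edir j'i) !dot_translate.
  split; split=> [/eqP|->]; rewrite ?mulr0 //.
    by rewrite mulf_eq0 (gt_eqF l0) /= => /eqP.
  by rewrite mulf_eq0 (gt_eqF l1) /= => /eqP.
rewrite /corner; case: xgetP => [q _ [/aff3P-/(_ ij ik jk)[a [b qE]] q1 q2]|hno].
  have qE' : q = x i + ((a * edge_len x i j) *: e j + (b * edge_len x i (nx j)) *: e (nx j)).
    by rewrite qE -addrA -!scalerA -!edge_edir.
  rewrite qE' in q1 q2 *; congr (_ + _).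
  have [[h1 _] [h2 _]] := eqv (a * edge_len x i j) (b * edge_len x i (nx j)).
  exact: (corner_unique g0 fr (h1 q1) (h2 q2)).
exfalso; set k := d / (1 + dot (e j) (e (nx j))).
apply: (hno (x i + (k *: e j + k *: e (nx j)))).
have [[_ h1] [_ h2]] := eqv k k.
have kE : k * (1 + dot (e j) (e (nx j))) = d by rewrite divfK // gt_eqF.
split.
- apply/aff3P => //; exists (k / edge_len x i j), (k / edge_len x i (nx j)).
  rewrite (edge_edir ji) (edge_edir j'i) (scalerA (k / edge_len x i j)).
  by rewrite (scalerA (k / edge_len x i (nx j))) !divfK ?gt_eqF // addrA.
- apply: h1; clearbody k.
  rewrite dotBl dotDl (dotZl k) (dotZl k) (dotZl d) ee (dotC (e (nx j))).
  by rewrite -kE; ring.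
- apply: h2; clearbody k.
  by rewrite dotBl dotDl (dotZl k) (dotZl k) (dotZl d) ff -kE; ring.
Qed.

Hypothesis d0 : 0 <= vol_dist m x i.

Lemma len_RE j : j \in nbrs m i -> len_R m x i j = vol_dist m x i * star_tan j.
Proof.
move=> ji; rewrite /len_R cornerE // edge_ptE //.
by rewrite opprD addrACA subrr add0r (corner_len g0 (sfr ji)).
Qed.

(** The left part at the edge to [nx j] lies in the triangle of [j], so it involves the same
    half-angle tangent as the right part at the edge to [j]. *)
Lemma len_LE j : j \in nbrs m i -> len_L m x i (nx j) = vol_dist m x i * star_tan j.
Proof.
move=> ji; have j'i := next_mem ji.
rewrite /len_L (prev_next (tr_nbrs_uniq trm i)) cornerE // edge_ptE //.
rewrite opprD addrACA subrr add0r /star_tan half_tanC.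
have := corner_len g0 (frame_sym (sfr ji)) d0.
by rewrite (dotC (e (nx j))) (addrC (e (nx j))).
Qed.

Lemma piece_areaE j : j \in nbrs m i ->
  piece_area m x i j = vol_dist m x i ^+ 2 * star_tan j.
Proof.
move=> ji; have j'i := next_mem ji; rewrite /piece_area cornerE // !edge_ptE //.
exact: (corner_area (x i) g0 (sfr ji) d0).
Qed.

Lemma star_tan_gt0 j : j \in nbrs m i -> 0 < star_tan j.
Proof. by move=> ji; exact: half_tan_gt0 g0 (sfr ji). Qed.

Definition star_sum := \sum_(j <- nbrs m i) star_tan j.

Lemma vol_areaE : vol_area m x i = vol_dist m x i ^+ 2 * star_sum.
Proof.
rewrite /vol_area /star_sum mulr_sumr big_seq [RHS]big_seq.
by apply: eq_bigr => j ji; exact: piece_areaE.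
Qed.

Lemma star_sum_gt0 : 0 < star_sum.
Proof.
have [j ji] := nbrs_nonempty trm i.
rewrite /star_sum (big_rem j) //= ltr_pwDl ?star_tan_gt0 //.
rewrite big_seq; apply: sumr_ge0 => k /mem_rem ki.
by apply: ltW; exact: star_tan_gt0.
Qed.

(** The cyclic shift permutes the neighbours. It converts sums over edges, with contributions from
    both sides, into sums over triangles. *)
Lemma sum_next (V : nmodType) (F : 'I_M -> V) :
  \sum_(j <- nbrs m i) F (nx j) = \sum_(j <- nbrs m i) F j.
Proof.
have U := tr_nbrs_uniq trm i.
rewrite -(big_map nx xpredT F); apply: perm_big; apply: uniq_perm => //.
  by rewrite map_inj_in_uniq // => a b _ _ /(congr1 (prev (nbrs m i))); rewrite !prev_next.
move=> a; apply/mapP/idP => [[b bi ->]|ai]; first by rewrite mem_next.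
by exists (prev (nbrs m i) a); rewrite ?mem_prev ?next_prev.
Qed.

Lemma sum_len (r : 'I_M -> R) :
  \sum_(j <- nbrs m i) r j * (len_L m x i j + len_R m x i j) =
  vol_dist m x i * \sum_(j <- nbrs m i) star_tan j * (r j + r (nx j)).
Proof.
under eq_bigr do rewrite mulrDr.
rewrite big_split /= -(sum_next (fun j => r j * len_L m x i j)) -big_split /= mulr_sumr.
rewrite big_seq [RHS]big_seq; apply: eq_bigr => j ji.
by rewrite len_LE // len_RE //; ring.
Qed.

Lemma sum_star_le (F : 'I_M -> R) b : (forall j, j \in nbrs m i -> `|F j| <= b * star_tan j) ->
  `|\sum_(j <- nbrs m i) F j| <= b * star_sum.
Proof.
move=> h; apply: le_trans (ler_norm_sum _ _ _) _; rewrite /star_sum mulr_sumr.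
by rewrite big_seq [leRHS]big_seq; apply: ler_sum => j; exact: h.
Qed.

(** The weights equal [star_tan j / star_sum]; they are positive and add up to 1. *)
Lemma weighted_mean_le (F : 'I_M -> R) a b : 0 < vol_dist m x i ->
  (forall j, j \in nbrs m i -> `|F j - a| <= b) ->
  `|\sum_(j <- nbrs m i) piece_area m x i j / vol_area m x i * F j - a| <= b.
Proof.
move=> dp h; have Th := star_sum_gt0.
have -> : \sum_(j <- nbrs m i) piece_area m x i j / vol_area m x i * F j - a =
    (\sum_(j <- nbrs m i) star_tan j * (F j - a)) / star_sum.
  under [in RHS]eq_bigr do rewrite mulrBr.
  rewrite sumrB -mulr_suml -/star_sum mulrBl mulrAC mulfV ?gt_eqF // mul1r; congr (_ - _).
  rewrite mulr_suml big_seq [RHS]big_seq; apply: eq_bigr => j ji.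
  rewrite piece_areaE // vol_areaE; field; rewrite !gt_eqF //.
rewrite normrM normfV (gtr0_norm Th) ler_pdivrMr //.
apply: sum_star_le => j ji; rewrite normrM (gtr0_norm (star_tan_gt0 ji)) mulrC.
by rewrite ler_wpM2r ?h // ltW // star_tan_gt0.
Qed.

(* The vectors [tau_j (e_j + e_{j+1})] are the edges [e_j - e_{j+1}] of the closed
   polygon of the [e_j], rotated by a right angle in the plane of each triangle;
   they sum to 0 if all these planes coincide. *)
Lemma rotated_sum (T n : 'rV[R]_3) b :
  (forall j, j \in nbrs m i -> enorm (tnormal S m t i j - n) <= b) ->
  `|\sum_(j <- nbrs m i) star_tan j * (dot T (e j) + dot T (e (nx j)))|
    <= 2 * b * enorm T * star_sum.
Proof.
move=> h.
have -> : \sum_(j <- nbrs m i) star_tan j * (dot T (e j) + dot T (e (nx j))) =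
    \sum_(j <- nbrs m i) dot T (cross (tnormal S m t i j - n) (e j - e (nx j))).
  (* With a fixed [n] in place of the triangle normals the sum telescopes; subtracting this zero
     leaves only the deviations of the normals. *)
  have z : \sum_(j <- nbrs m i) dot T (cross n (e j - e (nx j))) = 0.
    have -> : \sum_(j <- nbrs m i) dot T (cross n (e j - e (nx j))) =
        \sum_(j <- nbrs m i) (dot T (cross n (e j)) - dot T (cross n (e (nx j)))).
      by apply: eq_bigr => j _; rewrite -dotBr; congr dot; apply: rV3P; rewrite !rv3E; ring.
    by rewrite sumrB (sum_next (fun j => dot T (cross n (e j)))) subrr.
  rewrite -[LHS]subr0 -[X in _ - X]z -sumrB big_seq [RHS]big_seq; apply: eq_bigr => j ji.
  rewrite -dotDr -dotZr (half_tan_rotate g0 (sfr ji)) -dotBr; congr dot.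
  rewrite /tnormal crossDl; congr (_ + _); first exact/esym/crossZl.
  by apply: rV3P; rewrite !rv3E; ring.
apply: (@sum_star_le (fun j => dot T (cross (tnormal S m t i j - n) (e j - e (nx j))))
  (2 * b * enorm T)) => j ji; apply: le_trans (dot_le _ _) _.
have h1 := le_trans (enorm_cross_le _ _)
  (ler_pM (enorm_ge0 _) (enorm_ge0 _) (h j ji) (enormB_half_tan g0 (sfr ji))).
by have := ler_wpM2l (enorm_ge0 T) h1; rewrite /star_tan; lra.
Qed.

(** These three products determine the vector chosen by [xget]. An affine representation on the
    triangle exists because every nodal basis function has one. *)
Lemma flat_tgradP (u : 'I_M -> R) j : j \in nbrs m i ->
  let g := flat_tgrad x (fe_fun m t u) i j (nx j) in
  [/\ dot g (tnormal S m t i j) = 0, dot g (x j - x i) = u j - u i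
    & dot g (x (nx j) - x i) = u (nx j) - u i].
Proof.
move=> ji g; have [ij ik jk] := star_neq trm ji; have Km := star_tris trm ji.
set N := cross (x j - x i) (x (nx j) - x i).
have N0 : N != 0 by exact: (tr_nondeg trm tt Km).
have [a [b [ab gE]]] : exists a b,
    (forall y, hull x [set i; j; nx j]%SET y -> fe_fun m t u y = dot a y + b) /\
    g = tproj ((enorm N)^-1 *: N) a.
  rewrite /g /flat_tgrad -/N; case: xgetP => [y _ //|hno]; exfalso.
  have /choice[a /choice[b hab]] : forall l, exists a b, forall y,
      hull x [set i; j; nx j]%SET y -> hat m l (y, t) = dot a y + b.
    by move=> l; have [_ /(_ _ Km)] := tr_hat_Vh trm l tt.
  apply: (hno (tproj ((enorm N)^-1 *: N) (\sum_l u l *: a l))).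
  exists (\sum_l u l *: a l), (\sum_l u l * b l); split=> // y hy.
  have -> : dot (\sum_l u l *: a l) y = \sum_l u l * dot (a l) y.
    elim/big_rec2: _ => [|l s v _ <-]; first by rewrite dot0l.
    by rewrite dotDl dotZl.
  rewrite -big_split /=; apply: eq_bigr => l _.
  by rewrite (hab l y hy) mulrDr.
have nodal l : fe_fun m t u (x l) = u l.
  rewrite /fe_fun (bigD1 l) //= (tr_hat_delta trm) // eqxx mulr1 big1 ?addr0 //.
  by move=> k kl; rewrite (tr_hat_delta trm) // (negPf kl) mulr0.
have [Ti Tj Tk] := tri_vertices (x i) (x j - x i) (x (nx j) - x i).
rewrite !subrKC in Tj Tk.
have vE l : tri (x i) (x j - x i) (x (nx j) - x i) (x l) ->
    u l = dot a (x l) + b.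
  by move=> hl; rewrite -nodal // ab //; apply/hull3P.
have Ei := vE i Ti; have Ej := vE j Tj; have Ek := vE (nx j) Tk.
have tang w : dot N w = 0 -> dot g w = dot a w.
  by move=> Nw; rewrite gE /tproj dotBl (dotZl (dot a _)) (dotZl (enorm N)^-1) Nw !mulr0 subr0.
split.
- have nE : tnormal S m t i j = (enorm N)^-1 *: N.
    have l0 := edge_neq0 ji; have l1 := edge_neq0 (next_mem ji).
    rewrite -/(unitv N) /tnormal /edir [cross _ _]crossZl crossZr.
    by rewrite !unitvZ // invr_gt0.
  rewrite nE gE /tproj dotBl dotZl.
  have -> : dot ((enorm N)^-1 *: N) ((enorm N)^-1 *: N) = 1 by exact: unitv_unit.
  by rewrite mulr1 subrr.
- have t1 : dot N (x j - x i) = 0 by rewrite dotC; exact: dot_crossl.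
  by rewrite tang // dotBr Ej Ei; ring.
- have t1 : dot N (x (nx j) - x i) = 0 by rewrite dotC; exact: dot_crossr.
  by rewrite tang // dotBr Ek Ei; ring.
Qed.

End FixedMesh.
End Vertex.

(** * Errors of the Hamiltonian and of the viscosity term *)

Section Consistency.
Variable R : realType.
Implicit Type S : surface_data R.

Section FixedVertex.
Variables (S : surface_data R) (hstar gamma C d0 kap : R) (M : nat) (m : mesh R M) (t : R).
Hypotheses (g0 : 0 < gamma) (C0 : 0 < C) (d00 : 0 < d0) (kap0 : 0 < kap).
Hypothesis trm : triangulation S hstar gamma m.
Hypothesis tt : time_set S t.
Hypothesis tub : tubular C d0 (Gamma S t) (fun z => nu S (z, t)) (Gamma_h S m t)
  (fun y => Defs.proj S (y, t)).
Variable i : 'I_M.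

Local Notation x := (vtx S m t).
Local Notation nx := (next (nbrs m i)).
Local Notation e := (edir S m t i).
Local Notation D := (tdiam S m t i).
Local Notation n := (nu S (vtx S m t i, t)).

Hypothesis ratio : forall j j', j \in nbrs m i -> j' \in nbrs m i -> D j <= kap * D j'.

Definition star_size := seqmax [seq diam (hull x [set i; j; nx j]%SET) | j <- nbrs m i].

Lemma tdiam_le_size j : j \in nbrs m i -> D j <= star_size.
Proof. by move=> ji; apply: seqmax_ge; apply/mapP; exists j. Qed.

Lemma tdiam_gt0 j : j \in nbrs m i -> 0 < D j.
Proof. by move=> ji; have [] := star_shape g0 trm tt ji. Qed.

Lemma star_size_gt0 : 0 < star_size.
Proof.
have [j ji] := nbrs_nonempty trm i.
exact: lt_le_trans (tdiam_gt0 ji) (tdiam_le_size ji).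
Qed.

(** [6 * gamma ^+ 4] relates each contact distance to the diameter of its own triangle, and [kap]
    compares this diameter with the largest one at the vertex. *)
Lemma size_le_vol_dist : star_size <= 6 * gamma ^+ 4 * kap * vol_dist m x i.
Proof.
have gk : 0 < 6 * gamma ^+ 4 * kap by rewrite !mulr_gt0 // exprn_gt0.
rewrite mulrC -ler_pdivrMr //; apply: seqmin_ge.
  have [j ji] := nbrs_nonempty trm i; apply/eqP => h.
  have : contact_dist x i j (nx j) \in [seq contact_dist x i j (nx j) | j <- nbrs m i].
    by apply/mapP; exists j.
  by rewrite h.
move=> _ /mapP[j ji ->]; have [ij ik jk] := star_neq trm ji.
rewrite ler_pdivrMr //.
have h1 := contact_dist_ge ij ik jk g0 (star_shape g0 trm tt ji).
have h2 : star_size <= kap * D j.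
  apply: seqmax_le => [|_ /mapP[k ki ->]]; last exact: ratio.
  by rewrite mulr_ge0 // ltW // tdiam_gt0.
apply: le_trans h2 _; have := ler_wpM2l (ltW kap0) h1; lra.
Qed.

Lemma vol_dist_gt0 : 0 < vol_dist m x i.
Proof.
have := lt_le_trans star_size_gt0 size_le_vol_dist.
by rewrite pmulr_rgt0 // !mulr_gt0 // exprn_gt0.
Qed.

(** In the application [T] is the tangential gradient at the vertex, [u] the nodal values of [phi],
    and [uT] the Taylor estimate on the surface. *)
Variables (T : 'rV[R]_3) (u : 'I_M -> R) (K B1 : R).
Hypotheses (Tn : dot T n = 0) (TB : enorm T <= B1) (K0 : 0 <= K).
Hypothesis uT : forall j, `|u j - u i - dot T (x j - x i)| <= K * enorm (x j - x i) ^+ 2.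

Lemma edge_quotient j : j \in nbrs m i ->
  `|(u j - u i) / edge_len x i j - dot T (e j)| <= K * edge_len x i j.
Proof.
move=> ji; have l0 := edge_neq0 g0 trm tt ji.
have -> : (u j - u i) / edge_len x i j - dot T (e j) =
    (u j - u i - dot T (x j - x i)) / edge_len x i j.
  by rewrite (edge_edir g0 trm tt ji) (dotZr (edge_len x i j)); field; rewrite gt_eqF.
rewrite normrM normfV (gtr0_norm l0) ler_pdivrMr // -mulrA -expr2.
exact: uT.
Qed.

Lemma edge_quotient_size j : j \in nbrs m i ->
  `|(u j - u i) / edge_len x i j - dot T (e j)| <= K * star_size.
Proof.
move=> ji; apply: le_trans (edge_quotient ji) _; rewrite ler_wpM2l //.
by apply: le_trans (edge_le g0 trm tt ji) _; exact: tdiam_le_size.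
Qed.

(** Along the two edges the flat gradient reproduces the difference quotients, which agree with [T]
    up to [K] times the size. Along the triangle normal it vanishes, and [T] nearly does, being
    orthogonal to the nearby multiple of [n]. [frame_bound] combines the three components. *)
Lemma flat_tgrad_error j : j \in nbrs m i ->
  enorm (flat_tgrad x (fe_fun m t u) i j (nx j) - T) <=
    (8 * gamma ^+ 2 * C * B1 + 4 * gamma ^+ 2 * K) * star_size.
Proof.
move=> ji; have j'i := next_mem ji.
have [gn gj gk] := flat_tgradP g0 trm tt u ji.
set g := flat_tgrad _ _ _ _ _ in gn gj gk *.
have fr := star_frame g0 trm tt ji.
apply: le_trans (frame_bound (g - T) g0 fr) _; rewrite -/(tnormal S m t i j).
have ge l : l \in nbrs m i -> dot g (x l - x i) = u l - u i ->
    `|dot (g - T) (e l)| <= K * star_size.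
  move=> li gl; have l0 := edge_neq0 g0 trm tt li.
  apply: le_trans _ (edge_quotient_size li).
  rewrite dotBl -gl (edge_edir g0 trm tt li) (dotZr (edge_len x i l)) mulrAC mulfV ?mul1r //.
  by rewrite gt_eqF.
have h1 := ge j ji gj; have h2 := ge _ j'i gk.
have [s hs near_n] := tnormal_near g0 C0 trm tt tub ji.
have h3 : `|dot (g - T) (tnormal S m t i j)| <= B1 * (8 * gamma ^+ 2 * (C * star_size)).
  have -> : dot (g - T) (tnormal S m t i j) = - dot T (tnormal S m t i j - s *: n).
    by rewrite dotBl gn dotBr (dotZr s) Tn mulr0 subr0 sub0r.
  rewrite normrN; apply: le_trans (dot_le _ _) _; apply: ler_pM; rewrite ?enorm_ge0 //.
  apply: le_trans near_n _; have g8 : 0 <= 8 * gamma ^+ 2 by rewrite mulr_ge0 // sqr_ge0.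
  by apply: (ler_wpM2l g8); apply: (ler_wpM2l (ltW C0)); exact: tdiam_le_size.
have h4 := ler_wpM2l (sqr_ge0 gamma) (lerD h1 h2).
by move: h3 h4; lra.
Qed.

Definition fold_size := Num.min (overlap_size C d0 gamma (1 / (2 * gamma)))
  (1 / (64 * gamma ^+ 3 * C)).

Lemma fold_size_gt0 : 0 < fold_size.
Proof.
have h : 0 < gamma ^+ 3 * C by rewrite mulr_gt0 // exprn_gt0.
rewrite lt_min overlap_size_gt0 //=; first by rewrite divr_gt0 // -mulrA mulr_gt0.
by rewrite divr_gt0 // mulr_gt0.
Qed.

(** Small stars are oriented and [rotated_sum] applies. In a large star each term is at most
    [2 * B1] times its weight, and the factor [star_size / fold_size], at least 1, makes this bound
    linear in the size. *)
Lemma rotated_sum_size :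
  `|\sum_(j <- nbrs m i) star_tan S m t i j * (dot T (e j) + dot T (e (nx j)))| <=
    (16 * gamma ^+ 2 * C + 2 / fold_size) * B1 * star_size * star_sum S m t i.
Proof.
have f0 := fold_size_gt0; have s0 := star_size_gt0.
have B10 : 0 <= B1 by exact: le_trans (enorm_ge0 _) TB.
have Th0 := star_sum_gt0 g0 trm tt i.
have gC : 0 <= gamma ^+ 2 * C by rewrite mulr_ge0 ?sqr_ge0 // ltW.
have [small|big] := leP star_size fold_size.
  have small1 j : j \in nbrs m i -> D j <= overlap_size C d0 gamma (1 / (2 * gamma)).
    move=> ji; apply: le_trans (tdiam_le_size ji) (le_trans small _).
    by rewrite ge_min lexx.
  have small2 j : j \in nbrs m i -> 64 * gamma ^+ 3 * (C * D j) <= 1.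
    move=> ji; have h : 0 < 64 * gamma ^+ 3 * C by rewrite mulr_gt0 // mulr_gt0 // exprn_gt0.
    rewrite mulrA mulrC -ler_pdivlMr //.
    apply: le_trans (tdiam_le_size ji) (le_trans small _).
    by rewrite ge_min lexx orbT.
  have [s hs near_n] := star_orientation g0 C0 d00 trm tt tub small1 small2.
  have near_size j : j \in nbrs m i -> enorm (tnormal S m t i j - s *: n) <=
      8 * gamma ^+ 2 * (C * star_size).
    move=> ji; apply: le_trans (near_n j ji) _.
    have g8 : 0 <= 8 * gamma ^+ 2 by rewrite mulr_ge0 // sqr_ge0.
    by apply: (ler_wpM2l g8); apply: (ler_wpM2l (ltW C0)); exact: tdiam_le_size.
  apply: le_trans (rotated_sum g0 trm tt T near_size) _.
  rewrite ler_wpM2r ?(ltW Th0) //.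
  have h1 : 0 <= gamma ^+ 2 * C * star_size by rewrite mulr_ge0 // ltW.
  have h2 := ler_wpM2l h1 TB.
  have h3 : 0 <= 2 / fold_size * B1 * star_size.
    by rewrite mulr_ge0 ?(ltW s0) // mulr_ge0 // divr_ge0 // ltW.
  lra.
have h : `|\sum_(j <- nbrs m i) star_tan S m t i j * (dot T (e j) + dot T (e (nx j)))| <=
    2 * B1 * star_sum S m t i.
  apply: (sum_star_le (F := fun j => star_tan S m t i j * (dot T (e j) + dot T (e (nx j))))) => j ji.
  have st := star_tan_gt0 g0 trm tt ji; have [ee ff _] := star_frame g0 trm tt ji.
  rewrite normrM (gtr0_norm st) mulrC ler_wpM2r ?(ltW st) //.
  apply: le_trans (ler_normD _ _) _.
  have de v : dot v v = 1 -> `|dot T v| <= B1.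
    by move=> /enorm_unit v1; apply: le_trans (dot_le _ _) _; rewrite v1 mulr1.
  by have := de _ ee; have := de _ ff; lra.
apply: le_trans h _; rewrite ler_wpM2r ?(ltW Th0) //.
have h1 : 1 <= star_size / fold_size by rewrite ler_pdivlMr // mul1r ltW.
have h2 := ler_wpM2l B10 h1.
have h3 : 0 <= gamma ^+ 2 * C * B1 * star_size by rewrite !mulr_ge0 ?sqr_ge0 // ltW.
have -> : (16 * gamma ^+ 2 * C + 2 / fold_size) * B1 * star_size =
  16 * (gamma ^+ 2 * C * B1 * star_size) + 2 * (B1 * (star_size / fold_size)) by ring.
lra.
Qed.

(** [eps / vol_dist] stays bounded, since [eps] is at most [C1] times a size that [vol_dist]
    controls. The weighted sum over [star_sum] is of the order of the size: the part of [T] cancels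
    by rotation, and the rest is the Taylor error of the difference quotients. *)
Lemma viscosity_error eps C1 : 0 <= eps -> eps <= C1 * star_size ->
  `|eps / vol_area m x i * \sum_(j <- nbrs m i) (u j - u i) / edge_len x i j *
      (len_L m x i j + len_R m x i j)| <=
  C1 * (6 * gamma ^+ 4 * kap) *
    (2 * K + (16 * gamma ^+ 2 * C + 2 / fold_size) * B1) * star_size.
Proof.
move=> eps0 epsC; have dp := vol_dist_gt0; have s0 := star_size_gt0.
have Th0 := star_sum_gt0 g0 trm tt i.
set Z := (16 * _ * _ + _) * B1.
pose r j := (u j - u i) / edge_len x i j.
have -> : \sum_(j <- nbrs m i) (u j - u i) / edge_len x i j * (len_L m x i j + len_R m x i j) =
    vol_dist m x i * \sum_(j <- nbrs m i) star_tan S m t i j * (r j + r (nx j)).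
  exact: (sum_len g0 trm tt (ltW dp)).
set A := \sum_(j <- nbrs m i) star_tan S m t i j * (r j + r (nx j)).
have AB : `|A| <= (2 * K + Z) * star_size * star_sum S m t i.
  have -> : A = \sum_(j <- nbrs m i) star_tan S m t i j * (dot T (e j) + dot T (e (nx j))) +
      \sum_(j <- nbrs m i) star_tan S m t i j *
        ((r j - dot T (e j)) + (r (nx j) - dot T (e (nx j)))).
    by rewrite -big_split /=; apply: eq_bigr => j _; ring.
  apply: le_trans (ler_normD _ _) _.
  have h1 := rotated_sum_size; rewrite -/Z in h1.
  have h2 : `|\sum_(j <- nbrs m i) star_tan S m t i j *
        ((r j - dot T (e j)) + (r (nx j) - dot T (e (nx j))))| <=
      2 * K * star_size * star_sum S m t i.
    apply: (sum_star_le (F := fun j => star_tan S m t i j *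
        ((r j - dot T (e j)) + (r (nx j) - dot T (e (nx j)))))) => j ji.
    have st := star_tan_gt0 g0 trm tt ji.
    rewrite normrM (gtr0_norm st) mulrC ler_wpM2r ?(ltW st) //.
    apply: le_trans (ler_normD _ _) _.
    by have := edge_quotient_size ji; have := edge_quotient_size (next_mem ji); rewrite /r; lra.
  by apply: le_trans (lerD h1 h2) _; lra.
have Zs0 : 0 <= (2 * K + Z) * star_size.
  by have := le_trans (normr_ge0 _) AB; rewrite pmulr_lge0.
rewrite (vol_areaE g0 trm tt (ltW dp)).
have -> : eps / (vol_dist m x i ^+ 2 * star_sum S m t i) * (vol_dist m x i * A) =
    eps / vol_dist m x i * (A / star_sum S m t i) by field; rewrite !gt_eqF.
rewrite normrM ger0_norm; last by rewrite divr_ge0 // ltW.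
have h1 : `|A / star_sum S m t i| <= (2 * K + Z) * star_size.
  by rewrite normrM normfV (gtr0_norm Th0) ler_pdivrMr.
have h2 : eps / vol_dist m x i <= C1 * (6 * gamma ^+ 4 * kap).
  have C10 : 0 <= C1 by have := le_trans eps0 epsC; rewrite pmulr_lge0.
  rewrite ler_pdivrMr //; apply: le_trans epsC _; rewrite -(mulrA C1).
  by apply: (ler_wpM2l C10); exact: size_le_vol_dist.
rewrite -[leRHS]mulrA; apply: ler_pM => //.
by rewrite divr_ge0 // ltW.
Qed.

Lemma hamiltonian_error (Hp : 'rV[R]_3 -> R) L2 : 0 <= L2 ->
  (forall p q, `|Hp p - Hp q| <= L2 * enorm (p - q)) ->
  `|\sum_(j <- nbrs m i) piece_area m x i j / vol_area m x i *
      Hp (flat_tgrad x (fe_fun m t u) i j (nx j)) - Hp T| <=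
  L2 * ((8 * gamma ^+ 2 * C * B1 + 4 * gamma ^+ 2 * K) * star_size).
Proof.
move=> L20 hH.
apply: (weighted_mean_le g0 trm tt (ltW vol_dist_gt0)
  (F := fun j => Hp (flat_tgrad x (fe_fun m t u) i j (nx j)))) => [|j ji].
  exact: vol_dist_gt0.
by apply: le_trans (hH _ _) _; rewrite ler_wpM2l // flat_tgrad_error.
Qed.

End FixedVertex.

(** The supremum over all times dominates its elements only because the diameters are bounded, which
    follows from [Phi_bounded]. *)
Lemma tdiam_mesh_size S hstar gamma M (m : mesh R M) t i j :
  evolving_surface S -> 0 < gamma -> triangulation S hstar gamma m -> time_set S t ->
  j \in nbrs m i -> tdiam S m t i j <= mesh_size S m.
Proof.
move=> surf g0 trm tt ji; have [B B0 hB] := Phi_bounded surf.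
apply: ub_le_sup; last by exists t, [set i; j; next (nbrs m i) j]%SET; split=> //; exact: (star_tris trm).
exists (6 * gamma * B) => _ [t' [K [tt' Km ->]]].
have /card_gt0P[k kK] : (0 < #|K|)%N by rewrite (tr_card trm Km).
have : K \in [set K in tris m | k \in K]%SET by rewrite finset.inE Km.
rewrite (tr_nbrs_tris trm) => /imsetP[l lk ->].
exact: (tdiam_bound surf g0 trm tt' hB lk).
Qed.

Lemma time_grid_mem S N (t : nat -> R) n : time_grid S N t -> (n <= N)%N -> time_set S (t n).
Proof.
move=> [t0 tN tS] nN.
have inc k l : (k + l <= N)%N -> t k <= t (k + l)%N.
  elim: l => [|l IH]; first by rewrite addn0.
  rewrite addnS => h; apply: le_trans (IH (ltnW h)) _.
  exact/ltW/tS.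
apply/andP; split; first by rewrite -t0; exact: (inc 0%N).
by rewrite -tN -(subnKC nN); apply: inc; rewrite subnKC.
Qed.

Lemma sup_norm_cases (T : Type) (A : set T) (f : T -> R) p : A p ->
  sup_norm A f = +oo%E \/
  exists B, [/\ 0 <= B, sup_norm A f = B%:E & forall q, A q -> `|f q| <= B].
Proof.
move=> Ap; have ub q : A q -> (`|f q|%:E <= sup_norm A f)%E.
  by move=> Aq; apply: ereal_sup_ubound; exists q.
case: (sup_norm A f) ub => [B| |] ub; [right|by left|].
- exists B; split=> //.
  by have := ub p Ap; rewrite lee_fin; exact: le_trans.
- by have := ub p Ap.
Qed.

Lemma sup_norm_neqNy (T : Type) (A : set T) (f : T -> R) p : A p ->
  sup_norm A f != -oo%E.
Proof. by move=> Ap; have [->|[B [_ -> _]]] := sup_norm_cases f Ap. Qed.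

End Consistency.

Theorem lemma4p2 (R : realType) (S : surface_data R)
    (hstar gamma L2 C0 C1 C2 : R)
    (surfS : evolving_surface S)
    (hstar_gt0 : 0 < hstar) (gamma_gt0 : 0 < gamma) (L2_gt0 : 0 < L2)
    (C0_gt0 : 0 < C0) (C1_gt0 : 0 < C1) (C2_gt0 : 0 < C2)
    (monoC : monotonicity_constants S hstar gamma L2 C0 C1 C2) :
  exists C3 : R, 0 < C3 /\
  forall (L1 : R) (H : 'rV[R]_3 * R -> 'rV[R]_3 -> R)
    (M : nat) (m : mesh R M) (N : nat) (t : nat -> R)
    (eps : nat -> 'I_M -> R),
    0 < L1 -> hamiltonian S L1 L2 H ->
    triangulation S hstar gamma m -> time_grid S N t ->
    (forall n i, (n < N)%N -> 0 < eps n i) ->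
    mesh_condition S C0 C1 C2 m N t eps ->
  forall phi : 'rV[R]_3 * R -> R, Ck_on 2 (STbar S) phi ->
  forall (n : nat) (i : 'I_M), (n < N)%N ->
  let phi_n k := fun j : 'I_M => phi (vtx S m (t k) j, t k) in
  let p := (vtx S m (t n) i, t n) in
  (`|(phi_n n.+1 i - scheme_coef S H m t eps n (phi_n n) i) / (t n.+1 - t n)
     - (matder S phi p + H p (tgrad S phi p))|%:E
   <= (C3 * mesh_size S m)%:E *
      (sup_norm (STbar S) (fun q => enorm (tgrad S phi q))
       + sup_norm (STbar S) (fun q => frobenius (tgrad2 S phi q))
       + sup_norm (STbar S) (matder S (matder S phi))))%E.
Proof.
have [C Cp hC] := normal_quadratic surfS.
have [d0 d0p hd0] := normal_tube surfS.
have [CT CTp hCT] := surface_taylor surfS.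
have [kap kapp hkap] := star_ratio hstar surfS gamma_gt0 Cp d0p.
(* The constants of [hamiltonian_error] and [viscosity_error] for [K = CT * (B1 + B2)], freed from
   the norms of [phi]. *)
pose CH := L2 * (8 * gamma ^+ 2 * C + 4 * gamma ^+ 2 * CT).
pose CE := C1 * (6 * gamma ^+ 4 * kap) *
  (2 * CT + (16 * gamma ^+ 2 * C + 2 / fold_size gamma C d0)).
have g2 : 0 < gamma ^+ 2 by rewrite exprn_gt0.
have g4 : 0 < gamma ^+ 4 by rewrite exprn_gt0.
have f0 := fold_size_gt0 gamma_gt0 Cp d0p.
have CHp : 0 < CH by rewrite mulr_gt0 // addr_gt0 // !mulr_gt0.
have CEp : 0 < CE.
  rewrite mulr_gt0 //; first by rewrite mulr_gt0 // mulr_gt0 // mulr_gt0.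
  by rewrite !addr_gt0 // ?divr_gt0 // !mulr_gt0.
exists (C2 + CH + CE); split; first by rewrite !addr_gt0.
move=> L1 H M m N t eps L1p hH trm grid epsp mc phi cphi n i nN.
pose phi_n k j := phi (vtx S m (t k) j, t k); pose p := (vtx S m (t n) i, t n).
rewrite -/p -/(phi_n n) -/(phi_n n.+1) /=.
have tn := time_grid_mem grid (ltnW nN); have tn1 := time_grid_mem grid nN.
have [_ _ /(_ n nN) tlt] := grid.
have h0 : 0 < mesh_size S m by have /andP[] := tr_size trm.
have pS : STbar S p by split=> //; exact: (vtx_Gamma _ trm).
have Ch : 0 < (C2 + CH + CE) * mesh_size S m by rewrite mulr_gt0 // !addr_gt0.
set A1 := sup_norm _ (fun q => enorm _); set A2 := sup_norm _ (fun q => frobenius _).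
set A3 := sup_norm _ (matder _ _).
have A1N : A1 != -oo%E by exact: sup_norm_neqNy pS.
have A2N : A2 != -oo%E by exact: sup_norm_neqNy pS.
have A3N : A3 != -oo%E by exact: sup_norm_neqNy pS.
have A12N : (A1 + A2)%E != -oo%E by rewrite adde_eq_ninfty negb_or A1N A2N.
(* An infinite norm makes the right-hand side infinite, since the factor in front is positive;
   otherwise all three norms are real numbers. *)
case: (sup_norm_cases (fun q => enorm (tgrad S phi q)) pS) => [E1|[B1 [B10 E1 hB1]]].
  by rewrite /A1 E1 addye // addye // gt0_muley ?lte_fin // leey.
case: (sup_norm_cases (fun q => frobenius (tgrad2 S phi q)) pS) => [E2|[B2 [B20 E2 hB2]]].
  by rewrite /A2 E2 addey // addye // gt0_muley ?lte_fin // leey.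
case: (sup_norm_cases (matder S (matder S phi)) pS) => [E3|[B3 [B30 E3 hB3]]].
  by rewrite /A3 E3 addey // gt0_muley ?lte_fin // leey.
rewrite /A1 /A2 /A3 E1 E2 E3 -!EFinD -EFinM lee_fin.
have {}hB1 q : STbar S q -> enorm (tgrad S phi q) <= B1.
  by move=> /hB1; rewrite ger0_norm // enorm_ge0.
have {}hB2 q : STbar S q -> frobenius (tgrad2 S phi q) <= B2.
  by move=> /hB2; rewrite ger0_norm // sqrtr_ge0.
have tub := tubular_surface surfS trm tn hC hd0.
have ratio j j' : j \in nbrs m i -> j' \in nbrs m i ->
    tdiam S m (t n) i j <= kap * tdiam S m (t n) i j' by exact: hkap.
have Tn : dot (tgrad S phi p) (nu S p) = 0.
  by apply: tgrad_orth => //; exact: is_tgrad_exists.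
have TB := hB1 _ pS.
pose K := CT * (B1 + B2).
have K0 : 0 <= K by rewrite mulr_ge0 ?addr_ge0 // ltW.
have uT j : `|phi_n n j - phi_n n i - dot (tgrad S phi p) (vtx S m (t n) j - vtx S m (t n) i)|
    <= K * enorm (vtx S m (t n) j - vtx S m (t n) i) ^+ 2.
  by apply: (hCT phi B1 B2) => //; exact: (vtx_Gamma _ trm).
have [/(_ i) /= /andP[_ epsC] tauC] := mc n nN.
have hs : star_size S m (t n) i <= mesh_size S m.
  apply: seqmax_le; first exact: ltW.
  by move=> _ /mapP[j ji ->]; exact: (tdiam_mesh_size surfS gamma_gt0 trm tn ji).
have s0 := star_size_gt0 gamma_gt0 trm tn i.
(* The shortest edge in the mesh condition is at most any edge at [i], and thus at most the mesh
   size. *)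
have tau_h : t n.+1 - t n <= C2 * mesh_size S m.
  apply: le_trans tauC _; rewrite ler_wpM2l ?(ltW C2_gt0) //.
  have [j ji] := nbrs_nonempty trm i.
  apply: le_trans (seqmin_le (a := edge_len (vtx S m (t n)) i j) _) _.
    by apply/allpairsPdep; exists i, j; rewrite mem_enum.
  apply: le_trans (edge_le gamma_gt0 trm tn ji) _.
  exact: (tdiam_mesh_size surfS gamma_gt0 trm tn ji).
have e1 := time_taylor surfS cphi (tr_vtx0 trm i) tlt tn tn1 hB3.
have e2 := hamiltonian_error gamma_gt0 Cp kapp trm tn tub ratio Tn TB K0 uT
  (ltW L2_gt0) (fun P Q => hH.2 p P Q pS).
have e3 := viscosity_error gamma_gt0 Cp d0p kapp trm tn tub ratio TB K0 uT
  (ltW (epsp n i nN)) epsC.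
rewrite /scheme_coef.
set X1 := \sum_(j <- nbrs m i) _ in e2 *; set X2 := eps n i / _ * _ in e3 *.
(* Division by the time step separates the time difference, the Hamiltonian and the viscosity. *)
have -> : (phi_n n.+1 i - (phi_n n i - (t n.+1 - t n) * (X1 - X2))) / (t n.+1 - t n)
    - (matder S phi p + H p (tgrad S phi p)) =
    ((phi_n n.+1 i - phi_n n i) / (t n.+1 - t n) - matder S phi p)
    + (X1 - H p (tgrad S phi p)) - X2.
  by field; rewrite subr_eq0 gt_eqF.
apply: le_trans (ler_normB _ _) _; apply: le_trans (lerD (ler_normD _ _) (lexx _)) _.
pose W := B1 + B2 + B3; have W0 : 0 <= W by rewrite !addr_ge0.
have B1W : B1 <= W by rewrite /W; clear -B10 B20 B30; lra.
have B2W : B1 + B2 <= W by rewrite /W; clear -B10 B20 B30; lra.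
have B3W : B3 <= W by rewrite /W; clear -B10 B20 B30; lra.
have f1 : B3 * (t n.+1 - t n) <= C2 * mesh_size S m * W.
  by rewrite mulrC; apply: ler_pM => //; rewrite subr_ge0 ltW.
have f2 : L2 * ((8 * gamma ^+ 2 * C * B1 + 4 * gamma ^+ 2 * K) * star_size S m (t n) i) <=
    CH * mesh_size S m * W.
  have a1 : 0 <= gamma ^+ 2 * C by rewrite mulr_ge0 // ltW.
  have a2 : 0 <= gamma ^+ 2 * CT by rewrite mulr_ge0 // ltW.
  rewrite /CH -!(mulrA L2); apply: (ler_wpM2l (ltW L2_gt0)).
  rewrite [leRHS]mulrAC.
  apply: ler_pM => //; [|exact: ltW|].
    by move: (mulr_ge0 a1 B10) (mulr_ge0 (ltW g2) K0); clear; lra.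
  by move: (ler_wpM2l a1 B1W) (ler_wpM2l a2 B2W); rewrite /K; clear; lra.
have f3 : C1 * (6 * gamma ^+ 4 * kap) *
    (2 * K + (16 * gamma ^+ 2 * C + 2 / fold_size gamma C d0) * B1) * star_size S m (t n) i <=
    CE * mesh_size S m * W.
  have a0 : 0 <= C1 * (6 * gamma ^+ 4 * kap).
    by rewrite mulr_ge0 ?(ltW C1_gt0) // mulr_ge0 ?(ltW kapp) // mulr_ge0 // ltW.
  rewrite /CE -!(mulrA (C1 * (6 * gamma ^+ 4 * kap))); apply: (ler_wpM2l a0).
  set Y := 16 * _ * _ + _; have Y0 : 0 <= Y.
    by rewrite addr_ge0 ?divr_ge0 ?(ltW f0) // !mulr_ge0 // ltW.
  rewrite [leRHS]mulrAC.
  apply: ler_pM => //; [|exact: ltW|].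
    by rewrite addr_ge0 // mulr_ge0.
  by move: (ler_wpM2l Y0 B1W) (ler_wpM2l (ltW CTp) B2W); rewrite /K; clear; lra.
rewrite -/W; move: (lerD (lerD (le_trans e1 f1) (le_trans e2 f2)) (le_trans e3 f3)).
by clear; lra.
Qed.
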